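(* Let $\psi\in C^3(\mathbb{R}^2)$ satisfy $\Delta\psi+f(\psi)=0$ in $\mathbb{R}^2$ for some $f\in C(\mathbb{R})$. If $\nabla\psi$ is compactly supported, then $\psi$ is locally radial in the following sense: the set $D:=\{x\in\mathbb{R}^2:\nabla\psi(x)\neq0\}$ can be written as $D=\bigcup_{i\in I}A_i$, where $I$ is countable and $\{A_i\}_{i\in I}$ are pairwise disjoint annuli or disks, and $\psi$ is radially symmetric (with respect to the center of $A_i$) in each $A_i$. *)

(* Defs.v *)
From Stdlib Require Import Reals.
From Coquelicot Require Import Coquelicot.
Open Scope R_scope.

Definition dx (u : R -> R -> R) : R -> R -> R :=
  fun x y => Derive (fun t => u t y) x.
Definition dy (u : R -> R -> R) : R -> R -> R :=
  fun x y => Derive (fun t => u x t) y.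

Definition cont2 (u : R -> R -> R) : Prop :=
  forall x y : R, continuous (fun p : R * R => u (fst p) (snd p)) (x, y).

Fixpoint Ck (k : nat) (u : R -> R -> R) : Prop :=
  match k with
  | O => cont2 u
  | S k' =>
      cont2 u /\
      (forall x y : R, ex_derive (fun t => u t y) x /\ ex_derive (fun t => u x t) y) /\
      Ck k' (dx u) /\ Ck k' (dy u)
  end.

Definition lap (u : R -> R -> R) : R -> R -> R :=
  fun x y => dx (dx u) x y + dy (dy u) x y.

Definition dist2 (x y a b : R) : R := sqrt ((x - a) ^ 2 + (y - b) ^ 2).

(* A is an open annulus {r1 < |p - c| < r2} (0 <= r1 < r2; r1 = 0 gives a
   punctured disk) or an open disk {|p - c| < r2}, centred at c = (a,b). *)
Definition annulus_or_disk (A : R -> R -> Prop) (a b : R) : Prop :=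
  exists r1 r2 : R,
    (0 <= r1 < r2 /\ forall x y, A x y <-> (r1 < dist2 x y a b < r2)) \/
    (0 < r2 /\ forall x y, A x y <-> dist2 x y a b < r2).

Definition countable_type (I : Type) : Prop :=
  exists g : I -> nat, forall i j, g i = g j -> i = j.

(* Main.v *)
(** Off a box [psi] is a constant [c], and [f c = 0]. If [c] were taken at a regular point, [f]
    would be Lipschitz at [c]; conservation of the Hamiltonian (the integral in [y] of
    [psi_x^2 - psi_y^2 + 2 F(psi)]) would then give [H'' >= H'^2 / H - K H] for
    [H x], the integral of [(psi x y - c)^2] in [y], so that [H] could not reach [0] and [psi]
    would be constant. Hence [psi - c] vanishes together with its gradient on the level [c], and
    then also with its Hessian, which is traceless there: so [u = max (psi - c) 0] has the second
    order expansion of a solution.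

    Quantize [u] on a fine lattice and let every interval of every row of every superlevel set
    move towards the origin with speed equal to its midpoint (Brock's continuous Steiner
    symmetrization). By the equation, the interaction of successive rows is stationary up to a
    small error. On the other hand each pair of intervals in successive rows contributes a
    nonnegative amount, and a definite one if a chord of a superlevel set has end gradients which
    are not mirror images of each other. This gives the reflection law: the gradients at the ends
    of a chord of a superlevel set above [c] are symmetric about its bisector.

    Turning a chord around one of its ends [A], the reflection law becomes a differential equation
    for its length, whose solution says that the other end runs through a circle. So the regular
    points above the level [c] lie on circles on which [psi] is constant and the gradient is
    radial; differentiating the gradient along these circles shows that their centers are locally
    constant. Below the level [c] one uses [- psi]. *)

From Stdlib Require Import Reals Lra ZArith Classical ClassicalEpsilon.
From Coquelicot Require Import Coquelicot.
From HB Require Import structures.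
From mathcomp Require Import ssreflect ssrfun ssrbool eqtype ssrnat seq choice fintype bigop zify.
Require Import Defs.
Open Scope R_scope.

(** The obstacle is that [f] is merely continuous: the difference of a solution and its mirror image
    solves no usable linear equation, so comparison arguments fail. The symmetrization uses only
    that [f(psi)] depends on the level, which is the same at both ends of an interval. Quantizing
    makes the first variation of the interaction a finite sum over pairs of intervals, whatever the
    level sets look like; no flow has to be constructed, since only its derivative at time zero is
    used. A row interacts with windows in the two adjacent rows whose width is comparable with the
    row distance [s], so that the displacement of an end from one row to the next is seen by the
    overlap. After normalization an asymmetric chord yields a gain of order [s^2], and the error is
    of order [w s^2 + d + eps], with [w] a bound for the oscillation of [f], [d] the mesh and [eps]
    the level step. A kink of [max (psi - c) 0] would give errors of order at least [s^2], which
    cannot be beaten; this is why the level [c] has to be flat to second order. *)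

HB.instance Definition _ := Monoid.isComLaw.Build R 0 Rplus
  (fun x y z => esym (Rplus_assoc x y z)) Rplus_comm Rplus_0_l.
HB.instance Definition _ := Monoid.isMulLaw.Build R 0 Rmult Rmult_0_l Rmult_0_r.
HB.instance Definition _ :=
  Monoid.isAddLaw.Build R Rmult Rplus Rmult_plus_distr_r Rmult_plus_distr_l.

Notation "\rsum_ ( i < n ) F" := (\big[Rplus/0]_(i < n) F)
  (at level 41, F at level 41, i, n at level 50).

(** * Finite sums of real numbers *)

Lemma rsum_le (I : finType) (P : pred I) (F G : I -> R) :
  (forall i, P i -> F i <= G i) ->
  \big[Rplus/0]_(i | P i) F i <= \big[Rplus/0]_(i | P i) G i.
Proof.
move=> H; apply: (big_ind2 Rle) => //; [lra | move=> *; lra].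
Qed.

Lemma rsum_ge0 (I : finType) (P : pred I) (F : I -> R) :
  (forall i, P i -> 0 <= F i) -> 0 <= \big[Rplus/0]_(i | P i) F i.
Proof.
move=> H; apply: (big_ind (fun x => 0 <= x)) => //; [lra | move=> *; lra].
Qed.

Lemma rsum_ge_term (I : finType) (P : pred I) (F : I -> R) i :
  P i -> (forall i, P i -> 0 <= F i) -> F i <= \big[Rplus/0]_(i | P i) F i.
Proof.
move=> Pi H; rewrite (bigD1 i Pi) /=.
have : 0 <= \big[Rplus/0]_(j | P j && (j != i)) F j.
  by apply: rsum_ge0 => j /andP[Pj _]; exact: H.
by move=> *; lra.
Qed.

Lemma rsum_const (n : nat) (c : R) : \rsum_(i < n) c = INR n * c.
Proof.
elim: n => [|n IH]; first by rewrite big_ord0 /=; lra.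
by rewrite big_ord_recr IH S_INR /=; lra.
Qed.

Lemma rsum_indicator (m lo hi : nat) :
  \rsum_(k < m) (if (lo <= k < hi)%N then 1 else 0) = INR (minn m hi - lo).
Proof.
elim: m => [|m IH]; first by rewrite big_ord0 min0n.
rewrite big_ord_recr IH /=; case: ifP => h.
  have -> : (minn m.+1 hi - lo = (minn m hi - lo).+1)%N by lia.
  by rewrite S_INR.
have -> : (minn m.+1 hi - lo = minn m hi - lo)%N by lia.
lra.
Qed.

Lemma rsum_window (F : nat -> R) K k0 m c :
  (forall i, 0 <= F i) -> (k0 + m <= K)%N ->
  (forall i, (i < m)%N -> c <= F (k0 + i)%N) ->
  INR m * c <= \rsum_(k < K) F k.
Proof.
move=> F0 hK hc.
rewrite -(big_mkord xpredT F) (@big_cat_nat _ _ _ k0) //=; last lia.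
rewrite (@big_cat_nat _ _ _ (k0 + m) k0 K) //=; last lia.
rewrite -{2}[k0]add0n big_addn addKn !big_mkord.
have h1 : 0 <= \rsum_(i < k0) F i by apply: rsum_ge0.
have h2 : 0 <= \big[Rplus/0]_(k0 + m <= i < K) F i.
  by rewrite -[(k0 + m)%N]add0n big_addn big_mkord; apply: rsum_ge0.
have h3 : \rsum_(i < m) c <= \rsum_(i < m) F (i + k0)%N.
  by apply: rsum_le => i _; rewrite addnC; apply: hc; exact: ltn_ord.
rewrite rsum_const in h3; move: h1 h2 h3 => /=; lra.
Qed.

(** * Superlevel sets of integer sequences *)

(* [a, b) is a maximal interval of {v > k}. At a = 0, where a.-1 = 0, this is impossible as soon
   as v 0 = 0. *)
Definition isrun (v : nat -> nat) (k a b : nat) : bool :=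
  [&& (a < b)%N, (v a.-1 <= k)%N, (v b <= k)%N
    & all (fun i => k < v i)%N (iota a (b - a))].

Lemma isrunP v k a b :
  reflect [/\ (a < b)%N, (v a.-1 <= k)%N, (v b <= k)%N
            & forall i, (a <= i < b)%N -> (k < v i)%N] (isrun v k a b).
Proof.
apply: (iffP and4P) => -[h1 h2 h3 h4]; split=> //.
  move=> i hi; move/allP: h4; apply; rewrite mem_iota; lia.
by apply/allP => i; rewrite mem_iota => hi; apply: h4; lia.
Qed.

Lemma isrun_exists v k x n :
  v 0%N = 0%N -> (forall i, (n <= i)%N -> v i = 0%N) -> (k < v x)%N ->
  exists a b, isrun v k a b /\ (a <= x < b)%N.
Proof.
move=> v0 vn kx.
have xn : (x < n)%N by case: (ltnP x n) => // /vn h; rewrite h in kx.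
have exb : exists b, (x < b)%N && (v b <= k)%N.
  by exists n; rewrite xn vn.
have exa : exists a, (a < x)%N && (v a <= k)%N.
  exists 0%N; rewrite v0 /= andbT; case: x kx {xn exb} => //; by rewrite v0.
have bda : forall a, (a < x)%N && (v a <= k)%N -> (a <= x)%N by move=> a; lia.
exists (ex_maxn exa bda).+1, (ex_minn exb).
case: ex_maxnP => a /andP[ax va] amax; case: ex_minnP => b /andP[xb vb] bmin.
split; last lia.
apply/isrunP; split=> //; first lia.
move=> i hi; rewrite ltnNge; apply/negP => vi.
have [ix|xi] := leqP x i.
  have /bmin : (x < i)%N && (v i <= k)%N.
    rewrite vi andbT ltn_neqAle ix andbT; apply/eqP => e; rewrite -e in vi; lia.
  lia.
have /amax : (i < x)%N && (v i <= k)%N by rewrite xi vi.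
lia.
Qed.

Lemma isrun_uniq v k x a b a' b' :
  isrun v k a b -> isrun v k a' b' -> (a <= x < b)%N -> (a' <= x < b')%N ->
  (0 < a)%N -> (0 < a')%N -> a = a' /\ b = b'.
Proof.
move=> /isrunP[h1 h2 h3 h4] /isrunP[g1 g2 g3 g4] hx gx pa pa'; split.
  have [e|e|//] := ltngtP a a'.
    have := h4 a'.-1; lia.
  have := g4 a.-1; lia.
have [e|e|//] := ltngtP b b'.
  have := g4 b; lia.
have := h4 b'; lia.
Qed.

(** Sums over the layer-cake decomposition of [v]. The bounds [K] on the levels and [n] on the
    positions make the index type finite; for the sequences considered they lose no interval. *)
Definition runs (K n : nat) (v : nat -> nat) (F : nat -> nat -> nat -> R) : R :=
  \big[Rplus/0]_(t : 'I_K * 'I_n.+1 * 'I_n.+1 | isrun v t.1.1 t.1.2 t.2)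
    F t.1.1 t.1.2 t.2.

Lemma runs_ext K n v F G :
  (forall k a b, isrun v k a b -> F k a b = G k a b) ->
  runs K n v F = runs K n v G.
Proof. by move=> H; apply: eq_bigr => t ht; apply: H. Qed.

Lemma runs_le K n v F G :
  (forall k a b, (b <= n)%N -> isrun v k a b -> F k a b <= G k a b) ->
  runs K n v F <= runs K n v G.
Proof.
move=> H; apply: rsum_le => t ht; apply: H => //; rewrite -ltnS; exact: ltn_ord.
Qed.

Lemma runs_add K n v F G :
  runs K n v (fun k a b => F k a b + G k a b) = runs K n v F + runs K n v G.
Proof. by rewrite /runs big_split. Qed.

Lemma runs_scal K n v c F :
  runs K n v (fun k a b => c * F k a b) = c * runs K n v F.
Proof. by rewrite /runs big_distrr. Qed.

Lemma runs_opp K n v F :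
  runs K n v (fun k a b => - F k a b) = - runs K n v F.
Proof.
transitivity (-1 * runs K n v F); last lra.
by rewrite -runs_scal; apply: runs_ext => *; lra.
Qed.

Lemma runs_rsum K n v m (F : nat -> nat -> nat -> nat -> R) :
  \rsum_(i < m) runs K n v (F i) = runs K n v (fun k a b => \rsum_(i < m) F i k a b).
Proof. by rewrite /runs exchange_big. Qed.

Lemma runs_exchange K n v K' n' v' (F : nat -> nat -> nat -> nat -> nat -> nat -> R) :
  runs K n v (fun k a b => runs K' n' v' (F k a b)) =
  runs K' n' v' (fun k' c d => runs K n v (fun k a b => F k a b k' c d)).
Proof. by rewrite /runs exchange_big. Qed.

Section LayerCake.
Variables (K n : nat) (v : nat -> nat).
Hypotheses (v0 : v 0%N = 0%N) (vn : forall i, (n <= i)%N -> v i = 0%N)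
           (vK : forall i, (v i <= K)%N).

Lemma isrun_bounds k a b : isrun v k a b -> [/\ (0 < a)%N, (b <= n)%N & (k < K)%N].
Proof.
case/isrunP => h1 h2 h3 h4.
have va := h4 a; split.
- by case: a h1 h2 h4 va => // h1 h2 h4; rewrite v0; lia.
- rewrite leqNgt; apply/negP => nb; have := h4 b.-1; rewrite vn; lia.
- have := vK a; lia.
Qed.

Lemma runs_level (k : nat) (x : nat) (F : nat -> nat -> R) :
  \big[Rplus/0]_(p : 'I_n.+1 * 'I_n.+1 | isrun v k p.1 p.2)
     (if (p.1 <= x < p.2)%N then F p.1 p.2 else 0) =
  if (k < v x)%N then
    \big[Rplus/0]_(p : 'I_n.+1 * 'I_n.+1 | isrun v k p.1 p.2 && (p.1 <= x < p.2)%N)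
       F p.1 p.2 else 0.
Proof.
rewrite -big_mkcondr /=; case: ifP => // kx; apply: big_pred0 => -[a b] /=.
apply/negP => /andP[/isrunP[_ _ _ /(_ x)] h1 /h1]; lia.
Qed.

(** Exactly the levels [k < v x] contribute, and each of them once: the maximal interval around [x]
    exists and is unique. *)
Lemma layer_cake x :
  INR (v x) = runs K n v (fun k a b => if (a <= x < b)%N then 1 else 0).
Proof.
rewrite /runs.
rewrite -(pair_big_dep xpredT (fun (ka : 'I_K * 'I_n.+1) (b : 'I_n.+1) => isrun v ka.1 ka.2 b)
   (fun ka b => if (ka.2 <= x < b)%N then 1 else 0)) /=.
rewrite -(pair_big_dep xpredT (fun _ _ => true)
  (fun (k : 'I_K) (a : 'I_n.+1) =>
   \big[Rplus/0]_(b : 'I_n.+1 | isrun v k a b) (if (a <= x < b)%N then 1 else 0))) /=.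
transitivity (\rsum_(k < K) (if (k < v x)%N then 1 else 0)).
  transitivity (\rsum_(k < K) (if (0 <= k < v x)%N then 1 else 0)); last by [].
  by rewrite rsum_indicator subn0 (minn_idPr (vK x)).
apply: eq_bigr => k _.
rewrite (pair_big_dep xpredT (fun (a b : 'I_n.+1) => isrun v k a b)
  (fun (a b : 'I_n.+1) => if (a <= x < b)%N then 1 else 0)) /=.
rewrite (runs_level k x (fun _ _ => 1)); case: ifP => // kx.
have [a [b [hr hx]]] := isrun_exists _ _ _ _ v0 vn kx.
have [pa bn _] := isrun_bounds _ _ _ hr.
have hb : (b < n.+1)%N by [].
have ha : (a < n.+1)%N by lia.
rewrite (big_pred1 (Ordinal ha, Ordinal hb)) // => -[a' b'] /=.
apply/andP/eqP => [[hr' hx']|[-> ->]] //=.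
have [pa' _ _] := isrun_bounds _ _ _ hr'.
have [e1 e2] := isrun_uniq _ _ _ _ _ _ _ hr hr' hx hx' pa pa'.
by congr pair; apply: val_inj.
Qed.

(** One good interval on each of [m] consecutive levels is enough, because all other terms are
    nonnegative. Used twice, it counts pairs of levels in the lower bound of the gain. *)
Lemma runs_ge_window F k0 m c :
  (forall k a b, isrun v k a b -> 0 <= F k a b) -> (k0 + m <= K)%N ->
  (forall i, (i < m)%N -> exists a b, isrun v (k0 + i) a b /\ c <= F (k0 + i)%N a b) ->
  INR m * c <= runs K n v F.
Proof.
move=> F0 hK hc.
rewrite /runs.
rewrite -(pair_big_dep xpredT (fun (ka : 'I_K * 'I_n.+1) (b : 'I_n.+1) => isrun v ka.1 ka.2 b)
   (fun ka b => F ka.1 ka.2 b)) /=.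
rewrite -(pair_big_dep xpredT (fun _ _ => true)
  (fun (k : 'I_K) (a : 'I_n.+1) =>
   \big[Rplus/0]_(b : 'I_n.+1 | isrun v k a b) (F k a b))) /=.
apply: (rsum_window (fun k => \big[Rplus/0]_(a < n.+1) \big[Rplus/0]_(b < n.+1 | isrun v k a b) F k a b) K k0 m) => //.
  by move=> k; apply: rsum_ge0 => a _; apply: rsum_ge0 => b hb; apply: F0.
move=> i hi; have [a [b [hr hF]]] := hc i hi.
have [pa bn _] := isrun_bounds _ _ _ hr.
have ab : (a < b)%N by case/isrunP: hr.
have hb : (b < n.+1)%N by [].
have ha : (a < n.+1)%N by lia.
apply: (Rle_trans _ _ _ hF).
apply: (Rle_trans _ (\big[Rplus/0]_(b : 'I_n.+1 | isrun v (k0+i)%N (Ordinal ha) b) (F (k0+i)%N (Ordinal ha) b))).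
  apply: (rsum_ge_term _ (fun b : 'I_n.+1 => isrun v (k0+i)%N a b) (fun b => F (k0+i)%N a b) (Ordinal hb)) => //.
  by move=> b' hb'; apply: F0.
apply: (rsum_ge_term _ xpredT (fun a : 'I_n.+1 => \big[Rplus/0]_(b : 'I_n.+1 | isrun v (k0+i)%N a b) (F (k0+i)%N a b)) (Ordinal ha)) => //.
by move=> a' _; apply: rsum_ge0 => b' hb'; apply: F0.
Qed.

(** An interval of level [k] that begins at [i.+1] needs [v i <= k < v i.+1 <= v i + G], so that at
    most [G] intervals begin at each of the [n] possible sites. *)
Lemma runs_count G :
  (forall i, (v i.+1 <= v i + G)%N) ->
  runs K n v (fun _ _ _ => 1) <= INR n * INR G.
Proof.
move=> hG; rewrite /runs.
rewrite -(pair_big_dep xpredT (fun (ka : 'I_K * 'I_n.+1) (b : 'I_n.+1) => isrun v ka.1 ka.2 b)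
   (fun ka b => 1)) /=.
rewrite -(pair_big_dep xpredT (fun _ _ => true)
  (fun (k : 'I_K) (a : 'I_n.+1) =>
   \big[Rplus/0]_(b : 'I_n.+1 | isrun v k a b) 1)) /=.
rewrite exchange_big /= big_ord_recl /=.
rewrite big1 => [|k _]; last first.
  apply: big_pred0 => b; apply/negP => hr; have [] := isrun_bounds _ _ _ hr; lia.
rewrite -rsum_const Rplus_0_l; apply: rsum_le => i _.
rewrite /bump /= add1n.
apply: (Rle_trans _ (\rsum_(k < K) (if (v i <= k < v i + G)%N then 1 else 0))).
  apply: rsum_le => k _.
  case: ifP => hk; last first.
    rewrite big_pred0; first lra.
    move=> b; apply/negP => /isrunP[h1 /= h2 h3 h4].
    have := h4 i.+1; have := hG i; lia.
  case: (pickP (fun b : 'I_n.+1 => isrun v k i.+1 b)) => [b hb|h0]; last first.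
    by rewrite big_pred0 //; lra.
  rewrite (big_pred1 b); first lra.
  move=> b'; apply/idP/eqP => [hb'|->] //.
  have hbb := hb; have hbb' := hb'.
  case/isrunP: hbb => e1 _ _ _; case/isrunP: hbb' => e2 _ _ _.
  by apply: val_inj; have [] := isrun_uniq v k i.+1 i.+1 b' i.+1 b hb' hb; try lia.
rewrite rsum_indicator; apply: le_INR; lia.
Qed.

End LayerCake.

(** * Interaction of two rows *)

Definition clampR (m t : R) : R := Rmax (- m) (Rmin m t).

(* The two windows of length m centered at the sites next to the wall x contain
   clampR m (2 (d - x)) - clampR m (2 (c - x)) sites of the interval [c, d). The overlap is the
   difference of these numbers for the walls a and b. *)
Definition overlap (m a b c d : R) : R :=
  clampR m (2 * (d - a)) - clampR m (2 * (c - a))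
  - clampR m (2 * (d - b)) + clampR m (2 * (c - b)).

Ltac clamp_lra := rewrite /overlap /clampR /Rmax /Rmin; repeat destruct Rle_dec; lra.

Lemma clampR_opp m t : 0 <= m -> clampR m (- t) = - clampR m t.
Proof. move=> h; clamp_lra. Qed.

(** The slope of [clampR m] is the indicator of [[-m, m]], so among intervals of length [e] the
    increment is larger when the midpoint is closer to 0; the hypotheses say that the midpoint of
    [[s, s + e]] is the closer one. *)
Lemma clampR_decr m s t e : 0 <= m -> 0 <= e -> s <= t -> 0 <= s + t + e ->
  clampR m (t + e) - clampR m t <= clampR m (s + e) - clampR m s.
Proof. move=> h0 h1 h2 h3; clamp_lra. Qed.

Lemma overlap_antisym m a b c d : 0 <= m ->
  overlap m c d a b = - overlap m a b c d.
Proof.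
move=> h; rewrite /overlap.
have e x y : clampR m (2 * (x - y)) = - clampR m (2 * (y - x)).
  by rewrite -clampR_opp //; congr clampR; lra.
rewrite (e b c) (e a c) (e b d) (e a d); lra.
Qed.

(* Unimodality: a symmetric window around one interval sees more of the other one when
   their midpoints are closer. *)
Lemma overlap_sign m a b c d : 0 <= m -> a <= b -> c <= d ->
  0 <= (a + b - c - d) * overlap m a b c d.
Proof.
move=> hm hab hcd.
have key x y z t : x <= y -> z <= t -> z + t <= x + y -> 0 <= overlap m x y z t.
  move=> h1 h2 h3; rewrite /overlap.
  have e u w : clampR m (2 * (u - w)) = - clampR m (2 * (w - u)).
    by rewrite -clampR_opp //; congr clampR; lra.
  rewrite (e z y) (e t y).
  have := clampR_decr m (2 * (z - x)) (2 * (y - t)) (2 * (t - z)) hm.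
  have -> : 2 * (z - x) + 2 * (t - z) = 2 * (t - x) by lra.
  have -> : 2 * (y - t) + 2 * (t - z) = 2 * (y - z) by lra.
  move=> h5; have := h5 ltac:(lra) ltac:(lra) ltac:(lra); lra.
have [h|h] := Rle_dec (c + d) (a + b).
  by apply: Rmult_le_pos; [lra | apply: key].
have := key c d a b hcd hab ltac:(lra).
rewrite overlap_antisym // => h1.
have -> : (a + b - c - d) * overlap m a b c d = (c + d - a - b) * - overlap m a b c d by lra.
by apply: Rmult_le_pos; lra.
Qed.

(** For long intervals the terms comparing a left end with a right end are saturated and cancel.
    What remains is the sum of the displacements [c - a] and [d - b], the second one truncated.
    Since [c - a] is at most [N / 2], a truncated [d - b] still leaves a sum of size more than [N],
    and [kap <= 1/2] makes this enough. *)
Lemma overlap_lower N kap a b c d :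
  0 < N -> 0 < kap <= / 2 -> Rabs (c - a) <= N / 2 ->
  2 * N + 1 <= 2 * (d - a) -> 2 * N + 1 <= 2 * (b - c) ->
  kap * N <= Rabs ((c - a) + (d - b)) ->
  2 * (kap * N) * (kap * N) <= (a + b - c - d) * overlap (2 * N + 1) a b c d.
Proof.
move=> hN hk /Rabs_le_between hca hda hbc hs.
have kN : kap * N <= N / 2 by nra.
have kN0 : 0 < kap * N by nra.
set q := kap * N in kN kN0 hs *.
have e1 : clampR (2 * N + 1) (2 * (d - a)) = 2 * N + 1 by clamp_lra.
have e2 : clampR (2 * N + 1) (2 * (c - b)) = - (2 * N + 1) by clamp_lra.
have e3 : clampR (2 * N + 1) (2 * (c - a)) = 2 * (c - a) by clamp_lra.
rewrite /overlap e1 e2 e3.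
have [h|h] : q <= (c - a) + (d - b) \/ (c - a) + (d - b) <= - q.
  by move: hs; rewrite /Rabs; destruct Rcase_abs; lra.
- have : 2 * q <= 2 * (c - a) + clampR (2 * N + 1) (2 * (d - b)) by clamp_lra.
  set C := clampR _ _ => hC.
  have -> : (a + b - c - d) * (2 * N + 1 - 2 * (c - a) - C + - (2 * N + 1)) =
     ((c - a) + (d - b)) * (2 * (c - a) + C) by ring.
  nra.
- have : 2 * (c - a) + clampR (2 * N + 1) (2 * (d - b)) <= - 2 * q by clamp_lra.
  set C := clampR _ _ => hC.
  have -> : (a + b - c - d) * (2 * N + 1 - 2 * (c - a) - C + - (2 * N + 1)) =
     (- ((c - a) + (d - b))) * - (2 * (c - a) + C) by ring.
  nra.
Qed.

(* The wall x separates the sites x-1 and x, on which the two windows are centered. The truncated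
   subtractions are exact for N < x. *)
Definition wall_sum (N : nat) (v : nat -> nat) (x : nat) : R :=
  \rsum_(i < (2 * N).+1) INR (v (x.-1 - N + i)%N) +
  \rsum_(i < (2 * N).+1) INR (v (x - N + i)%N).

Lemma window_count m z c d : (c <= d)%N ->
  \rsum_(i < m) (if (c <= z + i < d)%N then 1 else 0) =
  INR (minn m (d - z)) - INR (minn m (c - z)).
Proof.
move=> cd.
transitivity (\rsum_(i < m) (if (c - z <= i < d - z)%N then 1 else 0)).
  by apply: eq_bigr => i _; congr (if _ then _ else _); lia.
rewrite rsum_indicator -minus_INR; last lia.
congr INR; lia.
Qed.

(** A single window is centered at a site, half a unit away from the wall. Adding the windows of
    both neighbours restores the symmetry about [x]: between saturation the two counts add up to
    [2 (d - x) + 2 N + 1]. *)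
Lemma clampR_nat N x d : (N < x)%N ->
  INR (minn (2 * N).+1 (d - (x.-1 - N))) + INR (minn (2 * N).+1 (d - (x - N))) =
  clampR (2 * INR N + 1) (2 * (INR d - INR x)) + (2 * INR N + 1).
Proof.
move=> hx.
have [h|h] := leqP d (x.-1 - N).
  have -> : minn (2 * N).+1 (d - (x.-1 - N)) = 0%N by lia.
  have -> : minn (2 * N).+1 (d - (x - N)) = 0%N by lia.
  have : INR (d + N + 1) <= INR x by apply: le_INR; lia.
  rewrite !plus_INR /= => h1; have := pos_INR N; clamp_lra.
have [h'|h'] := leqP (x + N).+1 d.
  have -> : minn (2 * N).+1 (d - (x.-1 - N)) = (N + N + 1)%N by lia.
  have -> : minn (2 * N).+1 (d - (x - N)) = (N + N + 1)%N by lia.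
  have : INR (x + N + 1) <= INR d by apply: le_INR; lia.
  rewrite !plus_INR /= => h1; have := pos_INR N; clamp_lra.
have -> : minn (2 * N).+1 (d - (x.-1 - N)) = (d + N + 1 - x)%N by lia.
have -> : minn (2 * N).+1 (d - (x - N)) = (d + N - x)%N by lia.
rewrite !minus_INR; try lia.
rewrite !plus_INR /=.
have : INR x <= INR (d + N) by apply: le_INR; lia.
have : INR d <= INR (x + N) by apply: le_INR; lia.
rewrite !plus_INR; clamp_lra.
Qed.

Section Pair.
Variables (K n N : nat).

(** The empty margin of [N.+1] sites pushes every interval beyond [N.+1], so that the windows around
    its walls never reach the place where subtraction in [nat] truncates. *)
Definition admissible (v : nat -> nat) : Prop :=
  [/\ forall i, (i <= N.+1)%N -> v i = 0%N, forall i, (n <= i)%N -> v i = 0%N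
    & forall i, (v i <= K)%N].

Lemma wall_sum_runs v x : admissible v -> (N < x)%N ->
  wall_sum N v x = runs K n v (fun k c d =>
    clampR (2 * INR N + 1) (2 * (INR d - INR x)) -
    clampR (2 * INR N + 1) (2 * (INR c - INR x))).
Proof.
move=> [v0 vn vK] hx; rewrite /wall_sum.
have lc z : \rsum_(i < (2 * N).+1) INR (v (z + i)%N) =
   runs K n v (fun k c d => INR (minn (2 * N).+1 (d - z)) - INR (minn (2 * N).+1 (c - z))).
  transitivity (\rsum_(i < (2 * N).+1) runs K n v (fun k c d => if (c <= z + i < d)%N then 1 else 0)).
    by apply: eq_bigr => i _; apply: layer_cake => //; apply: v0.
  rewrite (runs_rsum K n v _ (fun i k c d => if (c <= z + i < d)%N then 1 else 0)).
  by apply: runs_ext => k c d /isrunP[cd _ _ _]; apply: window_count; lia.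
rewrite !lc -runs_add; apply: runs_ext => k c d _.
have := clampR_nat N x d hx; have := clampR_nat N x c hx; lra.
Qed.

(* The derivative at time zero of <v1, K * v2> along the flow that moves every interval of every
   superlevel set of v1 towards the origin, with speed equal to its midpoint. *)
Definition drift (v1 : nat -> nat) (w : nat -> R) : R :=
  runs K n v1 (fun _ a b => (INR a + INR b) * (w a - w b)).

Definition pair_gain (v1 v2 : nat -> nat) : R :=
  runs K n v1 (fun _ a b => runs K n v2 (fun _ c d =>
    (INR a + INR b - INR c - INR d) *
      overlap (2 * INR N + 1) (INR a) (INR b) (INR c) (INR d))).

Lemma admissible_run v k a b : admissible v -> isrun v k a b ->
  [/\ (N.+1 < a)%N, (a < b)%N & (b <= n)%N].
Proof.
move=> [v0 vn vK] hr; have [_ h2 _] := isrun_bounds K n v (v0 0%N isT) vn vK k a b hr.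
case/isrunP: hr => ab _ _ h; split=> //.
by rewrite ltnNge; apply/negP => /v0 e; have := h a; lia.
Qed.

Lemma drift_runs v1 v2 : admissible v1 -> admissible v2 ->
  drift v1 (wall_sum N v2) = runs K n v1 (fun _ a b => runs K n v2 (fun _ c d =>
   (INR a + INR b) * overlap (2 * INR N + 1) (INR a) (INR b) (INR c) (INR d))).
Proof.
move=> h1 h2; apply: runs_ext => k a b hr.
have [ha ab hb] := admissible_run _ _ _ _ h1 hr.
rewrite runs_scal !wall_sum_runs //; try lia.
congr Rmult; rewrite /Rminus -runs_opp -runs_add; apply: runs_ext => k' c d _.
rewrite /overlap /Rminus; lra.
Qed.

(** The kernel is even, hence the overlap is antisymmetric, and the two velocities enter only
    through their difference. By unimodality of the kernel every term has then the favourable sign,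
    although the single drifts have none. *)
Lemma pair_gain_drift v1 v2 : admissible v1 -> admissible v2 ->
  drift v1 (wall_sum N v2) + drift v2 (wall_sum N v1) = pair_gain v1 v2.
Proof.
move=> h1 h2; rewrite !drift_runs //.
rewrite (runs_exchange K n v2) -runs_add; apply: runs_ext => k a b _.
rewrite -runs_add; apply: runs_ext => k' c d _.
have hm : 0 <= 2 * INR N + 1 by have := pos_INR N; lra.
rewrite (overlap_antisym _ (INR a)) //; lra.
Qed.

Lemma gain_term_ge0 k a b k' c d (v1 v2 : nat -> nat) :
  isrun v1 k a b -> isrun v2 k' c d ->
  0 <= (INR a + INR b - INR c - INR d) *
      overlap (2 * INR N + 1) (INR a) (INR b) (INR c) (INR d).
Proof.
move=> /isrunP[ab _ _ _] /isrunP[cd _ _ _]; apply: overlap_sign.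
- have := pos_INR N; lra.
- apply: le_INR; lia.
- apply: le_INR; lia.
Qed.

End Pair.

(** * Upper bound for the total gain of consecutive rows *)

Section Rows.
Variables (K n N M G : nat) (v : nat -> nat -> nat) (E : R).
Hypotheses (hv : forall j, admissible K n N (v j)).
Hypotheses (vfirst : forall i, v 0%N i = 0%N) (vlast : forall i, v M i = 0%N).
Hypothesis hG : forall j i, (v j i.+1 <= v j i + G)%N.
Hypothesis E0 : 0 <= E.
Hypothesis hE : forall j k a b, (0 < j < M)%N -> isrun (v j) k a b ->
  Rabs (wall_sum N (v j.+1) a + wall_sum N (v j.-1) a
        - (wall_sum N (v j.+1) b + wall_sum N (v j.-1) b)) <= E.

Lemma drift_zero u w : (forall i, u i = 0%N) -> drift K n u w = 0.
Proof.
move=> hu; rewrite /drift /runs big_pred0 // => t.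
by apply/negP => /isrunP[h1 h2 h3 /(_ t.1.2)]; rewrite hu leqnn h1 => /(_ isT).
Qed.

Lemma drift_bound j : (0 < j < M)%N ->
  drift K n (v j) (wall_sum N (v j.+1)) + drift K n (v j) (wall_sum N (v j.-1)) <=
  INR n * INR G * (2 * INR n * E).
Proof.
move=> hj; rewrite /drift -runs_add.
apply: (Rle_trans _ (runs K n (v j) (fun _ _ _ => (2 * INR n * E) * 1))).
  apply: runs_le => k a b bn hr.
  have := hE j k a b hj hr; set A := wall_sum _ _ a; set A' := wall_sum _ _ a.
  set B := wall_sum _ _ b; set B' := wall_sum _ _ b => /Rabs_le_between h.
  have -> : (INR a + INR b) * (A - B) + (INR a + INR b) * (A' - B') =
      (INR a + INR b) * (A + A' - (B + B')) by ring.
  have [_ ab _] := admissible_run _ _ _ _ _ _ _ (hv j) hr.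
  have h1 : INR a <= INR n by apply: le_INR; lia.
  have h2 : INR b <= INR n by apply: le_INR; lia.
  have := pos_INR a; have := pos_INR b => h3 h4.
  nra.
rewrite runs_scal.
have [h0 h1 h2] := hv j.
have := runs_count K n (v j) (h0 0%N isT) h1 h2 G (hG j).
have := pos_INR n => h3 h4.
have : 0 <= 2 * INR n * E by nra.
nra.
Qed.

(** Summation by parts: the gains of consecutive pairs are regrouped into the drift of each row
    against both of its neighbours, and by [hE] the window sums of the two neighbours together
    nearly agree at the two ends of an interval. The boundary terms vanish because the first and the
    last row are empty. *)
Lemma gain_bound :
  \rsum_(j < M) pair_gain K n N (v j) (v j.+1) <=
  INR M * (INR n * INR G * (2 * INR n * E)).
Proof.
have B0 : 0 <= INR n * INR G * (2 * INR n * E).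
  have := pos_INR n; have := pos_INR G => *; apply: Rmult_le_pos; nra.
have -> : \rsum_(j < M) pair_gain K n N (v j) (v j.+1) =
  \rsum_(j < M) (drift K n (v j) (wall_sum N (v j.+1)) +
                 (if j == 0%N :> nat then 0 else drift K n (v j) (wall_sum N (v j.-1)))).
  transitivity (\rsum_(j < M) (drift K n (v j) (wall_sum N (v j.+1)) +
      drift K n (v j.+1) (wall_sum N (v j)))).
    by apply: eq_bigr => j _; rewrite pair_gain_drift.
  rewrite !big_split /=; congr Rplus.
  clear B0; move: vlast; case: M => [|m] vl; first by rewrite !big_ord0.
  rewrite big_ord_recr big_ord_recl /= drift_zero // Rplus_0_l Rplus_0_r.
  by apply: eq_bigr => i _.
rewrite -rsum_const; apply: rsum_le => j _.
case: ifP => [/eqP e|/negbT e].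
  by rewrite e drift_zero //; lra.
apply: drift_bound; have := ltn_ord j; lia.
Qed.

End Rows.

(** * The reflection law *)

Definition lev (eps t : R) : nat := Z.to_nat (Int_part (t / eps)).

Lemma lev_spec eps t : 0 < eps -> 0 <= t ->
  eps * INR (lev eps t) <= t < eps * INR (lev eps t) + eps.
Proof.
move=> he ht.
have ht' : 0 <= t / eps by apply: Rdiv_le_0_compat.
have [h1 h2] := base_Int_part (t / eps).
have hz : (0 <= Int_part (t / eps))%Z.
  have : IZR (-1) < IZR (Int_part (t / eps)) by lra.
  move/lt_IZR; lia.
rewrite /lev INR_IZR_INZ Z2Nat.id //.
have e : t = eps * (t / eps) by field; lra.
set q := t / eps in h1 h2 e *; rewrite e; split; nra.
Qed.

Lemma lev_gt eps t k : 0 < eps -> 0 <= t ->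
  (k < lev eps t)%N <-> (INR k + 1) * eps <= t.
Proof.
move=> he ht; have [h1 h2] := lev_spec eps t he ht; split.
  move=> hk; have : INR k.+1 <= INR (lev eps t) by apply: le_INR; lia.
  rewrite S_INR; nra.
move=> hk; apply/ltP; apply: INR_lt; nra.
Qed.

Lemma nat_floor x : 0 <= x -> exists m : nat, INR m <= x < INR m + 1.
Proof. by move=> /nfloor_ex [m hm]; exists m. Qed.

(** Strict differentiability: neither of the two compared points is the base point, as is the case
    for ends of intervals in neighbouring rows near the end of a chord. *)
Definition strict_diff (u : R -> R -> R) (x0 y0 p q : R) : Prop :=
  forall z, 0 < z -> exists eta, 0 < eta /\ forall x y x' y',
    Rabs (x - x0) < eta -> Rabs (y - y0) < eta ->
    Rabs (x' - x0) < eta -> Rabs (y' - y0) < eta ->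
    Rabs (u x y - u x' y' - p * (x - x') - q * (y - y')) <=
      z * (Rabs (x - x') + Rabs (y - y')).

(* The relation between s and d makes the mean square of the horizontal displacements equal to
   s^2, so that the sum sees the full Laplacian. *)
Definition stencil (u : R -> R -> R) (f : R -> R) : Prop :=
  forall w, 0 < w -> exists s0, 0 < s0 /\
    forall (N : nat) (d s : R), 0 < d -> 0 < s < s0 -> s ^ 2 = d ^ 2 * (INR N * (INR N + 1) / 3) ->
    forall x y,
      Rabs (\rsum_(i < (2 * N).+1)
              (u (x + (INR i - INR N) * d) (y + s) + u (x + (INR i - INR N) * d) (y - s))
            - (2 * INR N + 1) * (2 * u x y - s ^ 2 * f (u x y)))
      <= (2 * INR N + 1) * (w * s ^ 2).

(** * Quantization on the lattice, and the use of the equation *)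

Section Lattice.
Variables (u : R -> R -> R) (f : R -> R) (X L U : R).
Hypotheses (X0 : 0 < X) (L0 : 0 < L).
Hypothesis u0 : forall x y, 0 <= u x y.
Hypothesis uU : forall x y, u x y <= U.
Hypothesis usupp : forall x y, X < Rabs x \/ X < Rabs y -> u x y = 0.
Hypothesis uLip : forall x y x' y', Rabs (u x y - u x' y') <= L * (Rabs (x - x') + Rabs (y - y')).

Variables (N K n M G : nat) (d s eps w : R).
Hypotheses (d0 : 0 < d) (s0 : 0 < s) (e0 : 0 < eps) (w0 : 0 < w).
Hypothesis margin : (INR N + 2) * d < 1.
Hypothesis nX : 2 * X + 2 <= INR n * d.
Hypothesis MX : 2 * X + 2 <= INR M * s.
Hypothesis KU : U + 1 <= INR K * eps.
Hypothesis GL : L * d + eps <= INR G * eps.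

(** The lattice begins one unit before the support; by [margin] this unit contains the empty sites
    up to [N.+1] that [admissible] asks for. *)
Definition grid_x (i : nat) : R := - (X + 1) + INR i * d.
Definition grid_y (j : nat) : R := - (X + 1) + INR j * s.
Definition grid_level (j i : nat) : nat := lev eps (u (grid_x i) (grid_y j)).

Local Notation xs := grid_x.
Local Notation ys := grid_y.
Local Notation uv := grid_level.
Local Notation ug j i := (u (xs i) (ys j)).

Lemma grid_level_zero j i : (ug j i) = 0 -> uv j i = 0%N.
Proof.
move=> h; have [h1 h2] := lev_spec eps ((ug j i)) e0 (u0 _ _).
have : INR (uv j i) < 1 by rewrite /grid_level; nra.
by rewrite -[1]/(INR 1) => /INR_lt; lia.
Qed.

Lemma grid_level_admissible j : admissible K n N (uv j).
Proof.
split=> i.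
- move=> hi; apply: grid_level_zero; apply: usupp; left.
  have : INR i <= INR N + 1 by rewrite -S_INR; apply: le_INR; lia.
  move=> h; rewrite /grid_x Rabs_left; nra.
- move=> hi; apply: grid_level_zero; apply: usupp; left.
  have : INR n <= INR i by apply: le_INR; lia.
  move=> h; rewrite /grid_x Rabs_pos_eq; nra.
- apply/leP; apply: INR_le.
  have [h1 h2] := lev_spec eps ((ug j i)) e0 (u0 _ _).
  have := uU (xs i) (ys j); rewrite -/(uv j i) in h1; nra.
Qed.

Lemma grid_level_first i : uv 0 i = 0%N.
Proof.
apply: grid_level_zero; apply: usupp; right; rewrite /grid_y /= Rabs_left; lra.
Qed.

Lemma grid_level_last i : uv M i = 0%N.
Proof.
apply: grid_level_zero; apply: usupp; right; rewrite /grid_y Rabs_pos_eq; lra.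
Qed.

Lemma grid_level_step j i : (uv j i.+1 <= uv j i + G)%N.
Proof.
apply/leP; apply: INR_le; rewrite plus_INR.
have [h1 h2] := lev_spec eps ((ug j i)) e0 (u0 _ _).
have [h3 h4] := lev_spec eps ((ug j i.+1)) e0 (u0 _ _).
have := uLip (xs i.+1) (ys j) (xs i) (ys j).
have -> : xs i.+1 - xs i = d by rewrite /grid_x S_INR; ring.
rewrite Rminus_diag Rabs_R0 (Rabs_pos_eq d); last lra.
move/Rabs_le_between => h5.
rewrite -/(uv j i.+1) in h3 h4; rewrite -/(uv j i) in h1 h2; nra.
Qed.

Lemma grid_level_run j k a b : isrun (uv j) k a b ->
  [/\ (0 < a)%N, (a < b)%N &
   [/\ u (xs a.-1) (ys j) < (INR k + 1) * eps, (INR k + 1) * eps <= (ug j a),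
    (ug j b) < (INR k + 1) * eps & (INR k + 1) * eps <= u (xs b.-1) (ys j)]].
Proof.
move=> hr; have [ha ab _] := admissible_run _ _ _ _ _ _ _ (grid_level_admissible j) hr.
have lo i : (uv j i <= k)%N -> (ug j i) < (INR k + 1) * eps.
  move=> h; apply: Rnot_le_lt => /(lev_gt _ _ _ e0 (u0 _ _)); rewrite -/(uv j i); lia.
case/isrunP: hr => _ h1 h2 h3.
have hi i : (a <= i < b)%N -> (INR k + 1) * eps <= (ug j i).
  by move=> /h3 h; apply/(lev_gt _ _ _ e0 (u0 _ _)).
split=> //; first lia.
split; [exact: lo | apply: hi; lia | exact: lo | apply: hi; lia].
Qed.

Hypothesis hsten : forall x y,
  Rabs (\rsum_(i < (2 * N).+1)
          (u (x + (INR i - INR N) * d) (y + s) + u (x + (INR i - INR N) * d) (y - s))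
        - (2 * INR N + 1) * (2 * u x y - s ^ 2 * f (u x y)))
  <= (2 * INR N + 1) * (w * s ^ 2).
Hypothesis hf : forall x y x' y', Rabs (u x y - u x' y') <= 2 * L * d ->
  Rabs (f (u x y) - f (u x' y')) <= w.

(** The stencil in terms of the quantized values: rounding down costs at most [eps] for each value,
    hence [2 eps] for each of the [2 N + 1] columns. *)
Lemma window_sum_bound j x : (0 < j)%N -> (N <= x)%N ->
  Rabs (eps * (\rsum_(i < (2 * N).+1) INR (uv j.+1 (x - N + i)) +
               \rsum_(i < (2 * N).+1) INR (uv j.-1 (x - N + i)))
     - (2 * INR N + 1) * (2 * (ug j x) - s ^ 2 * f ((ug j x))))
  <= (2 * INR N + 1) * (w * s ^ 2 + 2 * eps).
Proof.
move=> hj hx.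
have := hsten (xs x) (ys j).
set S := \rsum_(i < _) _.
have hS : S - (2 * INR N + 1) * (2 * eps) <=
  eps * (\rsum_(i < (2 * N).+1) INR (uv j.+1 (x - N + i)) +
               \rsum_(i < (2 * N).+1) INR (uv j.-1 (x - N + i))) <= S.
  have -> : eps * (\rsum_(i < (2 * N).+1) INR (uv j.+1 (x - N + i)) +
               \rsum_(i < (2 * N).+1) INR (uv j.-1 (x - N + i))) =
     \rsum_(i < (2 * N).+1) (eps * (INR (uv j.+1 (x - N + i)) + INR (uv j.-1 (x - N + i)))).
    by rewrite -big_distrr big_split.
  have e i : (xs x + (INR i - INR N) * d) = xs (x - N + i).
    rewrite /grid_x plus_INR minus_INR; last lia. ring.
  have e1 : ys j + s = ys j.+1 by rewrite /grid_y S_INR; ring.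
  have e2 : ys j - s = ys j.-1 by rewrite /grid_y -{1}(prednK hj) S_INR; ring.
  split.
    have -> : S - (2 * INR N + 1) * (2 * eps) =
       S + \rsum_(i < (2 * N).+1) (- (2 * eps)).
      by rewrite rsum_const S_INR mult_INR /=; ring.
    rewrite /S -big_split; apply: rsum_le => i _.
    rewrite e e1 e2.
    have := lev_spec eps ((ug j.+1 (x - N + i))) e0 (u0 _ _).
    have := lev_spec eps (u (xs (x - N + i)) (ys j.-1)) e0 (u0 _ _).
    rewrite -/(uv j.+1 _) -/(uv j.-1 _); move=> /=; lra.
  apply: rsum_le => i _.
  rewrite e e1 e2.
  have := lev_spec eps ((ug j.+1 (x - N + i))) e0 (u0 _ _).
  have := lev_spec eps (u (xs (x - N + i)) (ys j.-1)) e0 (u0 _ _).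
  rewrite -/(uv j.+1 _) -/(uv j.-1 _); lra.
move/Rabs_le_between => h; apply/Rabs_le_between; lra.
Qed.

(** Here the equation enters. The stencil makes the window sums of the neighbouring rows a function
    of the value of [u] alone, and at the sites next to the two ends of an interval these values
    differ by at most [2 L d], since all of them are within [L d] of the same level. *)
Lemma wall_sum_oscillation j k a b : (0 < j < M)%N -> isrun (uv j) k a b ->
  Rabs (wall_sum N (uv j.+1) a + wall_sum N (uv j.-1) a
        - (wall_sum N (uv j.+1) b + wall_sum N (uv j.-1) b)) <=
  (2 * INR N + 1) / eps * (8 * (L * d) + 8 * (w * s ^ 2) + 8 * eps).
Proof.
move=> /andP[hj _] hr.
have [ha ab _] := admissible_run _ _ _ _ _ _ _ (grid_level_admissible j) hr.
have [_ _ [h1 h2 h3 h4]] := grid_level_run _ _ _ _ hr.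
have st i : (0 < i)%N -> Rabs ((ug j i) - u (xs i.-1) (ys j)) <= L * d.
  move=> hi; have := uLip (xs i) (ys j) (xs i.-1) (ys j).
  have -> : xs i - xs i.-1 = d by rewrite /grid_x -{1}(prednK hi) S_INR; ring.
  rewrite Rminus_diag Rabs_R0 (Rabs_pos_eq d); lra.
have sa := st a ltac:(lia); have sb := st b ltac:(lia).
have wa := window_sum_bound j a hj ltac:(lia).
have wa1 := window_sum_bound j a.-1 hj ltac:(lia).
have wb := window_sum_bound j b hj ltac:(lia).
have wb1 := window_sum_bound j b.-1 hj ltac:(lia).
have fab : Rabs (f ((ug j a)) - f ((ug j b))) <= w.
  apply: hf; move/Rabs_le_between: sa; move/Rabs_le_between: sb => *.
  apply/Rabs_le_between; lra.
have fab1 : Rabs (f (u (xs a.-1) (ys j)) - f (u (xs b.-1) (ys j))) <= w.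
  apply: hf; move/Rabs_le_between: sa; move/Rabs_le_between: sb => *.
  apply/Rabs_le_between; lra.
set P := 2 * INR N + 1 in wa wa1 wb wb1 *.
have P0 : 0 < P by rewrite /P; have := pos_INR N; lra.
rewrite /wall_sum.
move: wa wa1 wb wb1; rewrite ![eps * _]Rmult_plus_distr_l.
set A1 := \rsum_(i < _) INR (uv j.+1 (a - N + i)).
set A2 := \rsum_(i < _) INR (uv j.-1 (a - N + i)).
set A3 := \rsum_(i < _) INR (uv j.+1 (a.-1 - N + i)).
set A4 := \rsum_(i < _) INR (uv j.-1 (a.-1 - N + i)).
set B1 := \rsum_(i < _) INR (uv j.+1 (b - N + i)).
set B2 := \rsum_(i < _) INR (uv j.-1 (b - N + i)).
set B3 := \rsum_(i < _) INR (uv j.+1 (b.-1 - N + i)).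
set B4 := \rsum_(i < _) INR (uv j.-1 (b.-1 - N + i)).
move: fab fab1 sa sb => /Rabs_le_between fab /Rabs_le_between fab1
  /Rabs_le_between sa /Rabs_le_between sb
  /Rabs_le_between wa /Rabs_le_between wa1 /Rabs_le_between wb /Rabs_le_between wb1.
set ua := (ug j a) in fab fab1 sa sb wa wa1 wb wb1 h1 h2 h3 h4.
set ua1 := u (xs a.-1) (ys j) in fab fab1 sa sb wa wa1 wb wb1 h1 h2 h3 h4.
set ub := (ug j b) in fab fab1 sa sb wa wa1 wb wb1 h1 h2 h3 h4.
set ub1 := u (xs b.-1) (ys j) in fab fab1 sa sb wa wa1 wb wb1 h1 h2 h3 h4.
have s2 : 0 <= s ^ 2 by apply: pow2_ge_0.
set Q := s ^ 2 in s2 wa wa1 wb wb1 *.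
apply: (Rmult_le_reg_l eps) => //.
have -> : eps * (P / eps * (8 * (L * d) + 8 * (w * Q) + 8 * eps)) =
   P * (8 * (L * d) + 8 * (w * Q) + 8 * eps) by field; lra.
rewrite -{1}(Rabs_pos_eq eps) -?Rabs_mult; last lra.
(* Two differences of [f] give [2 w s^2]; the stencil errors at the four sites add
   [4 w s^2 + 8 eps]. *)
have key : Rabs (P * (2 * ua - Q * f ua) + P * (2 * ua1 - Q * f ua1)
       - P * (2 * ub - Q * f ub) - P * (2 * ub1 - Q * f ub1)) <= P * (8 * (L * d) + 2 * (w * Q)).
  have -> : P * (2 * ua - Q * f ua) + P * (2 * ua1 - Q * f ua1)
       - P * (2 * ub - Q * f ub) - P * (2 * ub1 - Q * f ub1) =
    P * (2 * (ua + ua1 - ub - ub1) - Q * ((f ua - f ub) + (f ua1 - f ub1))) by ring.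
  rewrite Rabs_mult (Rabs_pos_eq P); last lra.
  apply: Rmult_le_compat_l; first lra.
  apply/Rabs_le_between; split; nra.
have pwq : 0 <= P * (w * Q) by apply: Rmult_le_pos; nra.
move/Rabs_le_between: key => key.
apply/Rabs_le_between; lra.
Qed.

Lemma pair_gain_upper :
  \rsum_(j < M) pair_gain K n N (uv j) (uv j.+1) <=
  INR M * (INR n * INR G *
    (2 * INR n * ((2 * INR N + 1) / eps * (8 * (L * d) + 8 * (w * s ^ 2) + 8 * eps)))).
Proof.
apply: gain_bound.
- exact: grid_level_admissible.
- exact: grid_level_first.
- exact: grid_level_last.
- exact: grid_level_step.
- apply: Rmult_le_pos.
    apply: Rdiv_le_0_compat => //; have := pos_INR N; lra.
  have := pow2_ge_0 s => ?; have : 0 <= w * s ^ 2 by nra.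
  have : 0 < L * d by nra.
  lra.
- exact: wall_sum_oscillation.
Qed.

End Lattice.

(** * Displacement of the ends of a chord from one row to the next *)

Lemma Rabs_le_elim x y : Rabs x <= y -> - y <= x <= y.
Proof. by move/Rabs_le_between. Qed.

Lemma Rabs_le_intro x y : - y <= x <= y -> Rabs x <= y.
Proof. by move=> h; apply/Rabs_le_between. Qed.

Lemma Rabs_scal_r x c : 0 <= c -> Rabs (x * c) = Rabs x * c.
Proof. by move=> h; rewrite Rabs_mult (Rabs_pos_eq c). Qed.

Lemma Rabs_scal_l x c : 0 <= c -> Rabs (c * x) = c * Rabs x.
Proof. by move=> h; rewrite Rabs_mult (Rabs_pos_eq c). Qed.

(** With [t = tau / s - q], linearization at the two ends gives [da] close to [s t / p] and [db]
    close to [- s (q - q' + t) / P]. So [da + db] is nearly [s] times an affine function of [t], of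
    absolute value [k0] at [t0]. A quarter of [k0] pays for the passage from [t0] to [t], another
    one for the two errors of differentiability; [B] bounds [db / s]. *)
Lemma gap_estimate p P q q' t0 t1 z k0 B s tau da db :
  0 < p -> 0 < P -> 0 < z -> 0 < s ->
  Rabs t0 + t1 <= p / 4 -> z <= p / 16 -> z <= P / 2 ->
  B * P = 2 * (Rabs (q - q') + p / 4 + P) ->
  k0 = Rabs (t0 / p - (q - q' + t0) / P) ->
  t1 * Rabs (/ p - / P) <= k0 / 4 ->
  5 / 2 * (z / p) + z * (B + 2) / P <= k0 / 4 ->
  Rabs (tau - s * (q + t0)) <= t1 * s ->
  Rabs (tau - p * da - q * s) <= z * (Rabs da + 2 * s) ->
  Rabs (tau + P * db - q' * s) <= z * (Rabs db + 2 * s) ->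
  Rabs da <= s / 2 /\ k0 / 2 * s <= Rabs (da + db).
Proof.
move=> hp hP hz hs ht hz1 hz2 hB hk ht1 hze htau ha hb.
set t := tau / s - q.
have et : tau = s * (q + t) by rewrite /t; field; lra.
have htt : Rabs (t - t0) <= t1.
  apply: (Rmult_le_reg_r s) => //.
  rewrite -Rabs_scal_r; last lra.
  have -> : (t - t0) * s = tau - s * (q + t0) by rewrite et; ring.
  exact: htau.
have htp : Rabs t <= p / 4.
  have := Rabs_triang (t - t0) t0; have -> : t - t0 + t0 = t by ring.
  lra.
have ea : tau - p * da - q * s = s * t - p * da by rewrite et; ring.
have eb : tau + P * db - q' * s = s * (q - q' + t) + P * db by rewrite et; ring.
rewrite ea in ha; rewrite eb in hb.
have pda : p * Rabs da <= s * (p / 4) + z * (Rabs da + 2 * s).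
  have -> : p * Rabs da = Rabs (p * da) by rewrite Rabs_mult (Rabs_pos_eq p); lra.
  have := Rabs_triang (s * t) (- (s * t - p * da)).
  rewrite Rabs_Ropp Rabs_mult (Rabs_pos_eq s); last lra.
  have -> : s * t + - (s * t - p * da) = p * da by ring.
  have : s * Rabs t <= s * (p / 4) by apply: Rmult_le_compat_l; lra.
  lra.
(* The error term contains [da] itself and is absorbed on the left, since [z <= p / 16]. *)
have da2 : Rabs da <= s / 2.
  have a0 := Rabs_pos da.
  apply: Rnot_lt_le => h.
  have : z * (Rabs da + 2 * s) <= p / 16 * (Rabs da + 2 * s) by apply: Rmult_le_compat_r; lra.
  have : p * (s / 2) < p * Rabs da by apply: Rmult_lt_compat_l.
  nra.
split=> //.
have hB0 : Rabs db <= B * s.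
  have b0 := Rabs_pos db.
  have qq := Rabs_pos (q - q').
  have : P * Rabs db <= s * (Rabs (q - q') + p / 4) + z * (Rabs db + 2 * s).
    have -> : P * Rabs db = Rabs (P * db) by rewrite Rabs_mult (Rabs_pos_eq P); lra.
    have := Rabs_triang (s * (q - q' + t) + P * db) (- (s * (q - q' + t))).
    rewrite Rabs_Ropp [Rabs (s * _)]Rabs_mult (Rabs_pos_eq s); last lra.
    have -> : s * (q - q' + t) + P * db + - (s * (q - q' + t)) = P * db by ring.
    have : s * Rabs (q - q' + t) <= s * (Rabs (q - q') + p / 4).
      apply: Rmult_le_compat_l; first lra.
      have := Rabs_triang (q - q') t; lra.
    lra.
  have : z * (Rabs db + 2 * s) <= P / 2 * (Rabs db + 2 * s) by apply: Rmult_le_compat_r; lra.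
  move=> h1 h2; apply: (Rmult_le_reg_r P) => //.
  nra.
have da3 : Rabs (da - s * (t / p)) <= s * (5 / 2 * (z / p)).
  apply: (Rmult_le_reg_r p) => //.
  rewrite -Rabs_scal_r; last lra.
  have -> : (da - s * (t / p)) * p = - (s * t - p * da) by field; lra.
  rewrite Rabs_Ropp.
  have -> : s * (5 / 2 * (z / p)) * p = z * (s / 2 + 2 * s) by field; lra.
  apply: Rle_trans ha _; apply: Rmult_le_compat_l; lra.
have db3 : Rabs (db + s * ((q - q' + t) / P)) <= s * (z * (B + 2) / P).
  apply: (Rmult_le_reg_r P) => //.
  rewrite -Rabs_scal_r; last lra.
  have -> : (db + s * ((q - q' + t) / P)) * P = s * (q - q' + t) + P * db by field; lra.
  have -> : s * (z * (B + 2) / P) * P = z * (B * s + 2 * s) by field; lra.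
  apply: Rle_trans hb _; apply: Rmult_le_compat_l; lra.
have tt : Rabs ((t - t0) * (/ p - / P)) <= k0 / 4.
  rewrite Rabs_mult; apply: Rle_trans ht1.
  apply: Rmult_le_compat_r => //; exact: Rabs_pos.
have e : s * (t0 / p - (q - q' + t0) / P) =
  (da + db) - (da - s * (t / p)) - (db + s * ((q - q' + t) / P)) - s * ((t - t0) * (/ p - / P)).
  by field; lra.
have : s * k0 <= Rabs (da + db) + s * (5 / 2 * (z / p)) + s * (z * (B + 2) / P) + s * (k0 / 4).
  rewrite hk -Rabs_scal_l; last lra.
  rewrite e -hk.
  have h1 := Rabs_triang (da + db - (da - s * (t / p)) - (db + s * ((q - q' + t) / P)))
    (- (s * ((t - t0) * (/ p - / P)))).
  have h2 := Rabs_triang (da + db - (da - s * (t / p))) (- (db + s * ((q - q' + t) / P))).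
  have h3 := Rabs_triang (da + db) (- (da - s * (t / p))).
  rewrite !Rabs_Ropp in h1 h2 h3.
  rewrite [Rabs (s * _)]Rabs_mult (Rabs_pos_eq s) in h1; last lra.
  have : s * Rabs ((t - t0) * (/ p - / P)) <= s * (k0 / 4) by apply: Rmult_le_compat_l; lra.
  rewrite /Rminus in h1 h2 h3 da3 db3 *; lra.
have : s * (5 / 2 * (z / p) + z * (B + 2) / P) <= s * (k0 / 4) by apply: Rmult_le_compat_l; lra.
nra.
Qed.

(* If the displacements da and db of the two ends of a chord cancel when the level rises by s q,
   they do not when it rises by s (q + t0). *)
Lemma gap_constants p q p' q' : 0 < p -> p' < 0 -> ~ (p' = - p /\ q' = q) ->
  exists t0 t1 z kap, [/\ 0 < t1, 0 < z, 0 < kap, Rabs t0 + t1 <= p / 4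
    & forall s tau da db, 0 < s ->
       Rabs (tau - s * (q + t0)) <= t1 * s ->
       Rabs (tau - p * da - q * s) <= z * (Rabs da + 2 * s) ->
       Rabs (tau - p' * db - q' * s) <= z * (Rabs db + 2 * s) ->
       Rabs da <= s / 2 /\ kap * s <= Rabs (da + db)].
Proof.
move=> hp hp' hne.
set P := - p'; have hP : 0 < P by rewrite /P; lra.
(* The affine function of [t0] vanishes identically only for [q = q'] and [P = p], the excluded
   case. If it vanishes at 0, then [q = q'], and its value at [p / 8] is nonzero because [P] differs
   from [p]. *)
have [t0 [ht0 hk]] : exists t0, Rabs t0 <= p / 8 /\ t0 / p - (q - q' + t0) / P <> 0.
  have [h|h] := Req_dec (0 / p - (q - q' + 0) / P) 0; last first.
    by exists 0; rewrite Rabs_R0; split; [lra | exact: h].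
  have qq : q = q'.
    have : (q - q') / P = 0 by lra.
    move/(Rmult_eq_compat_r P); rewrite /Rdiv Rmult_assoc Rinv_l; lra.
  exists (p / 8); split; first by rewrite Rabs_pos_eq; lra.
  rewrite qq => h1; apply: hne; split=> //.
  have : P = p; last by rewrite /P; lra.
  have : (p / 8 / p - (q' - q' + p / 8) / P) * P * 8 = 0 by rewrite h1; ring.
  have -> : (p / 8 / p - (q' - q' + p / 8) / P) * P * 8 = P - p by field; lra.
  lra.
set k0 := Rabs (t0 / p - (q - q' + t0) / P).
have k0p : 0 < k0 by apply: Rabs_pos_lt.
set T := Rabs (/ p - / P).
have T0 : 0 <= T by apply: Rabs_pos.
set B := 2 * (Rabs (q - q') + p / 4 + P) / P.
have B0 : 0 < B.
  apply: Rdiv_lt_0_compat => //; have := Rabs_pos (q - q'); lra.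
set S := 5 / 2 / p + (B + 2) / P.
have S0 : 0 < S.
  apply: Rplus_lt_0_compat; apply: Rdiv_lt_0_compat; lra.
have minpos x y : 0 < x -> 0 < y -> exists m, [/\ 0 < m, m <= x & m <= y].
  move=> hx hy; exists (Rmin x y); split; [exact: Rmin_glb_lt | exact: Rmin_l | exact: Rmin_r].
have [t1 [ht1 ht1p ht1T]] := minpos (p / 8) (k0 / 4 / (T + 1)) ltac:(lra)
  ltac:(apply: Rdiv_lt_0_compat; lra).
have [z1 [hz1 hz1p hz1P]] := minpos (p / 16) (P / 2) ltac:(lra) ltac:(lra).
have [z [hz hzz hzS]] := minpos z1 (k0 / 4 / S) hz1 ltac:(apply: Rdiv_lt_0_compat; lra).
exists t0, t1, z, (k0 / 2); split; try lra.
move=> s tau da db hs h1 h2 h3.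
apply: (gap_estimate p P q q' t0 t1 z k0 B s tau) => //; try lra.
- by rewrite /B; field; lra.
- have : t1 * (T + 1) <= k0 / 4.
    have -> : k0 / 4 = k0 / 4 / (T + 1) * (T + 1) by field; lra.
    by apply: Rmult_le_compat_r; lra.
  rewrite -/T; nra.
- have -> : 5 / 2 * (z / p) + z * (B + 2) / P = z * S by rewrite /S; field; lra.
  have -> : k0 / 4 = k0 / 4 / S * S by field; lra.
  by apply: Rmult_le_compat_r; lra.
- by have -> : tau + P * db - q' * s = tau - p' * db - q' * s by rewrite /P; ring.
Qed.

Lemma nat_floor_mult x e : 0 < e -> 0 <= x ->
  exists m : nat, INR m * e <= x < (INR m + 1) * e.
Proof.
move=> he hx; have [m [h1 h2]] := nat_floor (x / e) ltac:(apply: Rdiv_le_0_compat; lra).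
exists m; have ex : x = x / e * e by field; lra.
set t := x / e in h1 h2 ex; rewrite ex; split; [apply: Rmult_le_compat_r | apply: Rmult_lt_compat_r]; lra.
Qed.

(** * Lower bound for the gain near an asymmetric chord *)

Section Chord.
Variables (u : R -> R -> R) (X L U : R).
Hypotheses (X0 : 0 < X) (L0 : 0 < L).
Hypothesis u0 : forall x y, 0 <= u x y.
Hypothesis uU : forall x y, u x y <= U.
Hypothesis usupp : forall x y, X < Rabs x \/ X < Rabs y -> u x y = 0.
Hypothesis uLip : forall x y x' y', Rabs (u x y - u x' y') <= L * (Rabs (x - x') + Rabs (y - y')).

Variables (N K n : nat) (d s eps : R).
Hypotheses (d0 : 0 < d) (s0 : 0 < s) (e0 : 0 < eps).
Hypothesis margin : (INR N + 2) * d < 1.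
Hypothesis nX : 2 * X + 2 <= INR n * d.
Hypothesis KU : U + 1 <= INR K * eps.

Variables (a0 b0 y0 h0 p q p' q' eta r e1 e2 t0 t1 z kap : R).
Hypothesis hA : forall x y x' y',
  Rabs (x - a0) < eta -> Rabs (y - y0) < eta -> Rabs (x' - a0) < eta -> Rabs (y' - y0) < eta ->
  Rabs (u x y - u x' y' - p * (x - x') - q * (y - y')) <= z * (Rabs (x - x') + Rabs (y - y')).
Hypothesis hB : forall x y x' y',
  Rabs (x - b0) < eta -> Rabs (y - y0) < eta -> Rabs (x' - b0) < eta -> Rabs (y' - y0) < eta ->
  Rabs (u x y - u x' y' - p' * (x - x') - q' * (y - y')) <= z * (Rabs (x - x') + Rabs (y - y')).
Hypotheses (r0 : 0 < r) (reta : r + d < eta) (rab : 2 * r + d <= b0 - a0) (e1eta : e1 < eta)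
  (aX : Rabs a0 <= X) (bX : Rabs b0 <= X) (r1 : r + d <= 1).
Hypothesis boxA : u (a0 - r) y0 <= h0 - 3 * e2.
Hypothesis boxB : u (b0 + r) y0 <= h0 - 3 * e2.
Hypothesis boxI : forall x, a0 + r <= x <= b0 - r -> h0 + 3 * e2 <= u x y0.
Hypotheses (e2p : 0 < e2) (e12 : L * (d + e1) <= e2).

Local Notation xs := (grid_x X d).
Local Notation ys := (grid_y X s).
Local Notation uv := (grid_level u X d s eps).

Lemma lattice_point x : - (X + 1) <= x -> exists i, xs i <= x < xs i + d.
Proof.
move=> hx.
have [m [h1 h2]] := nat_floor_mult (x + (X + 1)) d d0 ltac:(lra).
exists m; rewrite /grid_x; lra.
Qed.

Lemma grid_x_lt i j : xs i < xs j -> (i < j)%N.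
Proof.
rewrite /grid_x => h; apply/ltP; apply: INR_lt; apply: (Rmult_lt_reg_r d) => //; lra.
Qed.

Lemma grid_x_le i j : (i <= j)%N -> xs i <= xs j.
Proof.
move=> h; have h' : INR i <= INR j by apply: le_INR; lia.
have : INR i * d <= INR j * d by apply: Rmult_le_compat_r; lra.
rewrite /grid_x; lra.
Qed.

(** Low values at [a0 - r] and [b0 + r] and high values in between force the interval through the
    site [im] to begin near [a0] and to end near [b0]. Of the margin [3 e2], one [e2] pays for the
    change of level and one for the change of row and the rounding to sites. *)
Lemma run_near j k : Rabs (ys j - y0) <= e1 -> Rabs ((INR k + 1) * eps - h0) <= e2 ->
  exists a b, [/\ isrun (uv j) k a b, Rabs (xs a - a0) < eta & Rabs (xs b - b0) < eta].
Proof.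
move=> hy /Rabs_le_elim hh.
set h := (INR k + 1) * eps in hh.
have lip x x' : Rabs (x - x') <= d -> Rabs (u x (ys j) - u x' y0) <= e2.
  move=> hx; apply: (Rle_trans _ _ _ (uLip _ _ _ _)).
  apply: Rle_trans e12; apply: Rmult_le_compat_l; lra.
move/Rabs_le_elim: aX => aX'; move/Rabs_le_elim: bX => bX'.
have [il hil] := lattice_point (a0 - r) ltac:(lra).
have [im him] := lattice_point (a0 + r + d) ltac:(lra).
have [ir hir] := lattice_point (b0 + r + d) ltac:(lra).
have uil : u (xs il) (ys j) < h.
  have := lip (xs il) (a0 - r) ltac:(apply: Rabs_le_intro; lra).
  move/Rabs_le_elim; lra.
have uir : u (xs ir) (ys j) < h.
  have := lip (xs ir) (b0 + r) ltac:(apply: Rabs_le_intro; lra).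
  move/Rabs_le_elim; lra.
have umid x : a0 + r <= x <= b0 - r -> h <= u x (ys j).
  move=> hx; have := lip x x ltac:(rewrite Rminus_diag Rabs_R0; lra).
  have := boxI x hx; move=> ? /Rabs_le_elim; lra.
have adm := grid_level_admissible u X U X0 u0 uU usupp N K n d s eps d0 e0 margin nX KU j.
have lvl i : (k < uv j i)%N <-> h <= u (xs i) (ys j) := lev_gt _ _ _ e0 (u0 _ _).
have kim : (k < uv j im)%N by apply/lvl; apply: umid; lra.
case: (adm) => v0 vn vK.
have [a [b [hr hab]]] := isrun_exists (uv j) k im n (v0 0%N isT) vn kim.
have [ha ab bn] := admissible_run _ _ _ _ _ _ _ adm hr.
exists a, b; split=> //.
  have h1 : (il < a)%N.
    rewrite ltnNge; apply/negP => hil'.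
    have : (il < im)%N by apply: grid_x_lt; lra.
    move=> lim; have : (k < uv j il)%N by case/isrunP: hr => _ _ _; apply; lia.
    move/lvl; lra.
  have := grid_x_le il.+1 a h1; rewrite /grid_x S_INR -/(xs il) => h2.
  have h3 : xs a.-1 < a0 + r.
    apply: Rnot_le_lt => h3.
    have : xs a.-1 <= xs im by apply: grid_x_le; lia.
    move=> h4; have : (uv j a.-1 <= k)%N by case/isrunP: hr.
    rewrite leqNgt => /negP; apply; apply/lvl; apply: umid; lra.
  have h4 : xs a = xs a.-1 + d by rewrite /grid_x -{1}(prednK (n := a)) ?S_INR; [ring | lia].
  rewrite /grid_x in hil h2 h3 h4 *; apply: Rabs_def1; lra.
have h1 : (b <= ir)%N.
  rewrite leqNgt; apply/negP => hir'.
  have : (im < ir)%N by apply: grid_x_lt; lra.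
  move=> lim; have : (k < uv j ir)%N by case/isrunP: hr => _ _ _; apply; lia.
  move/lvl; lra.
have h2 := grid_x_le b ir h1.
have h3 : b0 - r < xs b.
  apply: Rnot_le_lt => h3.
  have : xs im <= xs b by apply: grid_x_le; lia.
  move=> h4; have : (uv j b <= k)%N by case/isrunP: hr.
  rewrite leqNgt => /negP; apply; apply/lvl; apply: umid; lra.
apply: Rabs_def1; lra.
Qed.

Hypothesis sN : s <= INR N * d.
Hypothesis N2s : INR N * d <= 2 * s.
Hypothesis long : 2 * eta + 2 * s + d <= b0 - a0.
Hypothesis zs : 2 * (L * d) <= z * s.
Hypothesis kap0 : 0 < kap <= / 2.
Hypothesis hgap : forall tau da db,
  Rabs (tau - s * (q + t0)) <= t1 * s ->
  Rabs (tau - p * da - q * s) <= z * (Rabs da + 2 * s) ->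
  Rabs (tau - p' * db - q' * s) <= z * (Rabs db + 2 * s) ->
  Rabs da <= s / 2 /\ 2 * kap * s <= Rabs (da + db).

(** The lattice ends miss their levels by at most [L d], which by [zs] costs no more than an
    additional [z s]; this is why [hgap] tolerates [2 s] where strict differentiability gives
    [s]. *)
Lemma pair_term j k k' a b c e :
  Rabs (ys j - y0) <= e1 -> Rabs (ys j.+1 - y0) <= e1 ->
  Rabs ((INR k' + 1) * eps - (INR k + 1) * eps - s * (q + t0)) <= t1 * s ->
  isrun (uv j) k a b -> Rabs (xs a - a0) < eta -> Rabs (xs b - b0) < eta ->
  isrun (uv j.+1) k' c e -> Rabs (xs c - a0) < eta -> Rabs (xs e - b0) < eta ->
  2 * (kap * INR N) * (kap * INR N) <= (INR a + INR b - INR c - INR e) *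
      overlap (2 * INR N + 1) (INR a) (INR b) (INR c) (INR e).
Proof.
move=> hy hy' htau hr ha hb hr' hc he.
set h := (INR k + 1) * eps in htau; set h' := (INR k' + 1) * eps in htau.
have ey : ys j.+1 - ys j = s by rewrite /grid_y S_INR; ring.
have step y i : (0 < i)%N -> Rabs (u (xs i) y - u (xs i.-1) y) <= L * d.
  move=> hi; have := uLip (xs i) y (xs i.-1) y.
  have -> : xs i - xs i.-1 = d by rewrite /grid_x -{1}(prednK hi) S_INR; ring.
  rewrite Rminus_diag Rabs_R0 (Rabs_pos_eq d); lra.
have [a1 ab [r1' r2 r3 r4]] := grid_level_run u X U X0 u0 uU usupp N K n d s eps d0 e0 margin nX KU _ _ _ _ hr.
have [c1 ce [q1 q2 q3 q4]] := grid_level_run u X U X0 u0 uU usupp N K n d s eps d0 e0 margin nX KU _ _ _ _ hr'.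
rewrite -/h in r1' r2 r3 r4; rewrite -/h' in q1 q2 q3 q4.
have sa := Rabs_le_elim _ _ (step (ys j) a a1).
have sb := Rabs_le_elim _ _ (step (ys j) b ltac:(lia)).
have sc := Rabs_le_elim _ _ (step (ys j.+1) c c1).
have se := Rabs_le_elim _ _ (step (ys j.+1) e ltac:(lia)).
have dA := hA (xs c) (ys j.+1) (xs a) (ys j) hc ltac:(lra) ha ltac:(lra).
have dB := hB (xs e) (ys j.+1) (xs b) (ys j) he ltac:(lra) hb ltac:(lra).
rewrite ey (Rabs_pos_eq s) in dA; last lra.
rewrite ey (Rabs_pos_eq s) in dB; last lra.
have dA' := Rabs_le_elim _ _ dA; have dB' := Rabs_le_elim _ _ dB.
have [g1 g2] := hgap (h' - h) (xs c - xs a) (xs e - xs b) htau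
  ltac:(apply: Rabs_le_intro; lra) ltac:(apply: Rabs_le_intro; lra).
have ex i i' : xs i - xs i' = (INR i - INR i') * d by rewrite /grid_x; ring.
have N0 : 0 < INR N by apply: (Rmult_lt_reg_r d) => //; lra.
move/Rabs_def2: ha => ha; move/Rabs_def2: hb => hb.
move/Rabs_def2: hc => hc; move/Rabs_def2: he => he.
apply: overlap_lower => //.
- apply: (Rmult_le_reg_r d) => //.
  rewrite -Rabs_scal_r -?ex; lra.
- apply: (Rmult_le_reg_r d) => //.
  have -> : 2 * (INR e - INR a) * d = 2 * (xs e - xs a) by rewrite ex; ring.
  rewrite Rmult_plus_distr_r; lra.
- apply: (Rmult_le_reg_r d) => //.
  have -> : 2 * (INR b - INR c) * d = 2 * (xs b - xs c) by rewrite ex; ring.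
  rewrite Rmult_plus_distr_r; lra.
- apply: (Rmult_le_reg_r d) => //.
  rewrite -Rabs_scal_r; last lra.
  have -> : (INR c - INR a + (INR e - INR b)) * d = xs c - xs a + (xs e - xs b) by rewrite !ex; ring.
  apply: Rle_trans g2; have : kap * (INR N * d) <= kap * (2 * s) by apply: Rmult_le_compat_l; lra.
  lra.
Qed.

Hypotheses (eps2 : eps <= e2 / 8) (epst : eps <= t1 * s / 2)
  (sq : s * (Rabs (q + t0) + t1) <= e2 / 8) (sh : e2 <= h0) (h0U : h0 <= U) (e21 : e2 <= 1)
  (t10 : 0 < t1).

(** About [e2 / (4 eps)] levels above [h0] are paired with about [t1 s / eps] levels of the next row
    each. Rounding these numbers to integers loses at most a factor 2, as [eps] is small. *)
Lemma pair_gain_lower j :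
  Rabs (ys j - y0) <= e1 -> Rabs (ys j.+1 - y0) <= e1 ->
  (e2 / (8 * eps)) * ((t1 * s / (2 * eps)) * (2 * (kap * INR N) * (kap * INR N)))
   <= pair_gain K n N (uv j) (uv j.+1).
Proof.
move=> hy hy'.
have adm i := grid_level_admissible u X U X0 u0 uU usupp N K n d s eps d0 e0 margin nX KU i.
have v0 i : uv i 0%N = 0%N by case: (adm i) => h _ _; apply: h.
have vn i : forall x, (n <= x)%N -> uv i x = 0%N by case: (adm i).
have vK i : forall x, (uv i x <= K)%N by case: (adm i).
set P := 2 * (kap * INR N) * (kap * INR N).
have kN : 0 <= kap * INR N by apply: Rmult_le_pos; [lra | exact: pos_INR].
have P0 : 0 <= P by rewrite /P Rmult_assoc; apply: Rmult_le_pos; [lra | exact: Rmult_le_pos].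
have kK k0 m : (INR k0 + INR m) * eps <= h0 + e2 -> (k0 + m <= K)%N.
  move=> h; apply/leP; apply: INR_le; rewrite plus_INR; apply: (Rmult_le_reg_r eps) => //; lra.
have [k0 [hk1' hk2']] := nat_floor_mult h0 eps e0 ltac:(lra).
have [m2 [hm1' hm2]] := nat_floor_mult (e2 / 4) eps e0 ltac:(lra).
have hm2' : e2 / (8 * eps) <= INR m2.
  apply: (Rmult_le_reg_r eps) => //.
  have -> : e2 / (8 * eps) * eps = e2 / 8 by field; lra.
  lra.
have t1s : 0 < t1 * s by apply: Rmult_lt_0_compat.
have [m3 [hn1' hn2]] := nat_floor_mult (t1 * s) eps e0 ltac:(lra).
have hn2' : t1 * s / (2 * eps) <= INR m3.
  apply: (Rmult_le_reg_r eps) => //.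
  have -> : t1 * s / (2 * eps) * eps = t1 * s / 2 by field; lra.
  lra.
have sqa : Rabs (s * (q + t0)) + t1 * s <= e2 / 8 by rewrite Rabs_scal_l; lra.
have sqb := Rabs_le_elim _ _ (Rle_refl (Rabs (s * (q + t0)))).
apply: (Rle_trans _ (INR m2 * (INR m3 * P))).
  apply: Rmult_le_compat => //.
  - by apply: Rdiv_le_0_compat; lra.
  - by apply: Rmult_le_pos => //; apply: Rdiv_le_0_compat; lra.
  - by apply: Rmult_le_compat_r.
apply: (runs_ge_window _ _ _ (v0 j) (vn j) (vK j) _ k0).
- move=> k a b hr; apply: rsum_ge0 => t ht; exact: gain_term_ge0 hr ht.
- apply: kK; lra.
move=> i hi.
have ii : INR i + 1 <= INR m2 by rewrite -S_INR; apply: le_INR; lia.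
set h := (INR (k0 + i) + 1) * eps.
have eh : h = (INR k0 + 1) * eps + INR i * eps by rewrite /h plus_INR; ring.
have hr : h0 <= h <= h0 + e2 / 4 + eps.
  have : 0 <= INR i * eps by apply: Rmult_le_pos; [exact: pos_INR | lra].
  have : (INR i + 1) * eps <= INR m2 * eps by apply: Rmult_le_compat_r; lra.
  lra.
have [a [b [hrun ha hb]]] := run_near j (k0 + i) hy ltac:(rewrite -/h; apply: Rabs_le_intro; lra).
exists a, b; split=> //.
(* The partner levels fill [[g, g + t1 s]], which is within the tolerance [t1 s] of the rise
   [s (q + t0)], where the displacements of the ends do not cancel. *)
set g := h + s * (q + t0) - t1 * s.
have hg : h0 - e2 / 8 <= g <= h0 + e2 / 2 by rewrite /g; lra.
have [k1 [hl1' hl2']] := nat_floor_mult g eps e0 ltac:(lra).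
apply: (runs_ge_window _ _ _ (v0 j.+1) (vn j.+1) (vK j.+1) _ k1).
- move=> k' c e hr'; exact: gain_term_ge0 hrun hr'.
- apply: kK; lra.
move=> i' hi'.
have ii' : INR i' + 1 <= INR m3 by rewrite -S_INR; apply: le_INR; lia.
set h' := (INR (k1 + i') + 1) * eps.
have eh' : h' = (INR k1 + 1) * eps + INR i' * eps by rewrite /h' plus_INR; ring.
have hr' : g <= h' <= g + t1 * s.
  have : 0 <= INR i' * eps by apply: Rmult_le_pos; [exact: pos_INR | lra].
  have : (INR i' + 1) * eps <= INR m3 * eps by apply: Rmult_le_compat_r; lra.
  lra.
have [c [e [hrun' hc he]]] := run_near j.+1 (k1 + i') hy' ltac:(rewrite -/h'; apply: Rabs_le_intro; lra).
exists c, e; split=> //.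
apply: (pair_term j (k0 + i) (k1 + i')) => //.
rewrite -/h -/h'; apply: Rabs_le_intro; rewrite /g in hr'; lra.
Qed.

End Chord.

(** A bookkeeping device for choosing a parameter below several thresholds; the nested conjunction
    ends in [True], whence the final [_] in the patterns that destruct it. *)
Lemma common_min (l : seq R) : foldr (fun x P => 0 < x /\ P) True l ->
  exists m, 0 < m /\ foldr (fun x P => m <= x /\ P) True l.
Proof.
elim: l => [|x l IH] /=; first by exists 1; split; [lra | ].
move=> [x0 /IH [m [hm hl]]]; exists (Rmin x m); split; first exact: Rmin_glb_lt.
split; first exact: Rmin_l.
elim: l hl {IH} => //= y l IH [h1 h2]; split; last exact: IH.
exact: Rle_trans (Rmin_r _ _) h1.
Qed.

(** The relation of [stencil] forces [d = s sqrt (3 / (N (N + 1)))]. Then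
    [N d / s = sqrt (3 N / (N + 1))] lies between 1 and 2 for all [N >= 1], and a large [N] makes
    [d] small. *)
Lemma lattice_params s dt : 0 < s -> 0 < dt -> exists (N : nat) d,
  [/\ 0 < d, d <= dt, s ^ 2 = d ^ 2 * (INR N * (INR N + 1) / 3), s <= INR N * d
    & INR N * d <= 2 * s] /\ 1 <= INR N.
Proof.
move=> hs hdt.
have [N [h1 h2]] := nat_floor (2 * s / dt) ltac:(apply: Rdiv_le_0_compat; lra).
set m := INR N.+1.
have hm : m = INR N + 1 by rewrite /m S_INR.
have m1 : 1 <= m by rewrite hm; have := pos_INR N; lra.
have mm : 0 < m * (m + 1) by apply: Rmult_lt_0_compat; lra.
have q0 : 0 < 3 / (m * (m + 1)) by apply: Rdiv_lt_0_compat; lra.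
set t := sqrt (3 / (m * (m + 1))).
have t0 : 0 < t by apply: sqrt_lt_R0.
have tt : t * t * (m * (m + 1)) = 3.
  rewrite /t sqrt_sqrt; last lra. field; lra.
have e3 : (m * t) * (m * t) + (m * t) * t = 3 by rewrite -tt; ring.
have mt0 : 0 < m * t by apply: Rmult_lt_0_compat; lra.
have tmt : t <= m * t by rewrite -{1}[t]Rmult_1_l; apply: Rmult_le_compat_r; lra.
set c := m * t in e3 mt0 tmt.
have mt1 : 1 <= c by nra.
have mt2 : c <= 2 by nra.
clearbody t.
exists N.+1, (s * t); split; last exact: m1.
rewrite -/m; split.
- nra.
- have : s * t * m <= 2 * s by (have -> : s * t * m = s * c by rewrite /c; ring); nra.
  have : 2 * s <= dt * m.
    have -> : 2 * s = 2 * s / dt * dt by field; lra.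
    rewrite Rmult_comm; apply: Rmult_le_compat_l; lra.
  move=> h3 h4; apply: (Rmult_le_reg_r m); lra.
- have -> : (s * t) ^ 2 * (m * (m + 1) / 3) = s ^ 2 * (t * t * (m * (m + 1)) / 3) by field.
  rewrite tt; field.
- have -> : m * (s * t) = s * c by rewrite /c; ring.
  nra.
- have -> : m * (s * t) = s * c by rewrite /c; ring.
  nra.
Qed.

(** The slopes [p] and [p'] give the drop just outside of the chord; the minimum over a compact
    middle part gives the surplus inside. *)
Lemma chord_box (u : R -> R -> R) L a0 b0 y0 h0 p q p' q' eta :
  0 < L ->
  (forall x y x' y', Rabs (u x y - u x' y') <= L * (Rabs (x - x') + Rabs (y - y'))) ->
  a0 < b0 -> u a0 y0 = h0 -> u b0 y0 = h0 -> (forall x, a0 < x < b0 -> h0 < u x y0) ->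
  0 < p -> p' < 0 -> strict_diff u a0 y0 p q -> strict_diff u b0 y0 p' q' -> 0 < eta ->
  exists r e2, [/\ 0 < r, r <= eta, 0 < e2, 4 * r <= b0 - a0 &
   [/\ u (a0 - r) y0 <= h0 - 3 * e2, u (b0 + r) y0 <= h0 - 3 * e2 &
       forall x, a0 + r <= x <= b0 - r -> h0 + 3 * e2 <= u x y0]].
Proof.
move=> hL hlip hab ha hb hin hp hp' dA dB heta.
have [eA [eA0 hA]] := dA (p / 2) ltac:(lra).
have [eB [eB0 hB]] := dB (- p' / 2) ltac:(lra).
have [r [hr [r1 [r2 [r3 [r4 _]]]]]] := common_min [:: eta; eA / 2; eB / 2; (b0 - a0) / 4]
  ltac:(repeat split; lra).
have ba : u (a0 - r) y0 <= h0 - p / 2 * r.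
  have := hA (a0 - r) y0 a0 y0; rewrite !Rminus_diag !Rabs_R0.
  have -> : a0 - r - a0 = - r by ring.
  rewrite Rabs_Ropp (Rabs_pos_eq r); last lra.
  move=> /(_ ltac:(lra) ltac:(lra) ltac:(lra) ltac:(lra)) /Rabs_le_elim; nra.
have bb : u (b0 + r) y0 <= h0 + p' / 2 * r.
  have := hB (b0 + r) y0 b0 y0; rewrite !Rminus_diag !Rabs_R0.
  have -> : b0 + r - b0 = r by ring.
  rewrite (Rabs_pos_eq r); last lra.
  move=> /(_ ltac:(lra) ltac:(lra) ltac:(lra) ltac:(lra)) /Rabs_le_elim; nra.
have [x0 [hmin hx0]] : exists x0, (forall c, a0 + r <= c <= b0 - r -> u x0 y0 <= u c y0) /\ a0 + r <= x0 <= b0 - r.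
  apply: (continuity_ab_min (fun x => u x y0)); first lra.
  move=> c hc e he; exists (e / (2 * L)); split; first by apply: Rdiv_lt_0_compat; lra.
  move=> x [_]; rewrite /dist /= /R_dist => hx.
  apply: (Rle_lt_trans _ _ _ (hlip _ _ _ _)).
  rewrite Rminus_diag Rabs_R0 Rplus_0_r.
  have : L * Rabs (x - c) < L * (e / (2 * L)) by apply: Rmult_lt_compat_l.
  have -> : L * (e / (2 * L)) = e / 2 by field; lra.
  lra.
have ux0 := hin x0 ltac:(lra).
have [e [he [l1 [l2 [l3 _]]]]] := common_min [:: p / 2 * r; - p' / 2 * r; u x0 y0 - h0]
  ltac:(repeat split; nra).
exists r, (e / 3); split; try lra; split; try lra.
move=> x hx; have := hmin x hx; lra.
Qed.

(** The comparison of scales. As [M], [n], [G], [N] are of the orders [1 / s], [1 / d], [d / eps],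
    [s / d], multiplication by [eps^2 d^2] turns the lower bound into [c s^2] and the upper bound
    into [C (L d + w s^2 + eps)]. The choice of [w] makes [C w = c / 4], and the remaining terms are
    beaten because [d] is small compared with [s^2]. *)
Lemma gain_bounds_absurd W L s d eps w N M n G e1 e2 t1 kap :
  0 < W -> 0 < L -> 0 < s -> 0 < d -> d <= 1 -> eps = d ^ 2 -> 0 < e1 -> 0 < e2 -> 0 < t1 ->
  0 < kap -> 1 <= N -> s <= N * d -> N * d <= 2 * s ->
  0 <= M -> M * s <= W -> 0 <= n -> n * d <= W -> 0 <= G -> G * eps <= L * d + 2 * eps ->
  w = (e1 * e2 * t1 * kap ^ 2 / 32) / (4 * (96 * W ^ 3 * (L + 2))) ->
  96 * W ^ 3 * (L + 2) * (L + 1) * d < e1 * e2 * t1 * kap ^ 2 / 32 * s ^ 2 / 2 ->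
  (e1 / (4 * s)) * ((e2 / (8 * eps)) * ((t1 * s / (2 * eps)) * (2 * (kap * N) * (kap * N)))) <=
  M * (n * G * (2 * n * ((2 * N + 1) / eps * (8 * (L * d) + 8 * (w * s ^ 2) + 8 * eps)))) ->
  False.
Proof.
move=> hW hL hs hd d1 he he1 he2 ht hk hN sN N2s hM MW hn nW hG GL hw hd2 hle.
have eps0 : 0 < eps by rewrite he; apply: pow_lt.
set c := e1 * e2 * t1 * kap ^ 2 / 32 in hw hd2.
have c0 : 0 < c.
  rewrite /c; have := pow_lt kap 2 hk => k2.
  by have := Rmult_lt_0_compat _ _ (Rmult_lt_0_compat _ _ (Rmult_lt_0_compat _ _ he1 he2) ht) k2; lra.
have W3 : 0 < W ^ 3 by apply: pow_lt.
set C := 96 * W ^ 3 * (L + 2) in hw hd2.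
have C0 : 0 < C by rewrite /C; apply: Rmult_lt_0_compat; lra.
have w0 : 0 < w by rewrite hw; apply: Rdiv_lt_0_compat; lra.
have s2 : 0 < s ^ 2 by apply: pow_lt.
have ws : 0 < w * s ^ 2 by apply: Rmult_lt_0_compat.
have Ld : 0 < L * d by apply: Rmult_lt_0_compat.
have : (c * s ^ 2) <= C * (L * d + w * s ^ 2 + eps).
  apply: (Rle_trans _ (eps ^ 2 * d ^ 2 * ((e1 / (4 * s)) * ((e2 / (8 * eps)) * ((t1 * s / (2 * eps)) * (2 * (kap * N) * (kap * N))))))).
    have -> : eps ^ 2 * d ^ 2 * ((e1 / (4 * s)) * ((e2 / (8 * eps)) * ((t1 * s / (2 * eps)) * (2 * (kap * N) * (kap * N))))) = c * (N * d) ^ 2.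
      by rewrite /c; field; lra.
    apply: Rmult_le_compat_l; first lra.
    apply: pow_incr; lra.
  apply: (Rle_trans _ (eps ^ 2 * d ^ 2 *  (M * (n * G * (2 * n * ((2 * N + 1) / eps * (8 * (L * d) + 8 * (w * s ^ 2) + 8 * eps))))))).
    apply: Rmult_le_compat_l => //.
    by apply: Rmult_le_pos; apply: pow_le; lra.
  set Z := L * d + w * s ^ 2 + eps.
  have Z0 : 0 < Z by rewrite /Z; lra.
  apply: (Rmult_le_reg_r s) => //.
  have -> : eps ^ 2 * d ^ 2 *  (M * (n * G * (2 * n * ((2 * N + 1) / eps * (8 * (L * d) + 8 * (w * s ^ 2) + 8 * eps))))) * s =
     16 * ((M * s) * (n * d) * (n * d) * ((G * eps) * (2 * N + 1))) * Z by rewrite /Z; field; lra.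
  have -> : C * Z * s = 16 * (W * W * W * ((L + 2) * (6 * s))) * Z by rewrite /C; ring.
  apply: Rmult_le_compat_r; first lra.
  apply: Rmult_le_compat_l; first lra.
  have a1 : 0 <= M * s by apply: Rmult_le_pos; lra.
  have a2 : 0 <= n * d by apply: Rmult_le_pos; lra.
  have a3 : 0 <= G * eps by apply: Rmult_le_pos; lra.
  have a4 : G * eps * (2 * N + 1) <= (L + 2) * (6 * s).
    apply: (Rle_trans _ (((L + 2) * d) * (2 * N + 1))).
      apply: Rmult_le_compat_r; first lra.
      rewrite he in GL *; have : d ^ 2 <= d by nra.
      nra.
    rewrite Rmult_assoc; apply: Rmult_le_compat_l; nra.
  apply: Rmult_le_compat => //.
  - apply: Rmult_le_pos => //; exact: Rmult_le_pos.
  - apply: Rmult_le_pos => //; lra.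
  - apply: Rmult_le_compat => //; first exact: Rmult_le_pos.
    exact: Rmult_le_compat.
have Cw : C * w = c / 4 by rewrite hw; field; lra.
have epsd : eps <= d by rewrite he; nra.
have : C * (L * d + w * s ^ 2 + eps) <= C * (L + 1) * d + c / 4 * s ^ 2.
  rewrite -Cw; have : C * eps <= C * d by apply: Rmult_le_compat_l; lra.
  lra.
have : 0 < c * s ^ 2 by apply: Rmult_lt_0_compat.
lra.
Qed.

(** The order of the choices matters: the chord fixes [z], [eta], [e2], [e1] and so the constant [c]
    of the gain; then come [w], the row distance [s] below the threshold of the stencil for [w], the
    mesh [d] depending on [s], and [eps = d^2]. *)
Lemma chord_reflection (u : R -> R -> R) (f : R -> R) (X L U a0 b0 y0 h0 p q p' q' : R) :
  0 < X -> 0 < L ->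
  (forall x y, 0 <= u x y) -> (forall x y, u x y <= U) ->
  (forall x y, X < Rabs x \/ X < Rabs y -> u x y = 0) ->
  (forall x y x' y', Rabs (u x y - u x' y') <= L * (Rabs (x - x') + Rabs (y - y'))) ->
  (forall w, 0 < w -> exists eta, 0 < eta /\ forall x y x' y',
     Rabs (u x y - u x' y') <= eta -> Rabs (f (u x y) - f (u x' y')) <= w) ->
  stencil u f ->
  a0 < b0 -> 0 < h0 -> u a0 y0 = h0 -> u b0 y0 = h0 ->
  (forall x, a0 < x < b0 -> h0 < u x y0) ->
  0 < p -> p' < 0 -> strict_diff u a0 y0 p q -> strict_diff u b0 y0 p' q' ->
  p' = - p /\ q' = q.
Proof.
move=> X0 L0 u0 uU usupp uLip fU hst hab h0p ua ub hin hp hp' dA dB.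
apply: NNPP => hne.
have [t0 [t1 [z [kap [t10 z0 kap0 ht hgap]]]]] := gap_constants p q p' q' hp hp' hne.
have [eA [eA0 hA]] := dA z z0.
have [eB [eB0 hB]] := dB z z0.
have supp0 x y : u x y <> 0 -> Rabs x <= X /\ Rabs y <= X.
  by move=> h; split; apply: Rnot_lt_le => h'; apply: h; apply: usupp; [left|right].
have [aX yX] := supp0 a0 y0 ltac:(lra).
have [bX _] := supp0 b0 y0 ltac:(lra).
have [eta [eta0 [et1 [et2 [et3 [et4 _]]]]]] := common_min [:: eA; eB; (b0 - a0) / 8; 1]
  ltac:(repeat split; lra).
have [r [e3 [r0 reta e30 rab [boxA boxB boxI]]]] := chord_box u L a0 b0 y0 h0 p q p' q' (eta / 2)
  L0 uLip hab ua ub hin hp hp' dA dB ltac:(lra).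
have [e2 [e20 [e2a [e2b [e2c _]]]]] := common_min [:: e3; 1; h0] ltac:(repeat split; lra).
have [e1 [e10 [e1a [e1b _]]]] := common_min [:: eta / 2; e2 / (2 * L)]
  ltac:(repeat split; [lra | apply: Rdiv_lt_0_compat; lra]).
have {}e1b : L * e1 <= e2 / 2.
  have -> : e2 / 2 = L * (e2 / (2 * L)) by field; lra.
  apply: Rmult_le_compat_l; lra.
set kp := Rmin (kap / 2) (/ 2).
have kp0 : 0 < kp by apply: Rmin_glb_lt; lra.
have kp1 : kp <= kap / 2 by apply: Rmin_l.
have kp2 : kp <= / 2 by apply: Rmin_r.
set W := 2 * X + 3.
have W0 : 0 < W by rewrite /W; lra.
set c := e1 * e2 * t1 * kp ^ 2 / 32.
have k2 := pow_lt kp 2 kp0.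
have c0 : 0 < c.
  by have := Rmult_lt_0_compat _ _ (Rmult_lt_0_compat _ _ (Rmult_lt_0_compat _ _ e10 e20) t10) k2; rewrite /c; lra.
set C := 96 * W ^ 3 * (L + 2).
have C0 : 0 < C by rewrite /C; have := pow_lt W 3 W0 => ?; apply: Rmult_lt_0_compat; lra.
set w := c / (4 * C).
have w0 : 0 < w by apply: Rdiv_lt_0_compat; lra.
have [s0 [s00 hst']] := hst w w0.
have [ef [ef0 hef]] := fU w w0.
have Q0 : 0 < Rabs (q + t0) + t1 by have := Rabs_pos (q + t0); lra.
have [s [hs [s1 [s2 [s3 [s4 [s5 _]]]]]]] := common_min
  [:: s0 / 2; / 8; e1 / 8; e2 / 8 / (Rabs (q + t0) + t1); (b0 - a0) / 16]
  ltac:(repeat split; try lra; apply: Rdiv_lt_0_compat; lra).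
have {}s4 : s * (Rabs (q + t0) + t1) <= e2 / 8.
  have -> : e2 / 8 = e2 / 8 / (Rabs (q + t0) + t1) * (Rabs (q + t0) + t1) by field; lra.
  apply: Rmult_le_compat_r; lra.
have ss := pow_lt s 2 hs.
have ts : 0 < t1 * s by apply: Rmult_lt_0_compat.
have zs : 0 < z * s by apply: Rmult_lt_0_compat.
have cs : 0 < c * s ^ 2 by apply: Rmult_lt_0_compat.
have CL : 0 < C * (L + 1) by apply: Rmult_lt_0_compat; lra.
have [dt [dt0 [d1 [d2 [d3 [d4 [d5 [d6 [d7 [d8 [d9 _]]]]]]]]]]] := common_min
  [:: ef / (2 * L); / 8; z * s / (2 * L); e2 / (2 * L); e2 / 8; t1 * s / 2; eta / 4;
      c * s ^ 2 / 4 / (C * (L + 1)); (b0 - a0) / 16]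
  ltac:(repeat split; try lra; apply: Rdiv_lt_0_compat; lra).
have [N [d [[d0 ddt hsd sN N2s] N1]]] := lattice_params s dt hs dt0.
have lmul x : dt <= x / (2 * L) -> 2 * (L * d) <= x.
  move=> h; have -> : x = 2 * L * (x / (2 * L)) by field; lra.
  rewrite -Rmult_assoc; apply: Rmult_le_compat_l; lra.
move: d1 d3 d4 => /lmul d1 /lmul d3 /lmul d4.
have {}d8 : C * (L + 1) * d <= c * s ^ 2 / 4.
  have -> : c * s ^ 2 / 4 = C * (L + 1) * (c * s ^ 2 / 4 / (C * (L + 1))) by field; lra.
  apply: Rmult_le_compat_l; lra.
set eps := d ^ 2.
have eps0 : 0 < eps by apply: pow_lt.
have epsd : eps <= d by rewrite /eps; nra.
have up x e : 0 < e -> 0 <= x -> exists m : nat, x <= INR m * e <= x + e.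
  move=> he hx; have [m hm] := nat_floor_mult x e he hx; exists m.+1; rewrite S_INR; lra.
have U0 : h0 <= U by rewrite -ua.
have [n [n1 n2]] := up (2 * X + 2) d d0 ltac:(lra).
have [M [M1 M2]] := up (2 * X + 2) s hs ltac:(lra).
have [K [K1 K2]] := up (U + 1) eps eps0 ltac:(lra).
have Ld0 : 0 < L * d by apply: Rmult_lt_0_compat.
have [G [G1 G2]] := up (L * d + eps) eps eps0 ltac:(lra).
have margin : (INR N + 2) * d < 1 by lra.
have hi := pair_gain_upper u f X L U X0 L0 u0 uU usupp uLip N K n M G d s eps w d0 eps0 w0 margin n1 M1 K1 G1
  (hst' N d s d0 ltac:(lra) hsd)
  (fun x y x' y' h => hef x y x' y' ltac:(lra)).
have boxI' x : a0 + r <= x <= b0 - r -> h0 + 3 * e2 <= u x y0.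
  by move=> /boxI; lra.
have kpk : 2 * kp <= kap by lra.
have lo := pair_gain_lower u X L U X0 L0 u0 uU usupp uLip N K n d s eps d0 hs eps0 margin n1 K1
  a0 b0 y0 h0 p q p' q' eta r e1 e2 t0 t1 z kp
  (fun x y x' y' h1 h2 h3 h4 => hA x y x' y' ltac:(lra) ltac:(lra) ltac:(lra) ltac:(lra))
  (fun x y x' y' h1 h2 h3 h4 => hB x y x' y' ltac:(lra) ltac:(lra) ltac:(lra) ltac:(lra))
  r0 ltac:(lra) ltac:(lra) ltac:(lra) aX bX ltac:(lra) ltac:(lra) ltac:(lra)
  boxI' e20 ltac:(lra) sN N2s ltac:(lra) ltac:(lra)
  ltac:(lra).
have {}lo := lo (fun tau da db h1 h2 h3 => match hgap s tau da db hs h1 h2 h3 with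
   conj g1 g2 => conj g1 (Rle_trans _ _ _ (Rmult_le_compat_r s _ _ (Rlt_le _ _ hs) kpk) g2) end)
  ltac:(lra) ltac:(lra) s4 e2c U0 e2b t10.
have [j0 [hj1 hj2]] := nat_floor_mult (y0 + (X + 1)) s hs ltac:(move/Rabs_le_elim: yX; lra).
have [m1 [hm1 hm2]] := nat_floor_mult (e1 / 2) s hs ltac:(lra).
have hm3 : e1 / (4 * s) <= INR m1.
  apply: (Rmult_le_reg_r s) => //.
  have -> : e1 / (4 * s) * s = e1 / 4 by field; lra.
  lra.
set P := (e2 / (8 * eps)) * ((t1 * s / (2 * eps)) * (2 * (kp * INR N) * (kp * INR N))) in lo.
have kN : 0 <= kp * INR N by apply: Rmult_le_pos; lra.
have P0 : 0 <= P.
  apply: Rmult_le_pos; first by apply: Rdiv_le_0_compat; lra.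
  apply: Rmult_le_pos; first by apply: Rdiv_le_0_compat; lra.
  by apply: Rmult_le_pos; lra.
have rows : INR m1 * P <= \rsum_(j < M) pair_gain K n N (grid_level u X d s eps j) (grid_level u X d s eps j.+1).
  (* [j0.+1] is the first row above [y0]. The [m1] rows from there on, and the successor of each,
     stay within [e1] of [y0]. *)
  apply: (rsum_window (fun j => pair_gain K n N (grid_level u X d s eps j) (grid_level u X d s eps j.+1)) M j0.+1 m1 P).
  - move=> j; apply: rsum_ge0 => t gt; apply: rsum_ge0 => t' gt'; exact: gain_term_ge0 gt gt'.
  - apply/leP; apply: INR_le; rewrite plus_INR S_INR.
    apply: (Rmult_le_reg_r s) => //; move/Rabs_le_elim: yX; lra.
  - move=> i hi'.
    have ii : INR i + 1 <= INR m1 by rewrite -S_INR; apply: le_INR; lia.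
    have i0 : 0 <= INR i * s by apply: Rmult_le_pos; [exact: pos_INR | lra].
    have i1 : (INR i + 1) * s <= INR m1 * s by apply: Rmult_le_compat_r; lra.
    apply: lo; rewrite /grid_y ?plus_INR ?S_INR ?plus_INR ?S_INR; apply: Rabs_le_intro; lra.
apply: (gain_bounds_absurd W L s d eps w (INR N) (INR M) (INR n) (INR G) e1 e2 t1 kp) => //; try lra.
- exact: pos_INR.
- rewrite /W; lra.
- exact: pos_INR.
- rewrite /W; lra.
- exact: pos_INR.
- have := cs; rewrite -/c -/C; lra.
- apply: Rle_trans hi; apply: Rle_trans rows; exact: Rmult_le_compat_r.
Qed.

(** * Differentiable functions of two variables *)

Lemma cont2_eps u : cont2 u -> forall x y e, 0 < e -> exists d, 0 < d /\
  forall x' y', Rabs (x' - x) < d -> Rabs (y' - y) < d -> Rabs (u x' y' - u x y) < e.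
Proof.
move=> hu x y e he.
have /filterlim_locally /(_ (mkposreal e he)) [d hd] := hu x y.
exists d; split; first exact: cond_pos.
by move=> x' y' hx hy; apply: (hd (x', y')); split.
Qed.

Lemma cont2_continuity_2d u : cont2 u -> forall x y, continuity_2d_pt u x y.
Proof.
move=> hu x y e; have [d [hd h]] := cont2_eps u hu x y e (cond_pos e).
by exists (mkposreal d hd).
Qed.

Lemma cont2_slice_y u : cont2 u -> forall x y, continuous (fun t => u x t) y.
Proof.
move=> hu x y; apply/filterlim_locally => e.
have [d [hd h]] := cont2_eps u hu x y e (cond_pos e).
exists (mkposreal d hd) => t ht; apply: h => //.
by rewrite Rminus_diag Rabs_R0.
Qed.

Lemma Ck_pred k u : Ck (S k) u -> Ck k u.
Proof.
elim: k u => [|k IH] u; first by case.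
case=> h1 [h2 [h3 h4]]; split=> //; split=> //; split; exact: IH.
Qed.

Lemma Ck_cont2 k u : Ck k u -> cont2 u.
Proof. by case: k => [|k] //= []. Qed.

Lemma Ck_is_derive_x k u x y : Ck (S k) u -> is_derive (fun t => u t y) x (dx u x y).
Proof. by case=> _ [h _]; apply: Derive_correct; have [] := h x y. Qed.

Lemma Ck_is_derive_y k u x y : Ck (S k) u -> is_derive (fun t => u x t) y (dy u x y).
Proof. by case=> _ [h _]; apply: Derive_correct; have [] := h x y. Qed.

Lemma Ck_dx k u : Ck (S k) u -> Ck k (dx u).
Proof. by case=> _ [_ []]. Qed.

Lemma Ck_dy k u : Ck (S k) u -> Ck k (dy u).
Proof. by case=> _ [_ []]. Qed.

Lemma mvt (f df : R -> R) a b : (forall x, is_derive f x (df x)) ->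
  exists c, Rmin a b <= c <= Rmax a b /\ f b - f a = df c * (b - a).
Proof.
move=> h; apply: MVT_gen => x hx //.
by apply: derivable_continuous_pt; exists (df x); apply/is_derive_Reals.
Qed.

Lemma between_dist a b c x0 d : Rmin a b <= c <= Rmax a b ->
  Rabs (a - x0) < d -> Rabs (b - x0) < d -> Rabs (c - x0) < d.
Proof.
move=> hc /Rabs_def2 ha /Rabs_def2 hb; apply: Rabs_def1;
  move: hc; rewrite /Rmin /Rmax; destruct Rle_dec; lra.
Qed.

Lemma C1_strict_diff u x0 y0 : Ck 1 u -> strict_diff u x0 y0 (dx u x0 y0) (dy u x0 y0).
Proof.
move=> hu z hz.
have [d1 [hd1 h1]] := cont2_eps (dx u) (Ck_cont2 _ _ (Ck_dx _ _ hu)) x0 y0 z hz.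
have [d2 [hd2 h2]] := cont2_eps (dy u) (Ck_cont2 _ _ (Ck_dy _ _ hu)) x0 y0 z hz.
have m1 := Rmin_l d1 d2; have m2 := Rmin_r d1 d2.
exists (Rmin d1 d2); split; first exact: Rmin_glb_lt.
move=> x y x' y' hx hy hx' hy'.
have [a [ha ea]] := mvt (fun t => u t y) (fun t => dx u t y) x' x
  (fun t => Ck_is_derive_x 0 u t y hu).
have [b [hb eb]] := mvt (fun t => u x' t) (fun t => dy u x' t) y' y
  (fun t => Ck_is_derive_y 0 u x' t hu).
have -> : u x y - u x' y' - dx u x0 y0 * (x - x') - dy u x0 y0 * (y - y') =
   (dx u a y - dx u x0 y0) * (x - x') + (dy u x' b - dy u x0 y0) * (y - y') by lra.
apply: (Rle_trans _ _ _ (Rabs_triang _ _)); rewrite !Rabs_mult.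
have ka : Rabs (a - x0) < d1.
  by apply: Rlt_le_trans m1; apply: between_dist ha _ _.
have kb : Rabs (b - y0) < d2.
  by apply: Rlt_le_trans m2; apply: between_dist hb _ _.
have := h1 a y ka ltac:(lra); have := h2 x' b ltac:(lra) kb.
have := Rabs_pos (x - x'); have := Rabs_pos (y - y') => p1 p2 q1 q2.
rewrite Rmult_plus_distr_l; apply: Rplus_le_compat; apply: Rmult_le_compat_r; lra.
Qed.

Lemma strict_diff_diff u x y p q : strict_diff u x y p q -> differentiable_pt_lim u x y p q.
Proof.
move=> h e; have [d [hd hh]] := h (e / 2) ltac:(have := cond_pos e; lra).
exists (mkposreal d hd) => a b ha hb.
have := hh a b x y ha hb; rewrite !Rminus_diag !Rabs_R0 => /(_ hd hd) h1.
have -> : u a b - u x y - (p * (a - x) + q * (b - y)) = u a b - u x y - p * (a - x) - q * (b - y) by ring.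
apply: Rle_trans h1 _.
have := Rmax_l (Rabs (a - x)) (Rabs (b - y)); have := Rmax_r (Rabs (a - x)) (Rabs (b - y)).
have := cond_pos e; nra.
Qed.

Lemma C1_comp u P Q t P' Q' : Ck 1 u -> is_derive P t P' -> is_derive Q t Q' ->
  is_derive (fun t => u (P t) (Q t)) t (dx u (P t) (Q t) * P' + dy u (P t) (Q t) * Q').
Proof.
move=> hu /is_derive_Reals hP /is_derive_Reals hQ; apply/is_derive_Reals.
apply: derivable_pt_lim_comp_2d => //; apply: strict_diff_diff; exact: C1_strict_diff.
Qed.

Lemma C2_schwarz u x y : Ck 2 u -> dx (dy u) x y = dy (dx u) x y.
Proof.
move=> hu; apply: Schwarz.
- exists (mkposreal 1 Rlt_0_1) => a b _ _; split; [|split; [|split]].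
  + by exists (dx u a b); apply: (Ck_is_derive_x 1).
  + by exists (dy u a b); apply: (Ck_is_derive_y 1).
  + by exists (dx (dy u) a b); apply: (Ck_is_derive_x 0); apply: Ck_dy.
  + by exists (dy (dx u) a b); apply: (Ck_is_derive_y 0); apply: Ck_dx.
- apply: (cont2_continuity_2d (dx (dy u))); exact: (Ck_cont2 _ _ (Ck_dx _ _ (Ck_dy _ _ hu))).
- apply: (cont2_continuity_2d (dy (dx u))); exact: (Ck_cont2 _ _ (Ck_dy _ _ (Ck_dx _ _ hu))).
Qed.

Definition const_off_box (X c : R) (u : R -> R -> R) : Prop :=
  forall x y, X < Rabs x \/ X < Rabs y -> u x y = c.

Lemma box_uniform u X c : cont2 u -> const_off_box X c u ->
  forall e, 0 < e -> exists d, 0 < d /\ forall x y x' y',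
    Rabs (x' - x) < d -> Rabs (y' - y) < d -> Rabs (u x' y' - u x y) < e.
Proof.
move=> hu hc e he.
have [d hd] := uniform_continuity_2d u (- (X + 1)) (X + 1) (- (X + 1)) (X + 1)
  (fun x y _ _ => cont2_continuity_2d u hu x y) (mkposreal e he).
have d0 := cond_pos d; have m1 := Rmin_l d 1; have m2 := Rmin_r d 1.
exists (Rmin d 1); split; first by apply: Rmin_glb_lt; lra.
move=> x y x' y' hx hy.
have [h|h] := classic (- (X + 1) <= x <= X + 1 /\ - (X + 1) <= y <= X + 1 /\
  - (X + 1) <= x' <= X + 1 /\ - (X + 1) <= y' <= X + 1).
  by apply: hd; try tauto; lra.
suff [-> ->] : u x y = c /\ u x' y' = c by rewrite Rminus_diag Rabs_R0.
move/Rabs_def2: hx => hx; move/Rabs_def2: hy => hy.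
have big x0 : ~ (- (X + 1) <= x0 <= X + 1) -> X + 1 < Rabs x0.
  by move=> h0; apply: Rnot_le_lt => /Rabs_le_elim.
have big' x0 x1 : ~ (- (X + 1) <= x0 <= X + 1) -> -1 < x0 - x1 < 1 -> X < Rabs x1.
  move=> h0 h1; apply: Rnot_le_lt => /Rabs_le_elim h2; apply: h0; lra.
have h4 : ~ (- (X + 1) <= x <= X + 1) \/ ~ (- (X + 1) <= y <= X + 1) \/
  ~ (- (X + 1) <= x' <= X + 1) \/ ~ (- (X + 1) <= y' <= X + 1) by tauto.
case: h4 => [h4|[h4|[h4|h4]]]; split; apply: hc.
- left; have := big _ h4; lra.
- left; apply: big' h4 _; lra.
- right; have := big _ h4; lra.
- right; apply: big' h4 _; lra.
- left; apply: big' h4 _; lra.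
- left; have := big _ h4; lra.
- right; apply: big' h4 _; lra.
- right; have := big _ h4; lra.
Qed.

(** A horizontal walk with steps [d / 2] leaves the box after [n + 1] steps, and each step changes
    the value by less than 1. *)
Lemma box_bounded u X c : 0 < X -> cont2 u -> const_off_box X c u ->
  exists B, 0 < B /\ forall x y, Rabs (u x y) <= B.
Proof.
move=> hX hu hc.
have [d [d0 hd]] := box_uniform u X c hu hc 1 Rlt_0_1.
have [n [n1 n2]] := nat_floor_mult (2 * X + d) (d / 2) ltac:(lra) ltac:(lra).
exists (Rabs c + INR n + 1).
split; first by have := Rabs_pos c; have := pos_INR n; lra.
move=> x y.
have step m : Rabs (u (x + INR m * (d / 2)) y - u x y) <= INR m.
  elim: m => [|m IH].
    have -> : x + INR 0 * (d / 2) = x by rewrite /=; ring.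
    rewrite Rminus_diag Rabs_R0 /=; lra.
  have := hd (x + INR m * (d / 2)) y (x + INR m.+1 * (d / 2)) y.
  rewrite Rminus_diag Rabs_R0 S_INR.
  have -> : x + (INR m + 1) * (d / 2) - (x + INR m * (d / 2)) = d / 2 by ring.
  rewrite Rabs_pos_eq; last lra.
  move=> /(_ ltac:(lra) d0) h1.
  have := Rabs_triang (u (x + (INR m + 1) * (d / 2)) y - u (x + INR m * (d / 2)) y) (u (x + INR m * (d / 2)) y - u x y).
  have -> : u (x + (INR m + 1) * (d / 2)) y - u (x + INR m * (d / 2)) y + (u (x + INR m * (d / 2)) y - u x y) = u (x + (INR m + 1) * (d / 2)) y - u x y by ring.
  lra.
have hc0 := Rabs_pos c; have n0 := pos_INR n.
have [h|h] := Rlt_dec X (Rabs x); first by rewrite hc; [lra | left].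
move: h => /Rnot_lt_le /Rabs_le_elim h.
have := step n.+1; rewrite (hc (x + _)); last first.
  left; rewrite Rabs_pos_eq S_INR; lra.
have := Rabs_triang (- (c - u x y)) c; rewrite Rabs_Ropp S_INR.
have -> : - (c - u x y) + c = u x y by ring.
lra.
Qed.

Lemma bounded_grad_lipschitz u L :
  Ck 1 u -> (forall x y, Rabs (dx u x y) <= L) -> (forall x y, Rabs (dy u x y) <= L) ->
  forall x y x' y', Rabs (u x y - u x' y') <= L * (Rabs (x - x') + Rabs (y - y')).
Proof.
move=> hu hx hy x y x' y'.
have [a [ha ea]] := mvt (fun t => u t y) (fun t => dx u t y) x' x
  (fun t => Ck_is_derive_x 0 u t y hu).
have [b [hb eb]] := mvt (fun t => u x' t) (fun t => dy u x' t) y' y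
  (fun t => Ck_is_derive_y 0 u x' t hu).
have -> : u x y - u x' y' = dx u a y * (x - x') + dy u x' b * (y - y') by lra.
apply: (Rle_trans _ _ _ (Rabs_triang _ _)); rewrite !Rabs_mult Rmult_plus_distr_l.
by apply: Rplus_le_compat; apply: Rmult_le_compat_r => //; apply: Rabs_pos.
Qed.

Lemma is_derive_bound f x l : is_derive f x l -> forall e, 0 < e -> exists d, 0 < d /\
  forall t, Rabs (t - x) < d -> Rabs (f t - f x - l * (t - x)) <= e * Rabs (t - x).
Proof.
move=> /is_derive_Reals h e he.
have [d hd] := h e he.
exists d; split; first exact: cond_pos.
move=> t ht; have [->|ne] := Req_dec t x.
  rewrite !Rminus_diag Rmult_0_r Rminus_0_r Rabs_R0; lra.
have n0 : t - x <> 0 by lra.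
have := hd (t - x) n0 ht.
have -> : x + (t - x) = t by ring.
move=> h1; have -> : f t - f x - l * (t - x) = ((f t - f x) / (t - x) - l) * (t - x) by field.
rewrite Rabs_mult; apply: Rmult_le_compat_r; [exact: Rabs_pos | lra].
Qed.

(** * Regular points do not have the value at infinity *)

(** Since [g] has nonzero slope at [t0], every [h] near [g t0] is some [g t] with [t - t0] at most
    [2 / |m|] times [h - g t0], and [f h = G t]. It will be used on an axis line, with [psi] for [g]
    and minus the Laplacian for [G], differentiable because [psi] is [C^3]. *)
Lemma lipschitz_at_regular_value (f g G : R -> R) t0 m k :
  (forall t, continuity_pt g t) -> is_derive g t0 m -> m <> 0 -> is_derive G t0 k ->
  (forall t, G t = f (g t)) ->
  exists K eta, 0 < K /\ 0 < eta /\ forall h, Rabs (h - g t0) < eta ->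
    Rabs (f h - f (g t0)) <= K * Rabs (h - g t0).
Proof.
move=> gc dg m0 dG hG.
have am : 0 < Rabs m by apply: Rabs_pos_lt.
have [d1 [hd1 h1]] := is_derive_bound g t0 m dg (Rabs m / 2) ltac:(lra).
have [d2 [hd2 h2]] := is_derive_bound G t0 k dG 1 Rlt_0_1.
have [d [hd [l1 [l2 _]]]] := common_min [:: d1; d2] ltac:(repeat split; lra).
have low t : Rabs (t - t0) < d -> Rabs m / 2 * Rabs (t - t0) <= Rabs (g t - g t0).
  move=> ht; have := h1 t ltac:(lra).
  have := Rabs_triang (g t - g t0) (- (g t - g t0 - m * (t - t0))).
  rewrite Rabs_Ropp.
  have -> : g t - g t0 + - (g t - g t0 - m * (t - t0)) = m * (t - t0) by ring.
  rewrite Rabs_mult; lra.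
exists ((Rabs k + 1) * (2 / Rabs m)), (Rabs m / 2 * (d / 2)).
have K0 : 0 < (Rabs k + 1) * (2 / Rabs m).
  apply: Rmult_lt_0_compat; [have := Rabs_pos k; lra | apply: Rdiv_lt_0_compat; lra].
split=> //; split; first nra.
move=> h hh.
have sgn e : Rabs e < d -> Rabs (g (t0 + e) - g t0 - m * e) <= Rabs m / 2 * Rabs e.
  move=> he; have := h1 (t0 + e).
  have -> : t0 + e - t0 = e by ring.
  by apply; lra.
have s1 := sgn (d / 2) ltac:(rewrite Rabs_pos_eq; lra).
have s2 := sgn (- (d / 2)) ltac:(rewrite Rabs_Ropp Rabs_pos_eq; lra).
rewrite Rabs_Ropp in s2; rewrite !(Rabs_pos_eq (d / 2)) in s1 s2; try lra.
have [t [ht egt]] : {t | Rmin (t0 + - (d / 2)) (t0 + d / 2) <= t <= Rmax (t0 + - (d / 2)) (t0 + d / 2) /\ g t = h}.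
  apply: IVT_gen; first by move=> t; exact: gc.
  move/Rabs_le_elim: s1 => s1; move/Rabs_le_elim: s2 => s2; move/Rabs_def2: hh => hh.
  move: s1 s2 hh am; rewrite /Rabs; case: Rcase_abs => hm s1 s2 hh am.
    rewrite Rmin_right ?Rmax_left; lra.
  rewrite Rmin_left ?Rmax_right; lra.
rewrite Rmin_left ?Rmax_right in ht; try lra.
have td : Rabs (t - t0) < d by apply: Rabs_def1; lra.
have lt := low t td.
have := h2 t ltac:(lra); rewrite !hG egt => hG'.
have : Rabs (f h - f (g t0)) <= (Rabs k + 1) * Rabs (t - t0).
  have := Rabs_triang (f h - f (g t0) - k * (t - t0)) (k * (t - t0)).
  have -> : f h - f (g t0) - k * (t - t0) + k * (t - t0) = f h - f (g t0) by ring.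
  rewrite (Rabs_mult k); lra.
move=> hk; apply: Rle_trans hk _.
rewrite Rmult_assoc; apply: Rmult_le_compat_l; first by have := Rabs_pos k; lra.
apply: (Rmult_le_reg_l (Rabs m / 2)); first lra.
have -> : Rabs m / 2 * (2 / Rabs m * Rabs (h - g t0)) = Rabs (h - g t0) by field; lra.
by rewrite -egt.
Qed.

Lemma continuity_pt_eps g t : continuity_pt g t -> forall e, 0 < e -> exists d, 0 < d /\
  forall s, Rabs (s - t) < d -> Rabs (g s - g t) < e.
Proof.
move=> h e he; have [d [hd hh]] := h e he; exists d; split=> // s hs.
have [->|ne] := Req_dec s t; first by rewrite Rminus_diag Rabs_R0.
by apply: hh; split; [split=> //; exact: not_eq_sym | exact: hs].
Qed.

Lemma first_hit g u v y : (forall t, continuity_pt g t) -> u < v -> y < g u -> g v <= y ->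
  exists t, u < t <= v /\ g t = y /\ forall s, u <= s < t -> y < g s.
Proof.
move=> hc huv hu hv.
pose S x := u <= x <= v /\ forall t, u <= t <= x -> y < g t.
have Su : S u by split; [lra | move=> t ht; have -> : t = u by lra].
have [l [ub lub]] := completeness S (ex_intro _ v (fun x hx => proj2 (proj1 hx))) (ex_intro _ u Su).
have ul : u <= l by apply: ub.
have lv : l <= v by apply: lub => x [[]].
have below s : u <= s < l -> y < g s.
  move=> hs; apply: NNPP => hn; have : l <= s; last lra.
  apply: lub => x [hx px]; apply: Rnot_lt_le => h; apply: hn; apply: px; lra.
have gl : g l = y.
  apply: NNPP => hne; have : g l < y \/ y < g l by lra.
  case=> h.
    have [d [d0 hd]] := continuity_pt_eps g l (hc l) (y - g l) ltac:(lra).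
    have [e|ne] := Req_dec l u; first by rewrite e in h; lra.
    set s := Rmax u (l - d / 2).
    have s1 : u <= s by apply: Rmax_l. have s2 : l - d / 2 <= s by apply: Rmax_r.
    have s3 : s < l by apply: Rmax_lub_lt; lra.
    have := below s (conj s1 s3); have := hd s ltac:(apply: Rabs_def1; lra) => /Rabs_def2; lra.
  have [d [d0 hd]] := continuity_pt_eps g l (hc l) (g l - y) ltac:(lra).
  have [e|ne] := Req_dec l v; first by rewrite e in h; lra.
  have r1 := Rmin_l v (l + d / 2); have r2 := Rmin_r v (l + d / 2).
  have r3 : l < Rmin v (l + d / 2) by apply: Rmin_glb_lt; lra.
  have : S (Rmin v (l + d / 2)); last by move/ub; lra.
  split; first lra.
  move=> t ht; have [tl|tl] := Rlt_dec t l; first by apply: below; lra.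
  have := hd t ltac:(apply: Rabs_def1; lra) => /Rabs_def2; lra.
exists l; split; last by split.
split=> //; have [e|//] : l = u \/ u < l by lra.
by rewrite e in gl; lra.
Qed.

(* H'' >= H'^2 / H - K H says that (log H)'' >= - K, so log H stays bounded below. *)
Lemma log_convex_positive (H H1 H2 : R -> R) (K a b : R) :
  (forall x, is_derive H x (H1 x)) -> (forall x, is_derive H1 x (H2 x)) ->
  a <= b -> 0 < H a -> 0 <= K ->
  (forall x, a <= x <= b -> 0 < H x -> H1 x ^ 2 / H x - K * H x <= H2 x) ->
  (forall x, 0 <= H x) -> 0 < H b.
Proof.
move=> dH dH1 hab Ha K0 hconv Hp.
have Hc x : continuity_pt H x.
  by apply: derivable_continuous_pt; exists (H1 x); apply/is_derive_Reals.
(* [B] bounds the rate at which [log H] can decrease on [[a, b]]: its initial slope, and [K] times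
   the length. *)
set B := Rabs (H1 a / H a) + K * (b - a).
have B0 : 0 <= B by rewrite /B; have := Rabs_pos (H1 a / H a); nra.
have low x : a <= x <= b -> (forall t, a <= t <= x -> 0 < H t) -> H a * exp (- B * (b - a)) <= H x.
  move=> hx pos.
  have quot t : a <= t <= x -> - B <= H1 t / H t.
    move=> ht.
    have [c [hc ec]] : exists c, Rmin a t <= c <= Rmax a t /\
       H1 t / H t - H1 a / H a = ((H2 c * H c - H1 c * H1 c) / H c ^ 2) * (t - a).
      apply: (MVT_gen (fun z => H1 z / H z)).
        move=> z; rewrite Rmin_left ?Rmax_right; try lra. move=> hz.
        apply: is_derive_div => //; have := pos z; lra.
      move=> z; rewrite Rmin_left ?Rmax_right; try lra. move=> hz.
      apply: continuity_pt_div => //; last by have := pos z; lra.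
      by apply: derivable_continuous_pt; exists (H2 z); apply/is_derive_Reals.
    rewrite Rmin_left ?Rmax_right in hc; try lra.
    have pc := pos c ltac:(lra).
    have h2 := hconv c ltac:(lra) pc.
    have : - K <= (H2 c * H c - H1 c * H1 c) / H c ^ 2.
      have -> : (H2 c * H c - H1 c * H1 c) / H c ^ 2 = (H2 c - H1 c ^ 2 / H c) / H c by field; lra.
      apply: (Rmult_le_reg_r (H c)) => //.
      have -> : (H2 c - H1 c ^ 2 / H c) / H c * H c = H2 c - H1 c ^ 2 / H c by field; lra.
      lra.
    set q := ((H2 c * H c - H1 c * H1 c) / H c ^ 2) in ec *; move=> hq.
    have := Rabs_le_elim _ _ (Rle_refl (Rabs (H1 a / H a))); rewrite /B.
    have : - K * (t - a) <= q * (t - a) by apply: Rmult_le_compat_r; lra.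
    have : K * (t - a) <= K * (b - a) by apply: Rmult_le_compat_l; lra.
    set q' := H1 t / H t in ec *; lra.
  have [c [hc ec]] : exists c, Rmin a x <= c <= Rmax a x /\
     H x * exp (B * x) - H a * exp (B * a) = (H1 c * exp (B * c) + H c * (B * exp (B * c))) * (x - a).
    apply: (MVT_gen (fun z => H z * exp (B * z))).
      move=> z _; apply: is_derive_mult => //; last by move=> *; apply: Rmult_comm.
      auto_derive => //; ring.
    move=> z _; apply: continuity_pt_mult => //.
    apply: derivable_continuous_pt; exists (B * exp (B * z)); apply/is_derive_Reals.
    by auto_derive => //; ring.
  rewrite Rmin_left ?Rmax_right in hc; try lra.
  have pc := pos c ltac:(lra).
  have : 0 <= (H1 c * exp (B * c) + H c * (B * exp (B * c))) * (x - a).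
    apply: Rmult_le_pos; last lra.
    have -> : H1 c * exp (B * c) + H c * (B * exp (B * c)) = (H1 c / H c + B) * (H c * exp (B * c)) by field; lra.
    apply: Rmult_le_pos; first by have := quot c ltac:(lra); lra.
    by apply: Rmult_le_pos; [lra | have := exp_pos (B * c); lra].
  move=> h0.
  have h1 : H a * exp (B * a) <= H x * exp (B * x) by lra.
  apply: (Rmult_le_reg_r (exp (B * x))); first exact: exp_pos.
  apply: Rle_trans h1; rewrite Rmult_assoc -exp_plus; apply: Rmult_le_compat_l; first lra.
  have [e|l] : - B * (b - a) + B * x = B * a \/ - B * (b - a) + B * x < B * a by nra.
    by rewrite e; lra.
  by have := exp_increasing _ _ l; lra.
set m := H a * exp (- B * (b - a)).
have m0 : 0 < m by apply: Rmult_lt_0_compat => //; exact: exp_pos.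
apply: Rnot_le_lt => Hb.
have ma : m <= H a by have := low a ltac:(lra) ltac:(by move=> t ht; have -> : t = a by lra).
have [e|l] : a = b \/ a < b by lra.
  by rewrite -e in Hb; lra.
(* If [H b] were 0, then [H] would take the value [m / 2] for a first time; up to this time it is
   positive, so the lower bound [m] applies there. *)
have [t [ht [et pos]]] := first_hit H a b (m / 2) Hc l ltac:(lra) ltac:(lra).
have := low t ltac:(lra); rewrite -/m et => h.
have : m <= m / 2; last lra.
apply: h => s hs; have [|st] := Rlt_dec s t; first by move=> st; have := pos s ltac:(lra); lra.
have -> : s = t by lra.
lra.
Qed.

Lemma cont2_plus u v : cont2 u -> cont2 v -> cont2 (fun x y => u x y + v x y).
Proof. move=> hu hv x y; apply: continuous_plus; [exact: hu | exact: hv]. Qed.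

Lemma cont2_mult u v : cont2 u -> cont2 v -> cont2 (fun x y => u x y * v x y).
Proof. move=> hu hv x y; apply: continuous_mult; [exact: hu | exact: hv]. Qed.

Lemma cont2_const c : cont2 (fun _ _ => c).
Proof. move=> x y; exact: continuous_const. Qed.

Lemma cont2_comp f u : (forall r, continuous f r) -> cont2 u -> cont2 (fun x y => f (u x y)).
Proof. move=> hf hu x y; apply: continuous_comp; [exact: hu | exact: hf]. Qed.

Lemma cont2_ext u v : (forall x y, u x y = v x y) -> cont2 u -> cont2 v.
Proof.
move=> h hu x y; apply: (continuous_ext (fun p => u (fst p) (snd p))) => //.
Qed.

Lemma cont2_ex_RInt u x a b : cont2 u -> ex_RInt (u x) a b.
Proof. move=> hu; apply: ex_RInt_continuous => t _; exact: cont2_slice_y. Qed.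

Lemma is_derive_RInt_slice g g' a b x :
  (forall s y, is_derive (fun t => g t y) s (g' s y)) -> cont2 g -> cont2 g' ->
  is_derive (fun s => RInt (g s) a b) x (RInt (g' x) a b).
Proof.
move=> hd hg hg'.
have e s y : Derive (fun t => g t y) s = g' s y by apply: is_derive_unique.
have -> : RInt (g' x) a b = RInt (fun t => Derive (fun u => g u t) x) a b.
  by apply: RInt_ext => t _; rewrite e.
apply: is_derive_RInt_param.
- exists (mkposreal 1 Rlt_0_1) => s _ t _; by exists (g' s t).
- move=> t _; apply: (continuity_2d_pt_ext g'); first by move=> ??; rewrite e.
  exact: cont2_continuity_2d.
- exists (mkposreal 1 Rlt_0_1) => s _; exact: cont2_ex_RInt.
Qed.

Lemma RInt_total_derivative g g' a b :
  (forall y, is_derive g y (g' y)) -> (forall y, continuous g' y) ->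
  (RInt g' a b : R) = g b - g a.
Proof.
move=> h hc; apply: is_RInt_unique; apply: is_RInt_derive => y _ //.
Qed.

Lemma RInt_sq_pos g a b y0 : a < y0 < b -> (forall y, continuous g y) ->
  (forall y, 0 <= g y) -> 0 < g y0 -> 0 < RInt g a b.
Proof.
move=> hy hc hp h0.
have /filterlim_locally /(_ (mkposreal (g y0 / 2) ltac:(lra))) [d hd] := hc y0.
have d0 := cond_pos d.
set a' := Rmax a (y0 - d / 2); set b' := Rmin b (y0 + d / 2).
have a1 : a <= a' by apply: Rmax_l. have a2 : y0 - d / 2 <= a' by apply: Rmax_r.
have b1 : b' <= b by apply: Rmin_l. have b2 : b' <= y0 + d / 2 by apply: Rmin_r.
have a3 : a' < y0 by apply: Rmax_lub_lt; lra.
have b3 : y0 < b' by apply: Rmin_glb_lt; lra.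
have ex c e : ex_RInt g c e by apply: ex_RInt_continuous => *; exact: hc.
rewrite -(RInt_Chasles g a a' b) // -(RInt_Chasles g a' b' b) //.
have i1 : 0 <= RInt g a a' by apply: RInt_ge_0.
have i2 : 0 <= RInt g b' b by apply: RInt_ge_0.
have i3 : 0 < RInt g a' b'.
  apply: RInt_gt_0; first lra.
    move=> x hx.
    have : Rabs (g x - g y0) < g y0 / 2 by apply: (hd x); apply: Rabs_def1; rewrite /minus /plus /opp /=; lra.
    move/Rabs_def2; lra.
  by move=> x hx; exact: hc.
rewrite /plus /=; lra.
Qed.

Lemma is_derive_off_interval (g : R -> R) X c x :
  (forall t, X < Rabs t -> g t = c) -> X < Rabs x -> is_derive g x 0.
Proof.
move=> hg h; apply: (is_derive_ext_loc (fun _ => c)); last exact: is_derive_const.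
exists (mkposreal (Rabs x - X) ltac:(lra)) => t ht; symmetry; apply: hg.
have : Rabs (t - x) < Rabs x - X by exact: ht.
have := Rabs_triang (- (t - x)) t; rewrite Rabs_Ropp.
have -> : - (t - x) + t = x by ring.
lra.
Qed.

(** * Unique continuation from infinity for a nonlinearity that is Lipschitz at [c] *)

Section UniqueContinuation.
Variables (psi : R -> R -> R) (f : R -> R) (X c : R).
Hypotheses (X0 : 0 < X) (C3 : Ck 3 psi) (fc : forall r, continuous f r)
  (eqn : forall x y, lap psi x y + f (psi x y) = 0) (box : const_off_box X c psi).

Let F (h : R) : R := RInt f c h.

Lemma dx_off_box : const_off_box X 0 (dx psi).
Proof.
move=> x y [h|h]; apply: is_derive_unique.
  by apply: (is_derive_off_interval _ X c) => // t ht; apply: box; left.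
apply: (is_derive_ext (fun _ => c)); last exact: is_derive_const.
by move=> t; rewrite box //; right.
Qed.

Lemma dy_off_box : const_off_box X 0 (dy psi).
Proof.
move=> x y [h|h]; apply: is_derive_unique; last first.
  by apply: (is_derive_off_interval _ X c) => // t ht; apply: box; right.
apply: (is_derive_ext (fun _ => c)); last exact: is_derive_const.
by move=> t; rewrite box //; left.
Qed.

Let px := dx psi.
Let py := dy psi.
Let pxx := dx px.
Let pyy := dy py.
Let pxy := dy px.
Let a := - (X + 1).
Let b := X + 1.

Lemma psi_C2 : Ck 2 psi. Proof. exact: Ck_pred. Qed.
Lemma psi_x_C2 : Ck 2 px. Proof. exact: Ck_dx. Qed.
Lemma psi_y_C2 : Ck 2 py. Proof. exact: Ck_dy. Qed.

Let c0 : cont2 psi := Ck_cont2 3 _ C3.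
Let cx : cont2 px := Ck_cont2 2 _ psi_x_C2.
Let cy : cont2 py := Ck_cont2 2 _ psi_y_C2.
Let cxx : cont2 pxx := Ck_cont2 1 _ (Ck_dx 1 _ psi_x_C2).
Let cxy : cont2 pxy := Ck_cont2 1 _ (Ck_dy 1 _ psi_x_C2).
Let cyy : cont2 pyy := Ck_cont2 1 _ (Ck_dy 1 _ psi_y_C2).

Let d1 x y : is_derive (fun t => psi t y) x (px x y) := Ck_is_derive_x 2 psi x y C3.
Let d2 x y : is_derive (fun t => psi x t) y (py x y) := Ck_is_derive_y 2 psi x y C3.
Let d3 x y : is_derive (fun t => px t y) x (pxx x y) := Ck_is_derive_x 1 px x y psi_x_C2.
Let d4 x y : is_derive (fun t => px x t) y (pxy x y) := Ck_is_derive_y 1 px x y psi_x_C2.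
Let d5 x y : is_derive (fun t => py x t) y (pyy x y) := Ck_is_derive_y 1 py x y psi_y_C2.
Let d6 x y : is_derive (fun t => py t y) x (pxy x y).
Proof.
have -> : pxy x y = dx py x y by rewrite /py (C2_schwarz psi x y psi_C2).
exact: (Ck_is_derive_x 1 py x y psi_y_C2).
Qed.

Let dF h : is_derive F h (f h).
Proof.
apply: is_derive_RInt => //; exists (mkposreal 1 Rlt_0_1) => t _.
by apply: RInt_correct; apply: ex_RInt_continuous => *; exact: fc.
Qed.

Let cF r : continuous F r.
Proof. by apply: ex_derive_continuous; exists (f r). Qed.

Lemma cont2_pow2 u : cont2 u -> cont2 (fun x y => u x y ^ 2).
Proof.
move=> hu; apply: (cont2_ext (fun x y => u x y * u x y)); first by move=> *; ring.
exact: cont2_mult.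
Qed.

Let cw : cont2 (fun x y => psi x y - c).
Proof. exact: (cont2_plus _ _ c0 (cont2_const (- c))). Qed.

Let cE : cont2 (fun x y => px x y ^ 2 - py x y ^ 2 + 2 * F (psi x y)).
Proof.
apply: cont2_plus.
  apply: (cont2_ext (fun s y => px s y ^ 2 + (-1) * py s y ^ 2)); first by move=> *; ring.
  apply: cont2_plus; first exact: cont2_pow2.
  apply: cont2_mult; [exact: cont2_const | exact: cont2_pow2].
apply: cont2_mult; [exact: cont2_const | exact: cont2_comp].
Qed.

(* The Hamiltonian of the equation, read as an evolution in x, is conserved and vanishes at
   infinity. *)
Lemma hamiltonian_zero x : RInt (fun y => px x y ^ 2 - py x y ^ 2 + 2 * F (psi x y)) a b = 0 :> R.
Proof.
set g := fun s y => px s y ^ 2 - py s y ^ 2 + 2 * F (psi s y).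
(* By the equation, the [x]-derivative of the density is the [y]-derivative of [-2 psi_x psi_y],
   which vanishes at both ends of the slice. *)
set g' := fun s y => -2 * (pyy s y * px s y + py s y * pxy s y).
have cg' : cont2 g'.
  apply: cont2_mult; first exact: cont2_const.
  by apply: cont2_plus; apply: cont2_mult.
have dg s y : is_derive (fun t => g t y) s (g' s y).
  have := eqn s y; rewrite /lap -/px -/py -/pxx -/pyy => e.
  have -> : g' s y = (2 * px s y * pxx s y - 2 * py s y * pxy s y) + 2 * (px s y * f (psi s y)).
    have -> : f (psi s y) = - (pxx s y + pyy s y) by lra.
    rewrite /g'; ring.
  apply: is_derive_plus.
    apply: is_derive_minus.
      have -> : 2 * px s y * pxx s y = INR 2 * pxx s y * px s y ^ Nat.pred 2 by rewrite /=; ring.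
      exact: is_derive_pow.
    have -> : 2 * py s y * pxy s y = INR 2 * pxy s y * py s y ^ Nat.pred 2 by rewrite /=; ring.
    exact: is_derive_pow.
  apply: is_derive_scal; apply: (is_derive_comp F (fun t => psi t y)) => //.
have dI s : is_derive (fun t => RInt (g t) a b) s 0.
  have <- : (RInt (g' s) a b : R) = 0.
    rewrite (RInt_total_derivative (fun y => -2 * (py s y * px s y))).
    - have z y : X < Rabs y -> px s y = 0 by move=> h; apply: dx_off_box; right.
      rewrite !z; first ring.
        rewrite /a Rabs_left; lra.
      rewrite /b Rabs_pos_eq; lra.
    - move=> y; apply: is_derive_scal; apply: is_derive_mult => //; by move=> *; apply: Rmult_comm.
    - move=> y; exact: (cont2_slice_y g' cg').
  exact: (is_derive_RInt_slice g).
have [t [_ e]] := mvt (fun t => RInt (g t) a b) (fun _ => 0) x (X + 1) dI.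
have : (RInt (g (X + 1)) a b : R) = 0.
  have -> : (RInt (g (X + 1)) a b : R) = RInt (fun _ => 0) a b.
    apply: RInt_ext => y _; rewrite /g /px /py dx_off_box ?dy_off_box ?box.
    - rewrite /F RInt_point /zero /=; ring.
    - by left; rewrite Rabs_pos_eq; lra.
    - by left; rewrite Rabs_pos_eq; lra.
    - by left; rewrite Rabs_pos_eq; lra.
  by rewrite RInt_const /scal /= /mult /= Rmult_0_r.
rewrite -/(g x); lra.
Qed.

Let H (x : R) : R := RInt (fun y => (psi x y - c) ^ 2) a b.
Let H1 (x : R) : R := RInt (fun y => 2 * ((psi x y - c) * px x y)) a b.
Let H2 (x : R) : R := RInt (fun y => 2 * px x y ^ 2 + 2 * ((psi x y - c) * pxx x y)) a b.

Let dH x : is_derive H x (H1 x).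
Proof.
apply: (is_derive_RInt_slice (fun x y => (psi x y - c) ^ 2) (fun x y => 2 * ((psi x y - c) * px x y))).
- move=> s y.
  have -> : 2 * ((psi s y - c) * px s y) = INR 2 * px s y * (psi s y - c) ^ Nat.pred 2 by rewrite /=; ring.
  apply: is_derive_pow; have -> : px s y = px s y - 0 by ring.
  apply: is_derive_minus => //; exact: is_derive_const.
- exact: cont2_pow2.
- apply: cont2_mult; [exact: cont2_const | exact: cont2_mult].
Qed.

Let dH1 x : is_derive H1 x (H2 x).
Proof.
apply: (is_derive_RInt_slice (fun x y => 2 * ((psi x y - c) * px x y))
   (fun x y => 2 * px x y ^ 2 + 2 * ((psi x y - c) * pxx x y))).
- move=> s y.
  have -> : 2 * px s y ^ 2 + 2 * ((psi s y - c) * pxx s y) =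
     2 * (px s y * px s y + (psi s y - c) * pxx s y) by ring.
  apply: is_derive_scal; apply: is_derive_mult => //; last by move=> *; apply: Rmult_comm.
  have -> : px s y = px s y - 0 by ring.
  apply: is_derive_minus => //; exact: is_derive_const.
- apply: cont2_mult; [exact: cont2_const | exact: cont2_mult].
- apply: cont2_plus; apply: cont2_mult; try exact: cont2_const; [exact: cont2_pow2 | exact: cont2_mult].
Qed.

Let G x y := 4 * px x y ^ 2 + (4 * F (psi x y) - 2 * ((psi x y - c) * f (psi x y))).

Let cG : cont2 G.
Proof.
apply: cont2_plus; first by apply: cont2_mult; [exact: cont2_const | exact: cont2_pow2].
apply: (cont2_ext (fun x y => 4 * F (psi x y) + (-2) * ((psi x y - c) * f (psi x y)))).
  by move=> *; ring.
apply: cont2_plus; apply: cont2_mult; try exact: cont2_const.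
  exact: cont2_comp.
apply: cont2_mult => //; exact: cont2_comp.
Qed.

(** Write [w = psi - c]. The equation and an integration by parts replace the integral of [w psi_xx]
    by that of [psi_y^2 - w f]; the vanishing Hamiltonian then trades [psi_y^2] for [psi_x^2 + 2 F].
    This doubles the coefficient of [psi_x^2] to 4, exactly what the Cauchy-Schwarz inequality needs
    to reach [H'^2 / H]. *)
Lemma slice_energy_second x : H2 x = RInt (G x) a b :> R.
Proof.
have cI : cont2 (fun x y => 2 * px x y ^ 2 + 2 * ((psi x y - c) * pxx x y)).
  apply: cont2_plus; apply: cont2_mult; try exact: cont2_const; [exact: cont2_pow2 | exact: cont2_mult].
set B := fun y => -2 * (py x y * py x y + (psi x y - c) * pyy x y).
have cB y : continuous B y.
  apply: (cont2_slice_y (fun x y => -2 * (py x y * py x y + (psi x y - c) * pyy x y))).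
  apply: cont2_mult; first exact: cont2_const.
  by apply: cont2_plus; apply: cont2_mult.
have IB : (RInt B a b : R) = 0.
  rewrite (RInt_total_derivative (fun y => -2 * ((psi x y - c) * py x y))) //.
  - have z y : X < Rabs y -> py x y = 0 by move=> h; apply: dy_off_box; right.
    rewrite !z; first ring.
      rewrite /a Rabs_left; lra.
    rewrite /b Rabs_pos_eq; lra.
  - move=> y; apply: is_derive_scal; apply: is_derive_mult => //; last by move=> *; apply: Rmult_comm.
    have -> : py x y = py x y - 0 by ring.
    apply: is_derive_minus => //; exact: is_derive_const.
have e : RInt (G x) a b + RInt B a b = H2 x + 2 * RInt (fun y => px x y ^ 2 - py x y ^ 2 + 2 * F (psi x y)) a b.
  have exB : ex_RInt B a b by apply: ex_RInt_continuous => *; exact: cB.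
  rewrite -[LHS](RInt_plus (G x) B) //; last exact: cont2_ex_RInt.
  have -> : 2 * RInt (fun y => px x y ^ 2 - py x y ^ 2 + 2 * F (psi x y)) a b =
     RInt (fun y => scal 2 (px x y ^ 2 - py x y ^ 2 + 2 * F (psi x y))) a b.
    rewrite RInt_scal //. exact: (cont2_ex_RInt _ _ _ _ cE).
  rewrite -[RHS](RInt_plus (fun y => 2 * px x y ^ 2 + 2 * ((psi x y - c) * pxx x y))).
  - apply: RInt_ext => y _; rewrite /plus /scal /= /mult /= /G /B.
    have := eqn x y; rewrite /lap -/px -/py -/pxx -/pyy => e.
    have -> : f (psi x y) = - (pxx x y + pyy x y) by lra.
    ring.
  - exact: (cont2_ex_RInt _ _ _ _ cI).
  - apply: ex_RInt_scal; exact: (cont2_ex_RInt _ _ _ _ cE).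
rewrite IB hamiltonian_zero in e; lra.
Qed.

(** The factor 6 is 4 from [4 F], as [F] is at most [K (psi - c)^2] in absolute value, and 2 from
    the term [2 (psi - c) f]. *)
Lemma slice_energy_convex K eta x : 0 < K -> (forall h, Rabs (h - c) < eta -> Rabs (f h) <= K * Rabs (h - c)) ->
  (forall y, Rabs (psi x y - c) < eta) -> 0 < H x -> H1 x ^ 2 / H x - 6 * K * H x <= H2 x.
Proof.
move=> hK hf hsmall Hx.
have hab : a <= b by rewrite /a /b; lra.
have Fb h : Rabs (h - c) < eta -> Rabs (F h) <= K * (h - c) ^ 2.
  move=> hh.
  have bnd t : Rmin c h <= t <= Rmax c h -> Rabs (f t) <= K * Rabs (h - c).
    move=> ht.
    have ht' : Rabs (t - c) <= Rabs (h - c).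
      move: ht; rewrite /Rmin /Rmax /Rabs; destruct Rle_dec; do 2 destruct Rcase_abs; lra.
    apply: (Rle_trans _ (K * Rabs (t - c))); first by apply: hf; lra.
    by apply: Rmult_le_compat_l; lra.
  have [t [ht et]] := mvt F f c h dF.
  have -> : F h = f t * (h - c).
    have : F c = 0 by rewrite /F RInt_point.
    move=> F0; rewrite -et F0; ring.
  rewrite Rabs_mult.
  have -> : K * (h - c) ^ 2 = K * Rabs (h - c) * Rabs (h - c).
    rewrite -Rsqr_pow2 Rsqr_abs /Rsqr; ring.
  apply: Rmult_le_compat_r; [exact: Rabs_pos | exact: bnd].
(* The minimizer of [4 s^2 H + 4 s H1 + Px], where the value is [Px - H1^2 / H]. *)
set s := - H1 x / (2 * H x).
have cq : cont2 (fun x y => 4 * (s * (psi x y - c) + px x y) ^ 2).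
  apply: cont2_mult; first exact: cont2_const.
  apply: cont2_pow2; apply: cont2_plus => //; apply: cont2_mult => //; exact: cont2_const.
have cr : cont2 (fun x y => 6 * K * (psi x y - c) ^ 2).
  by apply: cont2_mult; [exact: cont2_const | exact: cont2_pow2].
set Px := RInt (fun y => 4 * px x y ^ 2) a b.
have cP : cont2 (fun x y => 4 * px x y ^ 2).
  by apply: cont2_mult; [exact: cont2_const | exact: cont2_pow2].
have exH : ex_RInt (fun y => (psi x y - c) ^ 2) a b.
  exact: (cont2_ex_RInt (fun x y => (psi x y - c) ^ 2) _ _ _ (cont2_pow2 _ cw)).
have exH1 : ex_RInt (fun y => 2 * ((psi x y - c) * px x y)) a b.
  apply: (cont2_ex_RInt (fun x y => 2 * ((psi x y - c) * px x y))).
  apply: cont2_mult; [exact: cont2_const | exact: cont2_mult].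
have exP : ex_RInt (fun y => 4 * px x y ^ 2) a b.
  exact: (cont2_ex_RInt (fun x y => 4 * px x y ^ 2) _ _ _ cP).
(* Cauchy-Schwarz, in the form of the nonnegativity of the integral of (s w + w_x)^2. *)
have CS : 0 <= 4 * s ^ 2 * H x + (4 * s * H1 x + Px).
  have -> : 4 * s ^ 2 * H x + (4 * s * H1 x + Px) =
    RInt (fun y => plus (scal (4 * s ^ 2) ((psi x y - c) ^ 2))
       (plus (scal (4 * s) (2 * ((psi x y - c) * px x y))) (4 * px x y ^ 2))) a b.
    rewrite RInt_plus; last first.
    - apply: ex_RInt_plus => //; exact: ex_RInt_scal.
    - exact: ex_RInt_scal.
    rewrite RInt_plus //; last exact: ex_RInt_scal.
    rewrite (RInt_scal (fun y => (psi x y - c) ^ 2)) //.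
    by rewrite (RInt_scal (fun y => 2 * ((psi x y - c) * px x y))).
  apply: RInt_ge_0 => //.
    apply: ex_RInt_plus; first exact: ex_RInt_scal.
    apply: ex_RInt_plus => //; exact: ex_RInt_scal.
  move=> y _; rewrite /plus /scal /= /mult /=.
  have := pow2_ge_0 (s * (psi x y - c) + px x y); lra.
have PH : H1 x ^ 2 / H x <= Px.
  have e : 4 * s ^ 2 * H x + 4 * s * H1 x = - (H1 x ^ 2 / H x) by rewrite /s; field; lra.
  lra.
suff : Px - 6 * K * H x <= H2 x by lra.
have exq : ex_RInt (fun y => (- (6 * K)) * (psi x y - c) ^ 2) a b by apply: ex_RInt_scal.
have -> : Px - 6 * K * H x = RInt (fun y => plus (4 * px x y ^ 2) (scal (- (6 * K)) ((psi x y - c) ^ 2))) a b :> R.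
  by rewrite RInt_plus // (RInt_scal (fun y => (psi x y - c) ^ 2)) // /plus /scal /= /mult /= -/Px -/(H x); ring.
rewrite slice_energy_second; apply: RInt_le => //.
- exact: ex_RInt_plus.
- exact: cont2_ex_RInt.
move=> y _; rewrite /plus /scal /= /mult /= /G.
have := Fb _ (hsmall y); have := hf _ (hsmall y) => /Rabs_le_elim h1 /Rabs_le_elim h2.
have : Rabs ((psi x y - c) * f (psi x y)) <= K * (psi x y - c) ^ 2.
  rewrite Rabs_mult.
  have -> : K * (psi x y - c) ^ 2 = Rabs (psi x y - c) * (K * Rabs (psi x y - c)).
    rewrite -Rsqr_pow2 Rsqr_abs /Rsqr; ring.
  apply: Rmult_le_compat_l; [exact: Rabs_pos | exact: hf].
move/Rabs_le_elim; lra.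
Qed.

(** Let [l] be the supremum of the abscissas of nonconstant slices. By uniform continuity [psi] is
    within [eta] of [c] on a strip around the line [x = l]. In this strip [H] is positive somewhere
    to the left of or on this line, and this positivity propagates to the right of [l], where [H] is
    0. *)
Lemma unique_continuation K eta :
  0 < K -> 0 < eta -> (forall h, Rabs (h - c) < eta -> Rabs (f h) <= K * Rabs (h - c)) ->
  forall x y, psi x y = c.
Proof.
move=> hK he hf x y; apply: NNPP => hne.
pose S s := exists t, psi s t <> c.
have SX s : S s -> s <= X.
  move=> [t ht]; apply: Rnot_lt_le => h; apply: ht; apply: box; left.
  rewrite Rabs_pos_eq; lra.
have [l [ub lub]] := completeness S (ex_intro _ X SX) (ex_intro _ x (ex_intro _ y hne)).
have [d [d0 hd]] := box_uniform psi X c c0 box eta he.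
have off s : l < s -> forall t, psi s t = c.
  move=> h t; apply: NNPP => h'; have : s <= l by apply: ub; exists t.
  lra.
have [x0 [hx0 [y0 h0]]] : exists x0, l - d / 2 < x0 /\ S x0.
  apply: NNPP => hn; have : l <= l - d / 2; last lra.
  apply: lub => s hs; apply: Rnot_lt_le => h; apply: hn; by exists s.
have xl : x0 <= l by apply: ub; exists y0.
have y0b : a < y0 < b.
  have : Rabs y0 <= X by apply: Rnot_lt_le => h; apply: h0; apply: box; right.
  move/Rabs_le_elim; rewrite /a /b; lra.
have Hpos s : 0 <= H s.
  apply: RInt_ge_0; first by rewrite /a /b; lra.
    exact: (cont2_ex_RInt (fun x y => (psi x y - c) ^ 2) _ _ _ (cont2_pow2 _ cw)).
  by move=> *; exact: pow2_ge_0.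
have : 0 < H (l + d / 4).
  apply: (log_convex_positive H H1 H2 (6 * K) x0) => //; try lra.
  - apply: (RInt_sq_pos _ a b y0) => //.
    + exact: (cont2_slice_y _ (cont2_pow2 _ cw)).
    + by move=> *; exact: pow2_ge_0.
    + by apply: pow2_gt_0; lra.
  - move=> s hs; apply: (slice_energy_convex K eta) => // t.
    rewrite -(off (l + d / 4) ltac:(lra) t); apply: hd; last by rewrite Rminus_diag Rabs_R0.
    apply: Rabs_def1; lra.
have -> : H (l + d / 4) = RInt (fun _ => 0) a b :> R.
  apply: RInt_ext => t _; rewrite off; last lra. by rewrite Rminus_diag /= Rmult_0_l.
rewrite RInt_const /scal /= /mult /=; lra.
Qed.

Lemma regular_value_off_infinity x y : f c = 0 -> (exists x y, psi x y <> c) ->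
  psi x y = c -> dx psi x y = 0 /\ dy psi x y = 0.
Proof.
move=> fc0 [x1 [y1 hne]] hc; apply: NNPP => hn; apply: hne.
have [K [eta [hK [heta hf]]]] : exists K eta, 0 < K /\ 0 < eta /\ forall h, Rabs (h - c) < eta ->
    Rabs (f h) <= K * Rabs (h - c).
  have cont t g dg : is_derive g t dg -> continuity_pt g t.
    by move=> h; apply: derivable_continuous_pt; exists dg; apply/is_derive_Reals.
  have fe s t : f (psi s t) = - (pxx s t + pyy s t).
    by have := eqn s t; rewrite /lap -/px -/py -/pxx -/pyy; lra.
  have Cxx : Ck 1 pxx := Ck_dx 1 _ psi_x_C2. have Cyy : Ck 1 pyy := Ck_dy 1 _ psi_y_C2.
  have [h|h] : dx psi x y <> 0 \/ dy psi x y <> 0 by tauto.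
  - have [K [eta [hK [heta hf]]]] := lipschitz_at_regular_value f (fun t => psi t y)
      (fun t => - (pxx t y + pyy t y)) x _ _ (fun t => cont _ _ _ (d1 t y)) (d1 x y) h
      (is_derive_opp _ _ _ (is_derive_plus _ _ _ _ _ (Ck_is_derive_x 0 pxx x y Cxx) (Ck_is_derive_x 0 pyy x y Cyy)))
      (fun t => esym (fe t y)).
    exists K, eta; split=> //; split=> // r hr; have := hf r; rewrite hc fc0 Rminus_0_r; exact.
  - have [K [eta [hK [heta hf]]]] := lipschitz_at_regular_value f (fun t => psi x t)
      (fun t => - (pxx x t + pyy x t)) y _ _ (fun t => cont _ _ _ (d2 x t)) (d2 x y) h
      (is_derive_opp _ _ _ (is_derive_plus _ _ _ _ _ (Ck_is_derive_y 0 pxx x y Cxx) (Ck_is_derive_y 0 pyy x y Cyy)))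
      (fun t => esym (fe x t)).
    exists K, eta; split=> //; split=> // r hr; have := hf r; rewrite hc fc0 Rminus_0_r; exact.
exact: (unique_continuation K eta).
Qed.

End UniqueContinuation.

(** * Truncation at the value at infinity *)

Lemma mvt_open (f df : R -> R) a b : a < b -> (forall x, is_derive f x (df x)) ->
  exists c, a < c < b /\ f b - f a = df c * (b - a).
Proof.
move=> hab h; have [c [h1 h2]] := MVT_cor2 f df a b hab (fun x _ => proj1 (is_derive_Reals f x (df x)) (h x)).
by exists c.
Qed.

Lemma is_derive_extR (f g : R -> R) x l :
  (forall t : R, f t = g t :> R) -> is_derive f x l -> is_derive g x l.
Proof. exact: is_derive_ext. Qed.

Lemma C1_line u x y v w t : Ck 1 u ->
  is_derive (fun t => u (x + t * v) (y + t * w)) t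
    (dx u (x + t * v) (y + t * w) * v + dy u (x + t * v) (y + t * w) * w).
Proof.
move=> hu; apply: (C1_comp u (fun t => x + t * v) (fun t => y + t * w)) => //.
  by auto_derive => //; ring.
by auto_derive => //; ring.
Qed.

Section Truncation.
Variables (psi : R -> R -> R) (f : R -> R) (X c : R).
Hypotheses (X0 : 0 < X) (C3 : Ck 3 psi) (fc : forall r, continuous f r)
  (eqn : forall x y, lap psi x y + f (psi x y) = 0) (box : const_off_box X c psi)
  (fc0 : f c = 0) (crit : forall x y, psi x y = c -> dx psi x y = 0 /\ dy psi x y = 0).

Let px := dx psi.
Let py := dy psi.
Let pxx := dx px.
Let pyy := dy py.
Let pxy := dy px.

Let C2' : Ck 2 psi := Ck_pred 2 _ C3.
Let C1' : Ck 1 psi := Ck_pred 1 _ C2'.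
Let Cx' : Ck 1 px := Ck_pred 1 _ (Ck_dx 2 _ C3).
Let Cy' : Ck 1 py := Ck_pred 1 _ (Ck_dy 2 _ C3).

Let dxpy x y : dx py x y = pxy x y := C2_schwarz psi x y C2'.

Definition hess_form (x y v w : R) : R := pxx x y * v ^ 2 + 2 * pxy x y * (v * w) + pyy x y * w ^ 2.

Lemma psi_line x y v w t :
  is_derive (fun t => psi (x + t * v) (y + t * w)) t
    (px (x + t * v) (y + t * w) * v + py (x + t * v) (y + t * w) * w).
Proof. exact: C1_line. Qed.

Lemma psi_line2 x y v w t :
  is_derive (fun t => px (x + t * v) (y + t * w) * v + py (x + t * v) (y + t * w) * w) t
    (hess_form (x + t * v) (y + t * w) v w).
Proof.
have h1 := C1_line px x y v w t Cx'.
have h2 := C1_line py x y v w t Cy'.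
rewrite -/pxx -/pxy in h1; rewrite -/pyy dxpy in h2.
have -> : hess_form (x + t * v) (y + t * w) v w =
  v * (pxx (x + t * v) (y + t * w) * v + pxy (x + t * v) (y + t * w) * w) +
  w * (pxy (x + t * v) (y + t * w) * v + pyy (x + t * v) (y + t * w) * w).
  rewrite /hess_form; ring.
apply: (is_derive_extR (fun t => v * px (x + t * v) (y + t * w) + w * py (x + t * v) (y + t * w))).
  by move=> s; ring.
by apply: is_derive_plus; apply: is_derive_scal.
Qed.

(** Near the point, [psi] exceeds [c] in the direction [e] and is below [c] in the direction [g], so
    it equals [c] somewhere on the segment between them. There the gradient vanishes by [crit],
    although it is close to [t] times the Hessian applied to [v]; as the Hessian is traceless, it
    stretches all vectors by the same factor, and [v] is bounded away from 0 by the hypothesis on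
    the segment. *)
Lemma hess_indefinite_absurd x y z e1 e2 g1 g2 : psi x y = c -> 0 < z ->
  Rabs e1 <= 1 -> Rabs e2 <= 1 -> Rabs g1 <= 1 -> Rabs g2 <= 1 ->
  8 * z <= hess_form x y e1 e2 -> hess_form x y g1 g2 <= - 8 * z ->
  (forall l, 0 <= l <= 1 -> / 4 <= (e1 + l * (g1 - e1)) ^ 2 + (e2 + l * (g2 - e2)) ^ 2) ->
  64 * z ^ 2 <= pxx x y ^ 2 + pxy x y ^ 2 -> False.
Proof.
move=> hc hz he1 he2 hg1 hg2 hE hG hseg hm.
have [p0 q0] := crit x y hc; rewrite -/px in p0; rewrite -/py in q0.
have tr : pxx x y + pyy x y = 0 by have := eqn x y; rewrite /lap hc fc0 -/px -/py -/pxx -/pyy; lra.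
have [d1 [d10 h1]] := C1_strict_diff px x y Cx' z hz.
have [d2 [d20 h2]] := C1_strict_diff py x y Cy' z hz.
rewrite -/pxx -/pxy in h1; rewrite -/pyy dxpy in h2.
have [t [t0 [t1 [t2 _]]]] := common_min [:: d1 / 2; d2 / 2] ltac:(repeat split; lra).
have grad s v w : 0 <= s <= t -> Rabs v <= 1 -> Rabs w <= 1 ->
   Rabs (px (x + s * v) (y + s * w) - s * (pxx x y * v + pxy x y * w)) <= 2 * z * s /\
   Rabs (py (x + s * v) (y + s * w) - s * (pxy x y * v + pyy x y * w)) <= 2 * z * s.
  move=> hs hv hw.
  have ev : Rabs (x + s * v - x) <= s.
    have -> : x + s * v - x = s * v by ring. rewrite Rabs_scal_l; nra.
  have ew : Rabs (y + s * w - y) <= s.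
    have -> : y + s * w - y = s * w by ring. rewrite Rabs_scal_l; nra.
  have := h1 (x + s * v) (y + s * w) x y; have := h2 (x + s * v) (y + s * w) x y.
  rewrite !Rminus_diag !Rabs_R0 -/px -/py => k2 k1.
  have {}k1 := k1 ltac:(lra) ltac:(lra) d10 d10.
  have {}k2 := k2 ltac:(lra) ltac:(lra) d20 d20.
  rewrite p0 in k1; rewrite q0 in k2.
  have zz : z * (Rabs (x + s * v - x) + Rabs (y + s * w - y)) <= 2 * z * s by nra.
  split; (apply: Rle_trans zz).
    have -> : px (x + s * v) (y + s * w) - s * (pxx x y * v + pxy x y * w) =
      px (x + s * v) (y + s * w) - 0 - pxx x y * (x + s * v - x) - pxy x y * (y + s * w - y) by ring.
    exact: k1.
  have -> : py (x + s * v) (y + s * w) - s * (pxy x y * v + pyy x y * w) =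
      py (x + s * v) (y + s * w) - 0 - pxy x y * (x + s * v - x) - pyy x y * (y + s * w - y) by ring.
  exact: k2.
have slope s v w : 0 < s <= t -> Rabs v <= 1 -> Rabs w <= 1 ->
   Rabs (px (x + s * v) (y + s * w) * v + py (x + s * v) (y + s * w) * w - s * hess_form x y v w) <= 4 * z * s.
  move=> hs hv hw; have [k1 k2] := grad s v w ltac:(lra) hv hw.
  have -> : px (x + s * v) (y + s * w) * v + py (x + s * v) (y + s * w) * w - s * hess_form x y v w =
    (px (x + s * v) (y + s * w) - s * (pxx x y * v + pxy x y * w)) * v +
    (py (x + s * v) (y + s * w) - s * (pxy x y * v + pyy x y * w)) * w by rewrite /hess_form; ring.
  apply: (Rle_trans _ _ _ (Rabs_triang _ _)); rewrite !Rabs_mult.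
  have le1 a b m : 0 <= a <= m -> 0 <= b <= 1 -> a * b <= m by move=> ha hb; nra.
  have m1 := le1 _ _ _ (conj (Rabs_pos _) k1) (conj (Rabs_pos v) hv).
  have m2 := le1 _ _ _ (conj (Rabs_pos _) k2) (conj (Rabs_pos w) hw).
  lra.
have pos : c < psi (x + t * e1) (y + t * e2).
  have [s [hs es]] := mvt_open _ _ 0 t t0 (psi_line x y e1 e2).
  rewrite !Rmult_0_l !Rplus_0_r hc in es.
  have := slope s e1 e2 ltac:(lra) he1 he2; move/Rabs_le_elim.
  set D := px _ _ * e1 + _ in es *; move=> hD.
  have sz : 0 < s * z by apply: Rmult_lt_0_compat; lra.
  have sh : s * (8 * z) <= s * hess_form x y e1 e2 by apply: Rmult_le_compat_l; lra.
  have D0 : 0 < D by lra.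
  have := Rmult_lt_0_compat _ _ D0 t0; lra.
have neg : psi (x + t * g1) (y + t * g2) < c.
  have [s [hs es]] := mvt_open _ _ 0 t t0 (psi_line x y g1 g2).
  rewrite !Rmult_0_l !Rplus_0_r hc in es.
  have := slope s g1 g2 ltac:(lra) hg1 hg2; move/Rabs_le_elim.
  set D := px _ _ * g1 + _ in es *; move=> hD.
  have sz : 0 < s * z by apply: Rmult_lt_0_compat; lra.
  have sh : s * hess_form x y g1 g2 <= s * (- 8 * z) by apply: Rmult_le_compat_l; lra.
  have D0 : 0 < - D by lra.
  have := Rmult_lt_0_compat _ _ D0 t0; lra.
have [l [hl el]] : {l | Rmin 0 1 <= l <= Rmax 0 1 /\
    psi (x + t * e1 + l * (t * (g1 - e1))) (y + t * e2 + l * (t * (g2 - e2))) = c}.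
  apply: (IVT_gen (fun l => psi (x + t * e1 + l * (t * (g1 - e1))) (y + t * e2 + l * (t * (g2 - e2))))).
    move=> l; apply: derivable_continuous_pt; eexists; apply/is_derive_Reals; exact: psi_line.
  rewrite !Rmult_0_l !Rplus_0_r !Rmult_1_l.
  have -> : x + t * e1 + t * (g1 - e1) = x + t * g1 by ring.
  have -> : y + t * e2 + t * (g2 - e2) = y + t * g2 by ring.
  rewrite Rmin_right ?Rmax_left; lra.
rewrite Rmin_left ?Rmax_right in hl; try lra.
set v := e1 + l * (g1 - e1); set w := e2 + l * (g2 - e2).
have ev : x + t * e1 + l * (t * (g1 - e1)) = x + t * v by rewrite /v; ring.
have ew : y + t * e2 + l * (t * (g2 - e2)) = y + t * w by rewrite /w; ring.
rewrite ev ew in el.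
have conv p q : Rabs p <= 1 -> Rabs q <= 1 -> Rabs (p + l * (q - p)) <= 1.
  move=> /Rabs_le_elim h /Rabs_le_elim h'; apply: Rabs_le_intro; nra.
have [p1 q1] := crit _ _ el.
have [k1 k2] := grad t v w ltac:(lra) (conv _ _ he1 hg1) (conv _ _ he2 hg2).
rewrite -/px in p1; rewrite -/py in q1; rewrite p1 in k1; rewrite q1 in k2.
have r1 : Rabs (pxx x y * v + pxy x y * w) <= 2 * z.
  apply: (Rmult_le_reg_l t) => //; rewrite -Rabs_scal_l; last lra.
  rewrite -Rabs_Ropp; have -> : - (t * (pxx x y * v + pxy x y * w)) = 0 - t * (pxx x y * v + pxy x y * w) by ring.
  lra.
have r2 : Rabs (pxy x y * v + pyy x y * w) <= 2 * z.
  apply: (Rmult_le_reg_l t) => //; rewrite -Rabs_scal_l; last lra.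
  rewrite -Rabs_Ropp; have -> : - (t * (pxy x y * v + pyy x y * w)) = 0 - t * (pxy x y * v + pyy x y * w) by ring.
  lra.
have sq a : Rabs a <= 2 * z -> a ^ 2 <= 4 * z ^ 2.
  move/Rabs_le_elim => h; nra.
have := sq _ r1; have := sq _ r2.
have -> : pyy x y = - pxx x y by lra.
have := hseg l hl; rewrite -/v -/w => h4 s2 s1.
have e : (pxx x y * v + pxy x y * w) ^ 2 + (pxy x y * v + - pxx x y * w) ^ 2 =
  (pxx x y ^ 2 + pxy x y ^ 2) * (v ^ 2 + w ^ 2) by ring.
have : 64 * z ^ 2 * / 4 <= (pxx x y ^ 2 + pxy x y ^ 2) * (v ^ 2 + w ^ 2).
  by apply: Rmult_le_compat => //; have := pow_lt z 2 hz; lra.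
have := pow_lt z 2 hz; lra.
Qed.

(** The trace vanishes because [f c = 0]. A nonzero diagonal entry makes the coordinate directions a
    pair of opposite signs; if the diagonal vanishes, a nonzero mixed derivative does so for the
    directions [(1, 1)] and [(1, -1)]. *)
Lemma hess_zero x y : psi x y = c -> pxx x y = 0 /\ pxy x y = 0 /\ pyy x y = 0.
Proof.
move=> hc.
have tr : pxx x y + pyy x y = 0 by have := eqn x y; rewrite /lap hc fc0 -/px -/py -/pxx -/pyy; lra.
have R1 : Rabs 1 <= 1 by rewrite Rabs_R1; lra.
have R0 : Rabs 0 <= 1 by rewrite Rabs_R0; lra.
have Rm : Rabs (-1) <= 1 by rewrite Rabs_Ropp.
have xx : pxx x y = 0.
  apply: NNPP => h; have : pxx x y < 0 \/ 0 < pxx x y by lra.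
  case=> h'.
    apply: (hess_indefinite_absurd x y (- pxx x y / 8) 0 1 1 0) => //; rewrite /hess_form; try nra.
    by move=> l hl; nra.
  apply: (hess_indefinite_absurd x y (pxx x y / 8) 1 0 0 1) => //; rewrite /hess_form; try nra.
  by move=> l hl; nra.
have xy : pxy x y = 0.
  apply: NNPP => h; have : pxy x y < 0 \/ 0 < pxy x y by lra.
  have yy : pyy x y = 0 by lra.
  case=> h'.
    apply: (hess_indefinite_absurd x y (- pxy x y / 8) 1 (-1) 1 1) => //; rewrite /hess_form ?xx ?yy; try nra.
    by move=> l hl; nra.
  apply: (hess_indefinite_absurd x y (pxy x y / 8) 1 1 1 (-1)) => //; rewrite /hess_form ?xx ?yy; try nra.
  by move=> l hl; nra.
lra.
Qed.

End Truncation.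

(** * Second order expansion of the truncated function, and its stencil in a rotated frame *)

Section SecondDifference.
Variables (psi : R -> R -> R) (f : R -> R) (X c : R).
Hypotheses (X0 : 0 < X) (C3 : Ck 3 psi) (fc : forall r, continuous f r)
  (eqn : forall x y, lap psi x y + f (psi x y) = 0) (box : const_off_box X c psi)
  (fc0 : f c = 0) (crit : forall x y, psi x y = c -> dx psi x y = 0 /\ dy psi x y = 0).

Local Notation hess := (hess_form psi).

Lemma hess_uniform w : 0 < w -> exists d, 0 < d /\ forall x y x' y' v1 v2,
  Rabs (x' - x) < d -> Rabs (y' - y) < d ->
  Rabs (hess x' y' v1 v2 - hess x y v1 v2) <= w * (v1 ^ 2 + v2 ^ 2).
Proof.
move=> hw.
have bx := dx_off_box psi X c box; have by_ := dy_off_box psi X c box.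
have cxx : cont2 (dx (dx psi)) := Ck_cont2 1 _ (Ck_dx 1 _ (Ck_dx 2 _ C3)).
have cxy : cont2 (dy (dx psi)) := Ck_cont2 1 _ (Ck_dy 1 _ (Ck_dx 2 _ C3)).
have cyy : cont2 (dy (dy psi)) := Ck_cont2 1 _ (Ck_dy 1 _ (Ck_dy 2 _ C3)).
have [d1 [h1 u1]] := box_uniform _ X 0 cxx (dx_off_box _ _ _ bx) (w / 2) ltac:(lra).
have [d2 [h2 u2]] := box_uniform _ X 0 cxy (dy_off_box _ _ _ bx) (w / 2) ltac:(lra).
have [d3 [h3 u3]] := box_uniform _ X 0 cyy (dy_off_box _ _ _ by_) (w / 2) ltac:(lra).
have [d [hd [l1 [l2 [l3 _]]]]] := common_min [:: d1; d2; d3] ltac:(repeat split; lra).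
exists d; split=> // x y x' y' v1 v2 hx hy.
have := u1 x y x' y' ltac:(lra) ltac:(lra); have := u2 x y x' y' ltac:(lra) ltac:(lra).
have := u3 x y x' y' ltac:(lra) ltac:(lra).
rewrite /hess_form.
set A := dy (dy psi) x' y' - _; set B := dy (dx psi) x' y' - _; set C := dx (dx psi) x' y' - _.
move=> /Rabs_def2 hA /Rabs_def2 hB /Rabs_def2 hC.
match goal with |- Rabs ?t <= _ => have -> : t = C * v1 ^ 2 + 2 * B * (v1 * v2) + A * v2 ^ 2 by rewrite /A /B /C; ring end.
have s1 := pow2_ge_0 v1; have s2 := pow2_ge_0 v2.
have s3 := pow2_ge_0 (v1 + v2); have s4 := pow2_ge_0 (v1 - v2).
have t1 : 2 * (v1 * v2) <= v1 ^ 2 + v2 ^ 2 by lra.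
have t2 : - (v1 ^ 2 + v2 ^ 2) <= 2 * (v1 * v2) by lra.
set P := v1 ^ 2 in s1 t1 t2 *; set Q := v2 ^ 2 in s2 t1 t2 *; set T := v1 * v2 in t1 t2 *.
have a1 : Rabs (C * P) <= w / 2 * P.
  by rewrite Rabs_scal_r //; apply: Rmult_le_compat_r => //; apply: Rabs_le_intro; lra.
have a2 : Rabs (A * Q) <= w / 2 * Q.
  by rewrite Rabs_scal_r //; apply: Rmult_le_compat_r => //; apply: Rabs_le_intro; lra.
have a3 : Rabs (2 * B * T) <= w / 2 * (P + Q).
  have -> : 2 * B * T = B * (2 * T) by ring.
  rewrite Rabs_mult; apply: Rmult_le_compat; try exact: Rabs_pos; apply: Rabs_le_intro; lra.
move/Rabs_le_elim: a1 => a1; move/Rabs_le_elim: a2 => a2; move/Rabs_le_elim: a3 => a3.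
apply: Rabs_le_intro; lra.
Qed.

(** The mean value theorem for the even function [chi], and then for [ph1] between [- s] and [s],
    leaves only an oscillation of the Hessian, which is uniformly small. *)
Lemma taylor_second w : 0 < w -> exists d, 0 < d /\ forall x y v1 v2,
  Rabs v1 < d -> Rabs v2 < d ->
  Rabs (psi (x + v1) (y + v2) + psi (x - v1) (y - v2) - 2 * psi x y - hess x y v1 v2)
    <= w * (v1 ^ 2 + v2 ^ 2).
Proof.
move=> hw; have [d [d0 hd]] := hess_uniform (w / 2) ltac:(lra).
exists d; split=> // x y v1 v2 hv1 hv2.
set ph := fun t => psi (x + t * v1) (y + t * v2).
set ph1 := fun t => dx psi (x + t * v1) (y + t * v2) * v1 + dy psi (x + t * v1) (y + t * v2) * v2.
have dph t : is_derive ph t (ph1 t) := psi_line psi C3 x y v1 v2 t.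
have dph1 t : is_derive ph1 t (hess (x + t * v1) (y + t * v2) v1 v2) := psi_line2 psi C3 x y v1 v2 t.
have opp (g : R -> R) dg t : is_derive g (- t) dg -> is_derive (fun t => g (- t)) t (- dg).
  move=> h; have -> : - dg = -1 * dg by ring.
  apply: (is_derive_comp g Ropp) => //; by auto_derive => //; ring.
set H := hess x y v1 v2.
set chi := fun t => ph t + ph (- t) - t ^ 2 * H.
have dchi t : is_derive chi t (ph1 t - ph1 (- t) - 2 * t * H).
  apply: is_derive_minus.
    by apply: is_derive_plus => //; apply: opp.
  by auto_derive => //; ring.
have [s [hs es]] := mvt_open chi _ 0 1 Rlt_0_1 dchi.
have [r [hr er]] := mvt_open ph1 _ (- s) s ltac:(lra) dph1.
have -> : psi (x + v1) (y + v2) + psi (x - v1) (y - v2) - 2 * psi x y - H = chi 1 - chi 0.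
  rewrite /chi /ph !Rmult_0_l !Ropp_0 !Rmult_0_l !Rplus_0_r.
  have -> : x + 1 * v1 = x + v1 by ring.
  have -> : y + 1 * v2 = y + v2 by ring.
  have -> : x + - (1) * v1 = x - v1 by ring.
  have -> : y + - (1) * v2 = y - v2 by ring.
  ring.
rewrite es er.
have -> : (hess (x + r * v1) (y + r * v2) v1 v2 * (s - - s) - 2 * s * H) * (1 - 0) =
  (2 * s) * (hess (x + r * v1) (y + r * v2) v1 v2 - H) by ring.
rewrite Rabs_scal_l; last lra.
have small v : Rabs v < d -> Rabs (r * v) < d.
  move=> hv; rewrite Rabs_mult; have : Rabs r <= 1 by apply: Rabs_le_intro; lra.
  have := Rabs_pos v; have := Rabs_pos r; nra.
have := hd x y (x + r * v1) (y + r * v2) v1 v2.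
have -> : x + r * v1 - x = r * v1 by ring.
have -> : y + r * v2 - y = r * v2 by ring.
move=> /(_ (small _ hv1) (small _ hv2)); rewrite -/H.
have := Rabs_pos (hess (x + r * v1) (y + r * v2) v1 v2 - H).
nra.
Qed.

Definition upper (x y : R) : R := Rmax (psi x y - c) 0.

Definition above (x y : R) : R := if Rlt_dec c (psi x y) then 1 else 0.

(* Near the level c the function psi - c vanishes together with its first and second derivatives,
   so that the truncation does not spoil the second order expansion. *)
Lemma upper_second w : 0 < w -> exists d, 0 < d /\ forall x y v1 v2,
  Rabs v1 < d -> Rabs v2 < d ->
  Rabs (upper (x + v1) (y + v2) + upper (x - v1) (y - v2) - 2 * upper x y
        - above x y * hess x y v1 v2) <= w * (v1 ^ 2 + v2 ^ 2).
Proof.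
move=> hw.
have [d1 [d10 h1]] := taylor_second w hw.
(* If the segment meets the level [c], each value of [upper] on it is at most 4 units and the
   Hessian term at most 1, so that 17 = 4 + 4 + 8 + 1 units suffice. *)
have [d2 [d20 h2]] := hess_uniform (w / 17) ltac:(lra).
have [d [d0 [l1 [l2 _]]]] := common_min [:: d1; d2 / 2] ltac:(repeat split; lra).
exists d; split=> // x y v1 v2 hv1 hv2.
set S2 := v1 ^ 2 + v2 ^ 2.
have S20 : 0 <= S2 by rewrite /S2; have := pow2_ge_0 v1; have := pow2_ge_0 v2; lra.
set ph := fun t => psi (x + t * v1) (y + t * v2).
set ph1 := fun t => dx psi (x + t * v1) (y + t * v2) * v1 + dy psi (x + t * v1) (y + t * v2) * v2.
have dph t : is_derive ph t (ph1 t) := psi_line psi C3 x y v1 v2 t.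
have dph1 t : is_derive ph1 t (hess (x + t * v1) (y + t * v2) v1 v2) := psi_line2 psi C3 x y v1 v2 t.
have e1 : psi (x + v1) (y + v2) = ph 1 by rewrite /ph !Rmult_1_l.
have em : psi (x - v1) (y - v2) = ph (-1) by rewrite /ph; congr psi; ring.
have e0 : psi x y = ph 0 by rewrite /ph !Rmult_0_l !Rplus_0_r.
have cph t : continuity_pt ph t.
  by apply: derivable_continuous_pt; exists (ph1 t); apply/is_derive_Reals.
have [[t1 [ht1 et1]]|no] := classic (exists t, -1 <= t <= 1 /\ ph t = c).
  have [z1 z2] := crit _ _ et1.
  have [y1 [y2 y3]] := hess_zero psi f c C3 eqn fc0 crit _ _ et1.
  have hb t : -1 <= t <= 1 -> Rabs (hess (x + t * v1) (y + t * v2) v1 v2) <= w / 17 * S2.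
    move=> ht.
    have close v : Rabs v < d -> Rabs ((t - t1) * v) < d2.
      move=> hv; rewrite Rabs_mult; have : Rabs (t - t1) <= 2 by apply: Rabs_le_intro; lra.
      have := Rabs_pos v; have := Rabs_pos (t - t1); nra.
    have := h2 (x + t1 * v1) (y + t1 * v2) (x + t * v1) (y + t * v2) v1 v2.
    have -> : x + t * v1 - (x + t1 * v1) = (t - t1) * v1 by ring.
    have -> : y + t * v2 - (y + t1 * v2) = (t - t1) * v2 by ring.
    move=> /(_ (close _ hv1) (close _ hv2)).
    have -> : hess (x + t1 * v1) (y + t1 * v2) v1 v2 = 0 by rewrite /hess_form y1 y2 y3; ring.
    by rewrite Rminus_0_r.
  have wS : 0 <= w / 17 * S2 by apply: Rmult_le_pos; lra.
  have btw t s : -1 <= t <= 1 -> Rmin t1 t <= s <= Rmax t1 t -> -1 <= s <= 1.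
    by rewrite /Rmin /Rmax; destruct Rle_dec; lra.
  have lip t : -1 <= t <= 1 -> Rabs (t - t1) <= 2 by move=> ht; apply: Rabs_le_intro; lra.
  have gb t : -1 <= t <= 1 -> Rabs (ph1 t) <= 2 * (w / 17 * S2).
    move=> ht; have [s [hs es]] := mvt ph1 _ t1 t dph1.
    have -> : ph1 t = hess (x + s * v1) (y + s * v2) v1 v2 * (t - t1).
      by rewrite -es /ph1 z1 z2; ring.
    rewrite Rabs_mult Rmult_comm; apply: Rmult_le_compat; try exact: Rabs_pos.
      exact: lip.
    apply: hb; exact: btw hs.
  have pb t : -1 <= t <= 1 -> Rabs (ph t - c) <= 4 * (w / 17 * S2).
    move=> ht; have [s [hs es]] := mvt ph _ t1 t dph.
    have -> : ph t - c = ph1 s * (t - t1) by rewrite -es et1.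
    have -> : 4 * (w / 17 * S2) = 2 * (2 * (w / 17 * S2)) by ring.
    rewrite Rabs_mult Rmult_comm; apply: Rmult_le_compat; try exact: Rabs_pos.
      exact: lip.
    apply: gb; exact: btw hs.
  have ub t : -1 <= t <= 1 -> 0 <= Rmax (ph t - c) 0 <= 4 * (w / 17 * S2).
    move=> /pb /Rabs_le_elim; rewrite /Rmax; destruct Rle_dec; lra.
  have := ub 1 ltac:(lra); have := ub (-1) ltac:(lra); have := ub 0 ltac:(lra).
  rewrite /upper e1 em e0.
  have : Rabs (above x y * hess x y v1 v2) <= w / 17 * S2.
    have := hb 0 ltac:(lra); rewrite !Rmult_0_l !Rplus_0_r /above.
    by destruct Rlt_dec; rewrite ?Rmult_1_l ?Rmult_0_l ?Rabs_R0.
  move/Rabs_le_elim => ? ? ? ?; apply: Rabs_le_intro; lra.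
(* A segment that misses the level [c] stays on one side of it, where [upper] is either [psi - c] or
   0 throughout. *)
have same t : -1 <= t <= 1 -> (c < ph 0 -> c < ph t) /\ (ph 0 <= c -> ph t < c).
  move=> ht.
  have ivt : ~ Rmin (ph 0) (ph t) <= c <= Rmax (ph 0) (ph t).
    move=> hc; have [s [hs es]] := IVT_gen ph 0 t c (fun t => cph t) hc.
    apply: no; exists s; split=> //; move: hs; rewrite /Rmin /Rmax; destruct Rle_dec; lra.
  split=> h0; apply: Rnot_le_lt => h; apply: ivt; rewrite /Rmin /Rmax; destruct Rle_dec; lra.
have [s1 s1'] := same 1 ltac:(lra); have [s2 s2'] := same (-1) ltac:(lra).
rewrite /upper /above e1 em e0; destruct Rlt_dec as [h|h].
  have := s1 h; have := s2 h => q1 q2.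
  rewrite !Rmax_left; try lra.
  have := h1 x y v1 v2 ltac:(lra) ltac:(lra); rewrite e1 em e0 -/S2.
  have -> : ph 1 - c + (ph (-1) - c) - 2 * (ph 0 - c) - 1 * hess x y v1 v2 =
     ph 1 + ph (-1) - 2 * ph 0 - hess x y v1 v2 by ring.
  exact.
have h' : ph 0 <= c by lra.
have := s1' h'; have := s2' h' => q1 q2.
rewrite !Rmax_right; try lra.
have -> : 0 + 0 - 2 * 0 - 0 * hess x y v1 v2 = 0 by ring.
rewrite Rabs_R0; have : 0 <= w * S2 by apply: Rmult_le_pos; lra.
lra.
Qed.

Variables (A1 A2 e1 e2 : R).
Hypothesis unit_e : e1 ^ 2 + e2 ^ 2 = 1.

(** Coordinates with origin [A] and first axis along [e]: they make an arbitrary chord horizontal,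
    as the lattice argument requires. *)
Definition framed (s t : R) : R := upper (A1 + s * e1 - t * e2) (A2 + s * e2 + t * e1).

Lemma rsum_centered N : \rsum_(i < (2 * N).+1) (INR i - INR N) = 0.
Proof.
have h : \rsum_(i < (2 * N).+1) (INR i - INR N) = - \rsum_(i < (2 * N).+1) (INR i - INR N).
  transitivity (\rsum_(i < (2 * N).+1) (-1 * (INR i - INR N))).
    rewrite (reindex_inj rev_ord_inj) /=; apply: eq_bigr => i _.
    rewrite minus_INR; last by have := ltn_ord i; lia.
    rewrite !S_INR mult_INR /=; ring.
  by rewrite -big_distrr /=; ring.
lra.
Qed.

Lemma rsum_squares m : \rsum_(i < m.+1) (INR i ^ 2) = INR m * (INR m + 1) * (2 * INR m + 1) / 6.
Proof.
elim: m => [|m IH]; first by rewrite big_ord_recr big_ord0 /=; field.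
by rewrite big_ord_recr IH S_INR /=; field.
Qed.

Lemma rsum_nat m : \rsum_(i < m.+1) INR i = INR m * (INR m + 1) / 2.
Proof.
elim: m => [|m IH]; first by rewrite big_ord_recr big_ord0 /=; field.
by rewrite big_ord_recr IH S_INR /=; field.
Qed.

(** The mean square of the offsets, [N (N + 1) / 3], is the origin of the relation between [s] and
    [d] in [stencil]. *)
Lemma rsum_centered_sq N : \rsum_(i < (2 * N).+1) ((INR i - INR N) ^ 2) =
  (2 * INR N + 1) * (INR N * (INR N + 1) / 3).
Proof.
transitivity (\rsum_(i < (2 * N).+1) (INR i ^ 2 + (-2 * INR N * INR i + INR N ^ 2))).
  by apply: eq_bigr => i _; ring.
rewrite big_split big_split /= -big_distrr /= rsum_squares rsum_nat rsum_const S_INR mult_INR /=.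
field.
Qed.

(** Each upper point is paired with the point of the lower row opposite to it, by reversing the
    index, and [upper_second] applies. In the sum of the Hessian forms the mixed terms cancel, and
    both frame directions receive the weight [s^2], which leaves the trace, whatever the frame.
    Where [psi <= c], both sides vanish because [f c = 0]. *)
Lemma framed_stencil : stencil framed (fun t => f (c + t)).
Proof.
move=> w hw.
(* The displacements have squared length at most [5 s^2]: up to [2 s] along the row and [s]
   across. *)
have [d [d0 hd]] := upper_second (w / 5) ltac:(lra).
exists (d / 4); split; first lra.
move=> N dl s hdl hs es x y.
set x0 := A1 + x * e1 - y * e2; set y0 := A2 + x * e2 + y * e1.
have P0 := pos_INR N.
set rr := fun i : nat => INR i - INR N.
have Nd : INR N * dl <= 2 * s.
  apply: Rnot_lt_le => h.
  have : 4 * s ^ 2 < (INR N * dl) ^ 2 by nra.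
  have : 0 <= dl ^ 2 * INR N by apply: Rmult_le_pos => //; apply: pow2_ge_0.
  rewrite es; nra.
have -> : \rsum_(i < (2 * N).+1) (framed (x + (INR i - INR N) * dl) (y + s) + framed (x + (INR i - INR N) * dl) (y - s)) =
  \rsum_(i < (2 * N).+1) (upper (x0 + (rr i * dl * e1 - s * e2)) (y0 + (rr i * dl * e2 + s * e1)) +
                          upper (x0 - (rr i * dl * e1 - s * e2)) (y0 - (rr i * dl * e2 + s * e1))).
  rewrite !big_split /=; congr Rplus.
    by apply: eq_bigr => i _; rewrite /framed /x0 /y0 /rr; congr upper; ring.
  rewrite (reindex_inj rev_ord_inj) /=; apply: eq_bigr => i _.
  rewrite minus_INR; last by have := ltn_ord i; lia.
  rewrite !S_INR mult_INR /framed /x0 /y0 /rr /=; congr upper; ring.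
have eqf : s ^ 2 * f (c + framed x y) = - (above x0 y0 * (s ^ 2 * (hess x0 y0 1 0 + hess x0 y0 0 1))).
  have -> : hess x0 y0 1 0 + hess x0 y0 0 1 = lap psi x0 y0 by rewrite /hess_form /lap; ring.
  rewrite /framed -/x0 -/y0 /upper /above; destruct Rlt_dec as [h|h].
    rewrite Rmax_left; last lra.
    have -> : c + (psi x0 y0 - c) = psi x0 y0 by ring.
    have := eqn x0 y0 => e; have -> : f (psi x0 y0) = - lap psi x0 y0 by lra.
    rewrite /=; ring.
  rewrite Rmax_right; last lra.
  rewrite Rplus_0_r fc0; rewrite /=; ring.
have eqsum : (2 * INR N + 1) * (2 * framed x y - s ^ 2 * f (c + framed x y)) =
  \rsum_(i < (2 * N).+1) (2 * upper x0 y0 + above x0 y0 * hess x0 y0 (rr i * dl * e1 - s * e2) (rr i * dl * e2 + s * e1)).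
  rewrite eqf big_split rsum_const S_INR mult_INR /=.
  rewrite -big_distrr /=.
  have -> : \rsum_(i < (2 * N).+1) hess x0 y0 (rr i * dl * e1 - s * e2) (rr i * dl * e2 + s * e1) =
    \rsum_(i < (2 * N).+1) ((dl ^ 2 * hess x0 y0 e1 e2) * rr i ^ 2 +
      ((2 * dl * s * (dy (dx psi) x0 y0 * (e1 ^ 2 - e2 ^ 2) + (dy (dy psi) x0 y0 - dx (dx psi) x0 y0) * (e1 * e2))) * rr i
       + s ^ 2 * hess x0 y0 (- e2) e1)).
    by apply: eq_bigr => i _; rewrite /hess_form; ring.
  rewrite big_split big_split /= -!big_distrr /= rsum_const S_INR mult_INR /rr rsum_centered rsum_centered_sq.
  rewrite /framed -/x0 -/y0 /=.
  have k : hess x0 y0 e1 e2 + hess x0 y0 (- e2) e1 = hess x0 y0 1 0 + hess x0 y0 0 1.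
    have -> : hess x0 y0 e1 e2 + hess x0 y0 (- e2) e1 = (e1 ^ 2 + e2 ^ 2) * (hess x0 y0 1 0 + hess x0 y0 0 1).
      rewrite /hess_form; ring.
    by rewrite unit_e Rmult_1_l.
  have -> : dl * (dl * 1) * hess x0 y0 e1 e2 * ((2 * INR N + 1) * (INR N * (INR N + 1) / 3)) =
     (2 * INR N + 1) * (s ^ 2 * hess x0 y0 e1 e2) by rewrite es; field.
  rewrite -k; ring.
rewrite eqsum.
have mono (F G : 'I_(2 * N).+1 -> R) : (forall i, Rabs (F i - G i) <= w * s ^ 2) ->
  Rabs (\rsum_(i < (2 * N).+1) F i - \rsum_(i < (2 * N).+1) G i) <= (2 * INR N + 1) * (w * s ^ 2).
  move=> h; apply: Rabs_le_intro.
  have e : \rsum_(i < (2 * N).+1) (w * s ^ 2) = (2 * INR N + 1) * (w * s ^ 2).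
    by rewrite rsum_const S_INR mult_INR /=; ring.
  have h1 : \rsum_(i < (2 * N).+1) F i <= \rsum_(i < (2 * N).+1) (G i + w * s ^ 2).
    by apply: rsum_le => i _; have := Rabs_le_elim _ _ (h i); lra.
  have h2 : \rsum_(i < (2 * N).+1) G i <= \rsum_(i < (2 * N).+1) (F i + w * s ^ 2).
    by apply: rsum_le => i _; have := Rabs_le_elim _ _ (h i); lra.
  rewrite big_split /= in h1; rewrite big_split /= in h2.
  rewrite -/(s ^ 2) in h1 h2; rewrite -e; move: h1 h2; rewrite /=; lra.
apply: mono => i.
have hr : Rabs (rr i) <= INR N.
  have : INR i <= INR (2 * N) by apply: le_INR; have := ltn_ord i; lia.
  have := pos_INR i; rewrite mult_INR /= => ? ?; apply: Rabs_le_intro; rewrite /rr; lra.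
have hrd : Rabs (rr i * dl) <= 2 * s.
  rewrite Rabs_scal_r; last lra.
  apply: Rle_trans Nd; apply: Rmult_le_compat_r; lra.
have u1 : Rabs e1 <= 1 by apply: Rabs_le_intro; have := pow2_ge_0 e2; nra.
have u2 : Rabs e2 <= 1 by apply: Rabs_le_intro; have := pow2_ge_0 e1; nra.
have prod a b m : Rabs a <= m -> Rabs b <= 1 -> Rabs (a * b) <= m.
  move=> ha hb; rewrite Rabs_mult -[X in _ <= X]Rmult_1_r.
  by apply: Rmult_le_compat => //; exact: Rabs_pos.
have ss : Rabs s <= s by rewrite Rabs_pos_eq; lra.
have v1 : Rabs (rr i * dl * e1 - s * e2) < d.
  apply: (Rle_lt_trans _ _ _ (Rabs_triang _ _)); rewrite Rabs_Ropp.
  have := prod _ _ _ hrd u1; have := prod _ _ _ ss u2; lra.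
have v2 : Rabs (rr i * dl * e2 + s * e1) < d.
  apply: (Rle_lt_trans _ _ _ (Rabs_triang _ _)).
  have := prod _ _ _ hrd u2; have := prod _ _ _ ss u1; lra.
have := hd x0 y0 _ _ v1 v2.
have -> : (rr i * dl * e1 - s * e2) ^ 2 + (rr i * dl * e2 + s * e1) ^ 2 = ((rr i * dl) ^ 2 + s ^ 2) * (e1 ^ 2 + e2 ^ 2) by ring.
rewrite unit_e Rmult_1_r.
have sq : (rr i * dl) ^ 2 <= 4 * s ^ 2 by move/Rabs_le_elim: hrd => hrd'; nra.
have : w / 5 * ((rr i * dl) ^ 2 + s ^ 2) <= w / 5 * (5 * s ^ 2) by apply: Rmult_le_compat_l; lra.
set T1 := upper _ _; set T2 := upper _ _ ; set T3 := above _ _ * _ => h1 h2.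
have -> : T1 + T2 - (2 * upper x0 y0 + T3) = T1 + T2 - 2 * upper x0 y0 - T3 by ring.
lra.
Qed.

End SecondDifference.

(** * The reflection law for chords in an arbitrary direction *)

Section ChordLaw.
Variables (psi : R -> R -> R) (f : R -> R) (X c : R).
Hypotheses (X0 : 0 < X) (C3 : Ck 3 psi) (fc : forall r, continuous f r)
  (eqn : forall x y, lap psi x y + f (psi x y) = 0) (box : const_off_box X c psi)
  (fc0 : f c = 0) (crit : forall x y, psi x y = c -> dx psi x y = 0 /\ dy psi x y = 0).

Let C1' : Ck 1 psi := Ck_pred 1 _ (Ck_pred 2 _ C3).
Let c0 : cont2 psi := Ck_cont2 3 _ C3.

Lemma grad_bounded : exists L, 0 < L /\
  (forall x y, Rabs (dx psi x y) <= L) /\ (forall x y, Rabs (dy psi x y) <= L).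
Proof.
have [L1 [h1 b1]] := box_bounded _ X 0 X0 (Ck_cont2 2 _ (Ck_dx 2 _ C3)) (dx_off_box _ _ _ box).
have [L2 [h2 b2]] := box_bounded _ X 0 X0 (Ck_cont2 2 _ (Ck_dy 2 _ C3)) (dy_off_box _ _ _ box).
exists (L1 + L2); split; first lra.
split=> x y; [have := b1 x y | have := b2 x y]; lra.
Qed.

Lemma f_uniform : forall w, 0 < w -> exists eta, 0 < eta /\ forall x y x' y',
  Rabs (upper psi c x y - upper psi c x' y') <= eta ->
  Rabs (f (c + upper psi c x y) - f (c + upper psi c x' y')) <= w.
Proof.
move=> w hw.
have [B [B0 hB]] := box_bounded psi X c X0 c0 box.
have [d hd] := @Heine_cor2 f (- (B + Rabs c)) (B + Rabs c)
  (fun x _ => proj2 (continuity_pt_filterlim f x) (fc x)) (mkposreal w hw).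
have d0 := cond_pos d.
have rng x y : - (B + Rabs c) <= c + upper psi c x y <= B + Rabs c.
  have := Rabs_le_elim _ _ (hB x y); have := Rabs_le_elim _ _ (Rle_refl (Rabs c)).
  rewrite /upper /Rmax; destruct Rle_dec; lra.
exists (d / 2); split; first lra.
move=> x y x' y' h; apply: Rlt_le; apply: hd => //.
have -> : c + upper psi c x y - (c + upper psi c x' y') = upper psi c x y - upper psi c x' y' by ring.
lra.
Qed.

Lemma rotation_bound e1 e2 v w : e1 ^ 2 + e2 ^ 2 = 1 ->
  Rabs (v * e1 - w * e2) <= Rabs v + Rabs w /\ Rabs (v * e2 + w * e1) <= Rabs v + Rabs w.
Proof.
move=> he.
have u1 : Rabs e1 <= 1 by apply: Rabs_le_intro; have := pow2_ge_0 e2; nra.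
have u2 : Rabs e2 <= 1 by apply: Rabs_le_intro; have := pow2_ge_0 e1; nra.
have prod a b : Rabs b <= 1 -> Rabs (a * b) <= Rabs a.
  move=> hb; rewrite Rabs_mult -[X in _ <= X]Rmult_1_r.
  by apply: Rmult_le_compat_l => //; exact: Rabs_pos.
split; apply: (Rle_trans _ _ _ (Rabs_triang _ _)); rewrite ?Rabs_Ropp;
  by apply: Rplus_le_compat; apply: prod.
Qed.

Lemma framed_strict_diff A1 A2 e1 e2 s0 t0 : e1 ^ 2 + e2 ^ 2 = 1 ->
  let x := A1 + s0 * e1 - t0 * e2 in let y := A2 + s0 * e2 + t0 * e1 in
  c < psi x y ->
  strict_diff (framed psi c A1 A2 e1 e2) s0 t0
    (dx psi x y * e1 + dy psi x y * e2) (- dx psi x y * e2 + dy psi x y * e1).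
Proof.
move=> he x y hxy z hz.
have [d1 [d10 h1]] := C1_strict_diff psi x y C1' (z / 2) ltac:(lra).
have [d2 [d20 h2]] := cont2_eps psi c0 x y (psi x y - c) ltac:(lra).
have [d [d0 [l1 [l2 _]]]] := common_min [:: d1 / 2; d2 / 2] ltac:(repeat split; lra).
exists d; split=> // s t s' t' hs ht hs' ht'.
have near v w : Rabs (v - s0) < d -> Rabs (w - t0) < d ->
  let x' := A1 + v * e1 - w * e2 in let y' := A2 + v * e2 + w * e1 in
  [/\ Rabs (x' - x) < d1, Rabs (y' - y) < d1 & framed psi c A1 A2 e1 e2 v w = psi x' y' - c].
  move=> hv hw x' y'.
  have [r1 r2] := rotation_bound e1 e2 (v - s0) (w - t0) he.
  have ex : x' - x = (v - s0) * e1 - (w - t0) * e2 by rewrite /x' /x; ring.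
  have ey : y' - y = (v - s0) * e2 + (w - t0) * e1 by rewrite /y' /y; ring.
  rewrite -ex in r1; rewrite -ey in r2.
  split; try lra.
  rewrite /framed -/x' -/y' /upper Rmax_left //.
  have := h2 x' y' ltac:(lra) ltac:(lra) => /Rabs_def2; lra.
have [a1 a2 a3] := near s t hs ht; have [b1 b2 b3] := near s' t' hs' ht'.
rewrite a3 b3.
have := h1 _ _ _ _ a1 a2 b1 b2.
have [r1 r2] := rotation_bound e1 e2 (s - s') (t - t') he.
have ex : A1 + s * e1 - t * e2 - (A1 + s' * e1 - t' * e2) = (s - s') * e1 - (t - t') * e2 by ring.
have ey : A2 + s * e2 + t * e1 - (A2 + s' * e2 + t' * e1) = (s - s') * e2 + (t - t') * e1 by ring.
rewrite ex ey => k.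
match goal with |- Rabs ?g <= _ => match type of k with Rabs ?h <= _ => have -> : g = h by ring end end.
apply: Rle_trans k _.
have : z / 2 * (Rabs ((s - s') * e1 - (t - t') * e2) + Rabs ((s - s') * e2 + (t - t') * e1)) <=
  z / 2 * (2 * (Rabs (s - s') + Rabs (t - t'))) by apply: Rmult_le_compat_l; lra.
lra.
Qed.

(** A rotation changes the sum of the absolute coordinates by at most a factor 2, whence [2 L] and
    the doubled size of the support. Since [h] is above [c], the truncation is inactive near both
    ends, and the gradients there are those of [psi]. *)
Lemma chord_law A1 A2 e1 e2 b h : e1 ^ 2 + e2 ^ 2 = 1 -> 0 < b -> c < h ->
  psi A1 A2 = h -> psi (A1 + b * e1) (A2 + b * e2) = h ->
  (forall t, 0 < t < b -> h < psi (A1 + t * e1) (A2 + t * e2)) ->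
  0 < dx psi A1 A2 * e1 + dy psi A1 A2 * e2 ->
  dx psi (A1 + b * e1) (A2 + b * e2) * e1 + dy psi (A1 + b * e1) (A2 + b * e2) * e2 < 0 ->
  dx psi (A1 + b * e1) (A2 + b * e2) * e1 + dy psi (A1 + b * e1) (A2 + b * e2) * e2 =
    - (dx psi A1 A2 * e1 + dy psi A1 A2 * e2) /\
  - dx psi (A1 + b * e1) (A2 + b * e2) * e2 + dy psi (A1 + b * e1) (A2 + b * e2) * e1 =
    - dx psi A1 A2 * e2 + dy psi A1 A2 * e1.
Proof.
move=> he hb hc hA hB hin dA dB.
have [L [L0 [Lx Ly]]] := grad_bounded.
have [B [B0 hBd]] := box_bounded psi X c X0 c0 box.
have eB : forall s, A1 + s * e1 - 0 * e2 = A1 + s * e1 by move=> s; ring.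
have eB' : forall s, A2 + s * e2 + 0 * e1 = A2 + s * e2 by move=> s; ring.
have on_axis s : framed psi c A1 A2 e1 e2 s 0 = upper psi c (A1 + s * e1) (A2 + s * e2).
  by rewrite /framed eB eB'.
have e0 : A1 + 0 * e1 = A1 /\ A2 + 0 * e2 = A2 by split; ring.
apply: (chord_reflection (framed psi c A1 A2 e1 e2) (fun t => f (c + t))
  (2 * (X + Rabs A1 + Rabs A2)) (2 * L) (B + Rabs c) 0 b 0 (h - c)).
- have := Rabs_pos A1; have := Rabs_pos A2; lra.
- lra.
- by move=> x y; apply: Rmax_r.
- move=> x y; rewrite /framed /upper.
  have := Rabs_le_elim _ _ (hBd (A1 + x * e1 - y * e2) (A2 + x * e2 + y * e1)).
  have := Rabs_le_elim _ _ (Rle_refl (Rabs c)).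
  rewrite /Rmax; destruct Rle_dec; lra.
- move=> s t hst; rewrite /framed /upper.
  set x := A1 + s * e1 - t * e2; set y := A2 + s * e2 + t * e1.
  rewrite box; first by rewrite Rminus_diag Rmax_left; lra.
  apply: NNPP => hn.
  have hx : Rabs x <= X by apply: Rnot_lt_le => h'; apply: hn; left.
  have hy : Rabs y <= X by apply: Rnot_lt_le => h'; apply: hn; right.
  have he' : e1 ^ 2 + (- e2) ^ 2 = 1 by rewrite -he; ring.
  have [r1 r2] := rotation_bound e1 (- e2) (x - A1) (y - A2) he'.
  have es : (x - A1) * e1 - (y - A2) * - e2 = s.
    transitivity (s * (e1 ^ 2 + e2 ^ 2)); [rewrite /x /y; ring | rewrite he; ring].
  have et : (x - A1) * - e2 + (y - A2) * e1 = t.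
    transitivity (t * (e1 ^ 2 + e2 ^ 2)); [rewrite /x /y; ring | rewrite he; ring].
  rewrite es in r1; rewrite et in r2.
  have := Rabs_triang x (- A1); have := Rabs_triang y (- A2); rewrite !Rabs_Ropp /Rminus in r1 r2 *.
  have := Rabs_pos A1; have := Rabs_pos A2.
  case: hst; lra.
- move=> s t s' t'; rewrite /framed.
  set x := A1 + s * e1 - t * e2; set y := A2 + s * e2 + t * e1.
  set x' := A1 + s' * e1 - t' * e2; set y' := A2 + s' * e2 + t' * e1.
  apply: (Rle_trans _ (Rabs (psi x y - psi x' y'))).
    rewrite /upper /Rmax /Rabs; do 2 destruct Rle_dec; do 2 destruct Rcase_abs; lra.
  apply: (Rle_trans _ _ _ (bounded_grad_lipschitz psi L C1' Lx Ly x y x' y')).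
  have [r1 r2] := rotation_bound e1 e2 (s - s') (t - t') he.
  have -> : x - x' = (s - s') * e1 - (t - t') * e2 by rewrite /x /x'; ring.
  have -> : y - y' = (s - s') * e2 + (t - t') * e1 by rewrite /y /y'; ring.
  rewrite (Rmult_comm 2) Rmult_assoc; apply: Rmult_le_compat_l; lra.
- move=> w hw; have [eta [eta0 h1]] := f_uniform w hw.
  exists eta; split=> // x y x' y'; exact: h1.
- exact: (framed_stencil psi f X c C3 eqn box fc0 crit).
- exact: hb.
- lra.
- rewrite on_axis; case: e0 => -> ->; rewrite /upper hA Rmax_left; lra.
- rewrite on_axis /upper hB Rmax_left; lra.
- move=> x hx; rewrite on_axis /upper; have := hin x hx => h1; rewrite Rmax_left; lra.
- exact: dA.
- exact: dB.
- have := framed_strict_diff A1 A2 e1 e2 0 0 he.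
  rewrite eB eB'; case: e0 => -> -> /=; apply; lra.
- have := framed_strict_diff A1 A2 e1 e2 b 0 he.
  rewrite eB eB' /=; apply; lra.
Qed.

End ChordLaw.

Lemma eps_continuity_pt g t : (forall e, 0 < e -> exists d, 0 < d /\
  forall s, Rabs (s - t) < d -> Rabs (g s - g t) < e) -> continuity_pt g t.
Proof. by move=> h e he; have [d [hd hh]] := h e he; exists d; split=> // s [_ hs]; exact: hh. Qed.

(** * First returns along rays *)

Lemma left_record_slope g l t d : is_derive g t l -> 0 < d ->
  (forall s, t - d < s < t -> g t <= g s) -> l <= 0.
Proof.
move=> dg hd h; apply: Rnot_lt_le => hl.
have [e [e0 he]] := is_derive_bound g t l dg (l / 2) ltac:(lra).
have [m [m0 [m1 [m2 _]]]] := common_min [:: d / 2; e / 2] ltac:(repeat split; lra).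
have := he (t - m); have -> : t - m - t = - m by ring.
rewrite Rabs_Ropp (Rabs_pos_eq m); last lra.
move=> /(_ ltac:(lra)) /Rabs_le_elim.
have := h (t - m) ltac:(lra); nra.
Qed.

Section FirstReturn.
Variables (psi : R -> R -> R) (f : R -> R) (X c : R).
Hypotheses (X0 : 0 < X) (C3 : Ck 3 psi) (fc : forall r, continuous f r)
  (eqn : forall x y, lap psi x y + f (psi x y) = 0) (box : const_off_box X c psi)
  (fc0 : f c = 0) (crit : forall x y, psi x y = c -> dx psi x y = 0 /\ dy psi x y = 0).

(** The direction is not normalized: [b] is a parameter and not a length. This leaves the directions
    free to depend simply on a parameter, as [n] plus a multiple of its normal, or to be the
    gradient itself. *)
Definition first_return (A1 A2 E1 E2 b : R) : Prop :=
  [/\ 0 < b, psi (A1 + b * E1) (A2 + b * E2) = psi A1 A2 &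
      forall t, 0 < t < b -> psi A1 A2 < psi (A1 + t * E1) (A2 + t * E2)].

Lemma chord_law_scaled A1 A2 E1 E2 b :
  c < psi A1 A2 -> first_return A1 A2 E1 E2 b ->
  let B1 := A1 + b * E1 in let B2 := A2 + b * E2 in
  0 < dx psi A1 A2 * E1 + dy psi A1 A2 * E2 ->
  dx psi B1 B2 * E1 + dy psi B1 B2 * E2 < 0 ->
  dx psi B1 B2 * E1 + dy psi B1 B2 * E2 = - (dx psi A1 A2 * E1 + dy psi A1 A2 * E2) /\
  - dx psi B1 B2 * E2 + dy psi B1 B2 * E1 = - dx psi A1 A2 * E2 + dy psi A1 A2 * E1.
Proof.
move=> hc [hb hB hin] B1 B2 dA dB.
have n0 : 0 < E1 ^ 2 + E2 ^ 2.
  have := pow2_ge_0 E1; have := pow2_ge_0 E2 => p1 p2.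
  have [z|//] : E1 ^ 2 + E2 ^ 2 = 0 \/ 0 < E1 ^ 2 + E2 ^ 2 by lra.
  have z1 : E1 = 0 by nra. have z2 : E2 = 0 by nra.
  by rewrite z1 z2 in dA; lra.
set m := sqrt (E1 ^ 2 + E2 ^ 2).
have m0 : 0 < m by apply: sqrt_lt_R0.
have mm : m * m = E1 ^ 2 + E2 ^ 2 by apply: sqrt_sqrt; lra.
have sc t (v : R) : t * m * (v / m) = t * v by field; lra.
have sc' t (v : R) : t * (v / m) = t / m * v by field; lra.
have := chord_law psi f X c X0 C3 fc eqn box fc0 crit A1 A2 (E1 / m) (E2 / m) (b * m) (psi A1 A2).
rewrite !sc -/B1 -/B2 => h.
have [h1 h2] : dx psi B1 B2 * (E1 / m) + dy psi B1 B2 * (E2 / m) = - (dx psi A1 A2 * (E1 / m) + dy psi A1 A2 * (E2 / m)) /\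
  - dx psi B1 B2 * (E2 / m) + dy psi B1 B2 * (E1 / m) = - dx psi A1 A2 * (E2 / m) + dy psi A1 A2 * (E1 / m).
  apply: h => //.
  - have -> : (E1 / m) ^ 2 + (E2 / m) ^ 2 = (E1 ^ 2 + E2 ^ 2) / (m * m) by field; lra.
    rewrite -mm; field; lra.
  - exact: Rmult_lt_0_compat.
  - move=> t ht; rewrite !sc'; apply: hin; split.
      apply: Rdiv_lt_0_compat; lra.
    apply: (Rmult_lt_reg_r m) => //.
    have -> : t / m * m = t by field; lra.
    lra.
  - have -> : dx psi A1 A2 * (E1 / m) + dy psi A1 A2 * (E2 / m) = (dx psi A1 A2 * E1 + dy psi A1 A2 * E2) / m by field; lra.
    exact: Rdiv_lt_0_compat.
  - have -> : dx psi B1 B2 * (E1 / m) + dy psi B1 B2 * (E2 / m) = - ((- (dx psi B1 B2 * E1 + dy psi B1 B2 * E2)) / m) by field; lra.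
    have : 0 < (- (dx psi B1 B2 * E1 + dy psi B1 B2 * E2)) / m by apply: Rdiv_lt_0_compat; lra.
    lra.
split; apply: (Rmult_eq_reg_r (/ m)); try (apply: Rinv_neq_0_compat; lra).
  by rewrite /Rdiv in h1; lra.
by rewrite /Rdiv in h2; lra.
Qed.

Lemma line_cont A1 A2 E1 E2 t : continuity_pt (fun t => psi (A1 + t * E1) (A2 + t * E2)) t.
Proof. apply: derivable_continuous_pt; eexists; apply/is_derive_Reals; exact: psi_line. Qed.

Lemma line_slope_cont A1 A2 E1 E2 t :
  continuity_pt (fun t => dx psi (A1 + t * E1) (A2 + t * E2) * E1 + dy psi (A1 + t * E1) (A2 + t * E2) * E2) t.
Proof. apply: derivable_continuous_pt; eexists; apply/is_derive_Reals; exact: psi_line2. Qed.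

(* A non-transversal return is impossible: nearby chords between slightly higher levels, chosen to
   be transversal by tilting the graph, would have end slopes that do not match. *)
Lemma return_transversal A1 A2 E1 E2 b :
  c < psi A1 A2 -> first_return A1 A2 E1 E2 b ->
  0 < dx psi A1 A2 * E1 + dy psi A1 A2 * E2 ->
  dx psi (A1 + b * E1) (A2 + b * E2) * E1 + dy psi (A1 + b * E1) (A2 + b * E2) * E2 < 0.
Proof.
move=> hc [hb hB hin] dA; apply: Rnot_le_lt => dB.
set h := psi A1 A2 in hc hB hin.
set ph := fun t => psi (A1 + t * E1) (A2 + t * E2).
set sl := fun t => dx psi (A1 + t * E1) (A2 + t * E2) * E1 + dy psi (A1 + t * E1) (A2 + t * E2) * E2.
have dph t : is_derive ph t (sl t) := psi_line psi C3 A1 A2 E1 E2 t.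
have cph t : continuity_pt ph t := line_cont A1 A2 E1 E2 t.
have csl t : continuity_pt sl t := line_slope_cont A1 A2 E1 E2 t.
have ph0 : ph 0 = h by rewrite /ph !Rmult_0_l !Rplus_0_r.
have sl0 : sl 0 = dx psi A1 A2 * E1 + dy psi A1 A2 * E2 by rewrite /sl !Rmult_0_l !Rplus_0_r.
set g := dx psi A1 A2 * E1 + dy psi A1 A2 * E2 in dA sl0.
have [d1 [d10 h1]] := continuity_pt_eps sl 0 (csl 0) (g / 2) ltac:(lra).
have [d2 [d20 h2]] := continuity_pt_eps sl b (csl b) (g / 2) ltac:(lra).
have [d [d0 [l1 [l2 [l3 _]]]]] := common_min [:: d1; d2; b / 2] ltac:(repeat split; lra).
have up t : Rabs t < d -> g / 2 < sl t.
  move=> ht; have := h1 t; rewrite Rminus_0_r sl0 => /(_ ltac:(lra)) /Rabs_def2; lra.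
have dn t : Rabs (t - b) < d -> - (g / 2) < sl t.
  move=> ht; have := h2 t ltac:(lra) => /Rabs_def2; rewrite /sl in dB *; lra.
have [tm [hmin htm]] := continuity_ab_min ph (d / 2) (b - d / 2) ltac:(lra) (fun t _ => cph t).
set m := ph tm in hmin.
have mh : h < m by apply: hin; lra.
set q := m - h.
(* The tilt changes values by at most [q / 2] over the length [d], so that the level [k] found below
   stays under the minimum [m] of the middle part. *)
set kp := q / (2 * d).
have kpd : kp * d = q / 2 by rewrite /kp; field; lra.
have kp0 : 0 < kp by apply: Rdiv_lt_0_compat; rewrite /q; lra.
set chi := fun t => ph t + kp * t.
have dchi t : is_derive chi t (sl t + kp).
  apply: is_derive_plus => //; by auto_derive => //; ring.
have cchi t : continuity_pt chi t.
  by apply: derivable_continuous_pt; eexists; apply/is_derive_Reals; exact: dchi.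
(* At its first arrival at this value the tilted function [chi] has slope at most 0, hence [ph] has
   slope at most [- kp]: the return at [t] is transversal. *)
have [t [ht [et rec]]] := first_hit chi (b - d / 2) b (h + kp * b + q / 4) cchi ltac:(lra)
  ltac:(rewrite /chi; have := hmin (b - d / 2) ltac:(lra); rewrite /q in kpd *; lra)
  ltac:(rewrite /chi /ph hB; rewrite /q; lra).
set k := ph t.
have ek : k = h + kp * (b - t) + q / 4 by rewrite /k; rewrite /chi in et; lra.
have kr : h < k <= h + q / 2.
  have : 0 <= kp * (b - t) by apply: Rmult_le_pos; lra.
  have : kp * (b - t) <= kp * (d / 2) by apply: Rmult_le_compat_l; lra.
  rewrite /q in kpd ek *; lra.
have tb : t < b.
  have [e|//] : t = b \/ t < b by lra.
  by move: kr; rewrite /k e /ph hB; lra.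
have slt : sl t <= - kp.
  have : sl t + kp <= 0; last lra.
  apply: (left_record_slope chi _ t (t - (b - d / 2)) (dchi t)); first lra.
  move=> s hs; have := rec s ltac:(lra); lra.
have [a [ha ea]] : {a | Rmin 0 (d / 2) <= a <= Rmax 0 (d / 2) /\ ph a = k}.
  apply: IVT_gen; first exact: cph.
  have := hmin (d / 2) ltac:(lra); rewrite ph0 /q in kr *.
  rewrite /Rmin /Rmax; destruct Rle_dec; lra.
rewrite Rmin_left ?Rmax_right in ha; try lra.
have apos : 0 < a.
  have [e|//] : a = 0 \/ 0 < a by lra.
  by move: ea; rewrite e ph0; lra.
have shift s : A1 + a * E1 + s * E1 = A1 + (a + s) * E1 /\ A2 + a * E2 + s * E2 = A2 + (a + s) * E2.
  by split; ring.
have fr : first_return (A1 + a * E1) (A2 + a * E2) E1 E2 (t - a).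
  split; first lra.
    have [-> ->] := shift (t - a); rewrite -/(ph a) ea.
    by have -> : a + (t - a) = t by ring.
  move=> s hs; have [-> ->] := shift s; rewrite -/(ph a) ea -/(ph (a + s)).
  set r := a + s.
  have [r1|r1] := Rle_dec r (d / 2).
    have [x [hx ex]] := mvt_open ph sl a r ltac:(rewrite /r; lra) dph.
    have : g / 2 < sl x by apply: up; apply: Rabs_def1; lra.
    move=> hs'; have : 0 < sl x * (r - a) by apply: Rmult_lt_0_compat; rewrite /r; lra.
    lra.
  have [r2|r2] := Rle_dec r (b - d / 2).
    have := hmin r ltac:(lra); rewrite /q in kr; lra.
  have := rec r ltac:(rewrite /r in r1 r2 *; lra); rewrite /chi => hr.
  have : kp * r < kp * t by apply: Rmult_lt_compat_l; rewrite /r; lra.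
  rewrite ek; lra.
have hca : c < psi (A1 + a * E1) (A2 + a * E2) by rewrite -/(ph a) ea; lra.
have := chord_law_scaled _ _ _ _ _ hca fr; rewrite /=.
have [-> ->] := shift (t - a); have -> : a + (t - a) = t by ring.
rewrite -/(sl t) -/(sl a) => law.
have ga : g / 2 < sl a by apply: up; apply: Rabs_def1; lra.
(* The slope at the left end exceeds [g / 2]; the one at [t] is above [- g / 2], since [t] is close
   to the nontransversal return. So they are not opposite. *)
have [e _] := law ltac:(lra) ltac:(lra).
have := dn t ltac:(apply: Rabs_def1; lra); lra.
Qed.

Lemma return_law A1 A2 E1 E2 b :
  c < psi A1 A2 -> first_return A1 A2 E1 E2 b ->
  let B1 := A1 + b * E1 in let B2 := A2 + b * E2 in
  0 < dx psi A1 A2 * E1 + dy psi A1 A2 * E2 ->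
  dx psi B1 B2 * E1 + dy psi B1 B2 * E2 = - (dx psi A1 A2 * E1 + dy psi A1 A2 * E2) /\
  - dx psi B1 B2 * E2 + dy psi B1 B2 * E1 = - dx psi A1 A2 * E2 + dy psi A1 A2 * E1.
Proof.
move=> hc hfr B1 B2 dA; apply: chord_law_scaled => //; exact: return_transversal.
Qed.

(** The ray starts upwards and leaves the box, where [psi = c] is below the starting level. *)
Lemma return_exists A1 A2 E1 E2 :
  c < psi A1 A2 -> 0 < dx psi A1 A2 * E1 + dy psi A1 A2 * E2 ->
  exists b, first_return A1 A2 E1 E2 b.
Proof.
move=> hc dA.
set ph := fun t => psi (A1 + t * E1) (A2 + t * E2).
set sl := fun t => dx psi (A1 + t * E1) (A2 + t * E2) * E1 + dy psi (A1 + t * E1) (A2 + t * E2) * E2.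
have dph t : is_derive ph t (sl t) := psi_line psi C3 A1 A2 E1 E2 t.
have cph t : continuity_pt ph t := line_cont A1 A2 E1 E2 t.
have csl t : continuity_pt sl t := line_slope_cont A1 A2 E1 E2 t.
have ph0 : ph 0 = psi A1 A2 by rewrite /ph !Rmult_0_l !Rplus_0_r.
have sl0 : sl 0 = dx psi A1 A2 * E1 + dy psi A1 A2 * E2 by rewrite /sl !Rmult_0_l !Rplus_0_r.
have [d [d0 hd]] := continuity_pt_eps sl 0 (csl 0) (sl 0) ltac:(rewrite sl0; lra).
have inc t : 0 < t < d -> psi A1 A2 < ph t.
  move=> ht; have [x [hx ex]] := mvt_open ph sl 0 t ltac:(lra) dph.
  have := hd x; rewrite Rminus_0_r => /(_ ltac:(apply: Rabs_def1; lra)) /Rabs_def2 hs.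
  have : 0 < sl x * (t - 0) by apply: Rmult_lt_0_compat; lra.
  lra.
have far E A0 : E <> 0 -> exists T, d < T /\ X < Rabs (A0 + T * E).
  move=> hE; have aE : 0 < Rabs E by apply: Rabs_pos_lt.
  exists (d + (X + Rabs A0 + 1) / Rabs E).
  have q0 : 0 < (X + Rabs A0 + 1) / Rabs E.
    apply: Rdiv_lt_0_compat => //; have := Rabs_pos A0; lra.
  split; first lra.
  set T := d + _.
  have := Rabs_triang (A0 + T * E) (- A0); rewrite Rabs_Ropp.
  have -> : A0 + T * E + - A0 = T * E by ring.
  rewrite Rabs_mult (Rabs_pos_eq T); last by rewrite /T; lra.
  have : (X + Rabs A0 + 1) <= T * Rabs E.
    have {1}-> : X + Rabs A0 + 1 = (X + Rabs A0 + 1) / Rabs E * Rabs E by field; lra.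
    apply: Rmult_le_compat_r; rewrite /T; lra.
  lra.
have [T [hT eT]] : exists T, d < T /\ ph T = c.
  have [h|h] : E1 <> 0 \/ E2 <> 0.
  - apply: NNPP => hn; have z1 : E1 = 0 by apply: NNPP => z; apply: hn; left.
    have z2 : E2 = 0 by apply: NNPP => z; apply: hn; right.
    by rewrite z1 z2 in dA; lra.
  - have [T [h1 h2]] := far E1 A1 h; exists T; split=> //; apply: box; by left.
  - have [T [h1 h2]] := far E2 A2 h; exists T; split=> //; apply: box; by right.
have [b [hb [eb rec]]] := first_hit ph (d / 2) T (psi A1 A2) cph ltac:(lra) (inc (d / 2) ltac:(lra)) ltac:(lra).
exists b; split=> //; first lra.
move=> t ht; have [h|h] := Rlt_dec t d; first by apply: inc; lra.
apply: rec; lra.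
Qed.

End FirstReturn.

(** * Dependence of the return time on the ray *)

Lemma bound_is_derive f x l : (forall e, 0 < e -> exists d, 0 < d /\
    forall t, Rabs (t - x) < d -> Rabs (f t - f x - l * (t - x)) <= e * Rabs (t - x)) ->
  is_derive f x l.
Proof.
move=> h; apply/is_derive_Reals => e he.
have [d [d0 hd]] := h (e / 2) ltac:(lra).
exists (mkposreal d d0) => t t0 /= ht.
have := hd (x + t); have -> : x + t - x = t by ring.
move=> /(_ ht) h1.
have -> : (f (x + t) - f x) / t - l = (f (x + t) - f x - l * t) / t by field.
have tp : 0 < Rabs t by apply: Rabs_pos_lt.
rewrite /Rdiv Rabs_mult Rabs_inv; apply: (Rmult_lt_reg_r (Rabs t)) => //.
rewrite Rmult_assoc Rinv_l; nra.
Qed.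

(** The function [k] is given and continuous, so differentiability of [Gam] at the single point is
    enough. *)
Lemma implicit_derivative (Gam : R -> R -> R) (k g : R -> R) t0 p q g' :
  differentiable_pt_lim Gam t0 (k t0) p q -> is_derive g t0 g' -> q <> 0 ->
  continuity_pt k t0 ->
  (exists d, 0 < d /\ forall t, Rabs (t - t0) < d -> Gam t (k t) = g t) ->
  is_derive k t0 ((g' - p) / q).
Proof.
move=> dG dg q0 ck [d1 [d10 eqn]].
have aq : 0 < Rabs q by apply: Rabs_pos_lt.
set l := (g' - p) / q.
have main z : 0 < z -> z <= Rabs q / 2 -> exists d, 0 < d /\ forall t, Rabs (t - t0) < d ->
    Rabs (q * (k t - k t0 - l * (t - t0))) <= z * (2 * Rabs (t - t0) + Rabs (k t - k t0)).
  move=> hz hzq.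
  have [d2 h2] := dG (mkposreal z hz).
  have [d3 [d30 h3]] := is_derive_bound g t0 g' dg z hz.
  have [d4 [d40 h4]] := continuity_pt_eps k t0 ck d2 (cond_pos d2).
  have d20 := cond_pos d2.
  have [d [d0 [l1 [l2 [l3 [l4 _]]]]]] := common_min [:: d1; d2 : R; d3; d4] ltac:(repeat split; lra).
  exists d; split=> // t ht.
  have := h2 t (k t) ltac:(lra) (h4 t ltac:(lra)); rewrite /=.
  have := h3 t ltac:(lra).
  rewrite (eqn t ltac:(lra)) (eqn t0); last by rewrite Rminus_diag Rabs_R0.
  have mx : Rmax (Rabs (t - t0)) (Rabs (k t - k t0)) <= Rabs (t - t0) + Rabs (k t - k t0).
    by apply: Rmax_lub; have := Rabs_pos (t - t0); have := Rabs_pos (k t - k t0); lra.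
  move=> /Rabs_le_elim a1 a2.
  have : Rabs (g t - g t0 - (p * (t - t0) + q * (k t - k t0))) <= z * (Rabs (t - t0) + Rabs (k t - k t0)).
    by apply: Rle_trans a2 _; apply: Rmult_le_compat_l; lra.
  move=> /Rabs_le_elim a3.
  have -> : q * (k t - k t0 - l * (t - t0)) = q * (k t - k t0) - (g' - p) * (t - t0) by rewrite /l; field.
  apply: Rabs_le_intro; lra.
(* For this [z] the increment of [k] on the right can be absorbed. So [k] is Lipschitz at [t0], and
   with this a small [z] gives the derivative. *)
have [dK [dK0 hK]] := main (Rabs q / 2) ltac:(lra) ltac:(lra).
set K := 2 * (1 + Rabs l).
have Kp : 0 < K by rewrite /K; have := Rabs_pos l; lra.
have lip t : Rabs (t - t0) < dK -> Rabs (k t - k t0) <= K * Rabs (t - t0).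
  move=> ht; have := hK t ht; rewrite Rabs_mult => h.
  have h' : Rabs (k t - k t0 - l * (t - t0)) <= / 2 * (2 * Rabs (t - t0) + Rabs (k t - k t0)).
    apply: (Rmult_le_reg_l (Rabs q)) => //; lra.
  have := Rabs_triang (k t - k t0 - l * (t - t0)) (l * (t - t0)).
  have -> : k t - k t0 - l * (t - t0) + l * (t - t0) = k t - k t0 by ring.
  rewrite (Rabs_mult l) /K; lra.
apply: bound_is_derive => e he.
set z := Rmin (Rabs q / 2) (e * Rabs q / (2 + K)).
have z0 : 0 < z.
  apply: Rmin_glb_lt; first lra.
  apply: Rdiv_lt_0_compat; [exact: Rmult_lt_0_compat | lra].
have [d [d0 hd]] := main z z0 (Rmin_l _ _).
have m1 := Rmin_l d dK; have m2 := Rmin_r d dK.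
exists (Rmin d dK); split; first exact: Rmin_glb_lt.
move=> t ht; have := hd t ltac:(lra); have := lip t ltac:(lra); rewrite Rabs_mult => h1 h2.
apply: (Rmult_le_reg_l (Rabs q)) => //; apply: Rle_trans h2 _.
have tp := Rabs_pos (t - t0).
apply: (Rle_trans _ (z * ((2 + K) * Rabs (t - t0)))).
  apply: Rmult_le_compat_l; lra.
have : z * (2 + K) <= e * Rabs q.
  have -> : e * Rabs q = e * Rabs q / (2 + K) * (2 + K) by field; lra.
  apply: Rmult_le_compat_r; [lra | exact: Rmin_r].
nra.
Qed.

Lemma differentiable_ray P E dP dE t0 k0 : is_derive P t0 dP -> is_derive E t0 dE ->
  differentiable_pt_lim (fun t k => P t + k * E t) t0 k0 (dP + k0 * dE) (E t0).
Proof.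
move=> hP hE e; have e0 := cond_pos e.
set z := e / (3 + Rabs k0).
have kp := Rabs_pos k0.
have z0 : 0 < z by apply: Rdiv_lt_0_compat; lra.
have ez : z * (3 + Rabs k0) = e by rewrite /z; field; lra.
have [d1 [d10 h1]] := is_derive_bound _ _ _ hP z z0.
have [d2 [d20 h2]] := is_derive_bound _ _ _ hE z z0.
have cE : continuity_pt E t0 by apply: derivable_continuous_pt; exists dE; apply/is_derive_Reals.
have [d3 [d30 h3]] := continuity_pt_eps E t0 cE z z0.
have [d [d0 [l1 [l2 [l3 _]]]]] := common_min [:: d1; d2; d3] ltac:(repeat split; lra).
exists (mkposreal d d0) => t k /= ht hk.
have a1 := h1 t ltac:(lra). have a2 := h2 t ltac:(lra). have a3 := h3 t ltac:(lra).
have -> : P t + k * E t - (P t0 + k0 * E t0) - ((dP + k0 * dE) * (t - t0) + E t0 * (k - k0)) =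
  (P t - P t0 - dP * (t - t0)) + (k0 * (E t - E t0 - dE * (t - t0)) + (k - k0) * (E t - E t0)) by ring.
apply: (Rle_trans _ _ _ (Rabs_triang _ _)).
have b1 := Rabs_triang (k0 * (E t - E t0 - dE * (t - t0))) ((k - k0) * (E t - E t0)).
rewrite !Rabs_mult in b1.
have m1 := Rmax_l (Rabs (t - t0)) (Rabs (k - k0)); have m2 := Rmax_r (Rabs (t - t0)) (Rabs (k - k0)).
set m := Rmax _ _ in m1 m2 *.
have t1 := Rabs_pos (t - t0); have t2 := Rabs_pos (k - k0).
have c1 : Rabs k0 * Rabs (E t - E t0 - dE * (t - t0)) <= Rabs k0 * (z * m).
  apply: Rmult_le_compat_l => //; apply: Rle_trans a2 _; apply: Rmult_le_compat_l; lra.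
have c2 : Rabs (k - k0) * Rabs (E t - E t0) <= m * z.
  apply: Rmult_le_compat; try lra; exact: Rabs_pos.
have c3 : z * Rabs (t - t0) <= z * m by apply: Rmult_le_compat_l; lra.
have : 0 <= z * m by apply: Rmult_le_pos; lra.
rewrite -ez; lra.
Qed.

Section ReturnCurve.
Variables (psi : R -> R -> R) (f : R -> R) (X c : R).
Hypotheses (X0 : 0 < X) (C3 : Ck 3 psi) (fc : forall r, continuous f r)
  (eqn : forall x y, lap psi x y + f (psi x y) = 0) (box : const_off_box X c psi)
  (fc0 : f c = 0) (crit : forall x y, psi x y = c -> dx psi x y = 0 /\ dy psi x y = 0).
Variables (P1 P2 E1 E2 dP1 dP2 dE1 dE2 k : R -> R) (t0 d : R).
Hypotheses (hP1 : forall t, is_derive P1 t (dP1 t)) (hP2 : forall t, is_derive P2 t (dP2 t))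
  (hE1 : forall t, is_derive E1 t (dE1 t)) (hE2 : forall t, is_derive E2 t (dE2 t)).
Hypothesis level : c < psi (P1 t0) (P2 t0).
Hypothesis slope : 0 < dx psi (P1 t0) (P2 t0) * E1 t0 + dy psi (P1 t0) (P2 t0) * E2 t0.
Hypotheses (d0 : 0 < d)
  (ret : forall t, Rabs (t - t0) < d -> first_return psi (P1 t) (P2 t) (E1 t) (E2 t) (k t)).

Let C1' : Ck 1 psi := Ck_pred 1 _ (Ck_pred 2 _ C3).
Let Gam t s := psi (P1 t + s * E1 t) (P2 t + s * E2 t).
Let sl t s := dx psi (P1 t + s * E1 t) (P2 t + s * E2 t) * E1 t
            + dy psi (P1 t + s * E1 t) (P2 t + s * E2 t) * E2 t.

Lemma cont2_ray u (P E : R -> R) (Q F : R -> R) : cont2 u ->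
  (forall t, continuous P t) -> (forall t, continuous E t) ->
  (forall t, continuous Q t) -> (forall t, continuous F t) ->
  cont2 (fun t s => u (P t + s * E t) (Q t + s * F t)).
Proof.
move=> hu hP hE hQ hF t s.
have fs (g : R -> R) : (forall t, continuous g t) -> continuous (fun p : R * R => g (fst p)) (t, s).
  move=> hg; apply: (continuous_comp fst g); [exact: continuous_fst | exact: hg].
have ray (g h : R -> R) : (forall t, continuous g t) -> (forall t, continuous h t) ->
   continuous (fun p : R * R => g (fst p) + snd p * h (fst p)) (t, s).
  move=> hg hh; apply: (continuous_plus (fun p : R * R => g (fst p))); first exact: fs.
  apply: (continuous_mult (fun p : R * R => snd p)); [exact: continuous_snd | exact: fs].
apply: (continuous_comp_2 (fun p : R * R => P (fst p) + snd p * E (fst p))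
  (fun p : R * R => Q (fst p) + snd p * F (fst p)) u); [exact: ray | exact: ray | exact: hu].
Qed.

Let dcont (g dg : R -> R) : (forall t, is_derive g t (dg t)) -> forall t, continuous g t.
Proof. by move=> h t; apply: ex_derive_continuous; exists (dg t). Qed.

Let cG : cont2 Gam.
Proof. by apply: cont2_ray; [exact: Ck_cont2 C3 | exact: dcont hP1 | exact: dcont hE1 | exact: dcont hP2 | exact: dcont hE2]. Qed.

Let csl : cont2 sl.
Proof.
have cE (g : R -> R) : (forall t, continuous g t) -> cont2 (fun t _ => g t).
  move=> hg t s; apply: (continuous_comp fst g); [exact: continuous_fst | exact: hg].
apply: cont2_plus; apply: cont2_mult; try (apply: cE; exact: dcont).
  by apply: cont2_ray; [exact: Ck_cont2 (Ck_dx _ _ C3) | exact: dcont hP1 | exact: dcont hE1 | exact: dcont hP2 | exact: dcont hE2].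
by apply: cont2_ray; [exact: Ck_cont2 (Ck_dy _ _ C3) | exact: dcont hP1 | exact: dcont hE1 | exact: dcont hP2 | exact: dcont hE2].
Qed.

Let dG t s : is_derive (Gam t) s (sl t s).
Proof. exact: psi_line. Qed.

Let G0 t : Gam t 0 = psi (P1 t) (P2 t).
Proof. by rewrite /Gam !Rmult_0_l !Rplus_0_r. Qed.

(** For nearby rays there is no earlier return: close to the start [psi] increases uniformly, and in
    the middle it stays above the starting level by a margin. There is no much later one either,
    because by transversality [psi] has dropped below that level at [b + r]. *)
Lemma return_continuous : continuity_pt k t0.
Proof.
have ret0 := ret t0 ltac:(rewrite Rminus_diag Rabs_R0; lra).
have [b0 eb hin] := ret0.
set b := k t0 in ret0 b0 eb hin.
rewrite -/(Gam t0 b) -G0 in eb.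
have s0 : 0 < sl t0 0 by rewrite /sl !Rmult_0_l !Rplus_0_r.
have sb : sl t0 b < 0.
  exact: (return_transversal psi f X c X0 C3 fc eqn box fc0 crit _ _ _ _ _ level ret0 slope).
apply: eps_continuity_pt => e he.
have [d1 [d10 h1]] := cont2_eps sl csl t0 0 (sl t0 0) s0.
have [d2 [d20 h2]] := cont2_eps sl csl t0 b (- sl t0 b) ltac:(lra).
have inc t s : Rabs (t - t0) < d1 -> 0 < s < d1 -> Gam t 0 < Gam t s.
  move=> ht hs; have [r [hr er]] := mvt_open (Gam t) (sl t) 0 s ltac:(lra) (dG t).
  have := h1 t r ht ltac:(apply: Rabs_def1; lra) => /Rabs_def2 hsl.
  have : 0 < sl t r * (s - 0) by apply: Rmult_lt_0_compat; lra.
  lra.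
have [r [r0 [r1 [r2 [r3 _]]]]] := common_min [:: e / 2; d2 / 2; / 2] ltac:(repeat split; lra).
have below : Gam t0 (b + r) < Gam t0 0.
  rewrite -eb; have [s [hs es]] := mvt_open (Gam t0) (sl t0) b (b + r) ltac:(lra) (dG t0).
  have := h2 t0 s ltac:(rewrite Rminus_diag Rabs_R0; lra) ltac:(apply: Rabs_def1; lra) => /Rabs_def2 hsl.
  have : 0 < - sl t0 s * (b + r - b) by apply: Rmult_lt_0_compat; lra.
  lra.
have [m [m0 hm]] : exists m, 0 < m /\ forall s, d1 / 2 <= s <= b - r -> Gam t0 0 + m <= Gam t0 s.
  have [h|h] := Rle_dec (d1 / 2) (b - r); last by exists 1; split; [lra | move=> s; lra].
  have cg s : continuity_pt (Gam t0) s.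
    by apply: derivable_continuous_pt; exists (sl t0 s); apply/is_derive_Reals.
  have [x [hx hx']] := continuity_ab_min (Gam t0) _ _ h (fun s _ => cg s).
  exists (Gam t0 x - Gam t0 0); split; last by move=> s /hx; lra.
  have := hin x ltac:(lra); rewrite -/(Gam t0 x) -G0; lra.
have [z [z0 [z1 [z2 _]]]] := common_min [:: m / 2; (Gam t0 0 - Gam t0 (b + r)) / 2]
  ltac:(repeat split; lra).
have [d3 h3] := uniform_continuity_2d Gam (t0 - 1) (t0 + 1) 0 (b + 1)
  (fun x y _ _ => cont2_continuity_2d Gam cG x y) (mkposreal z z0).
have d30 := cond_pos d3.
have [q [q0 [q1 [q2 [q3 [q4 _]]]]]] := common_min [:: d; d1; d3 : R; 1] ltac:(repeat split; lra).
exists q; split=> // t ht.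
have close s : 0 <= s <= b + 1 -> Rabs (Gam t s - Gam t0 s) < z.
  move=> hs; move/Rabs_def2: (ht) => ht'.
  by apply: h3; try lra; rewrite Rminus_diag Rabs_R0.
have k0 := close 0 ltac:(lra); move/Rabs_def2: k0 => k0.
have [bt et ht'] := ret t ltac:(lra).
rewrite -/(Gam t (k t)) -G0 in et.
have lo : b - r <= k t.
  apply: Rnot_lt_le => hlt.
  have [h|h] := Rlt_dec (k t) d1.
    have := inc t (k t) ltac:(lra) (conj bt h); lra.
  have := hm (k t) ltac:(lra); have := close (k t) ltac:(lra) => /Rabs_def2; lra.
have up : k t < b + r.
  apply: Rnot_le_lt => hle.
  have : Gam t 0 <= Gam t (b + r).
    have [e1|l1] : k t = b + r \/ b + r < k t by lra.
      by rewrite -e1 et; lra.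
    have := ht' (b + r) ltac:(lra); rewrite -/(Gam t (b + r)) -G0; lra.
  have := close (b + r) ltac:(lra) => /Rabs_def2; lra.
rewrite -/b; apply: Rabs_def1; lra.
Qed.

Lemma return_derivative :
  let B1 := P1 t0 + k t0 * E1 t0 in let B2 := P2 t0 + k t0 * E2 t0 in
  let p := dx psi B1 B2 * (dP1 t0 + k t0 * dE1 t0) + dy psi B1 B2 * (dP2 t0 + k t0 * dE2 t0) in
  let g := dx psi (P1 t0) (P2 t0) * dP1 t0 + dy psi (P1 t0) (P2 t0) * dP2 t0 in
  let q := dx psi B1 B2 * E1 t0 + dy psi B1 B2 * E2 t0 in
  is_derive k t0 ((g - p) / q).
Proof.
move=> B1 B2 p g q.
have ret0 := ret t0 ltac:(rewrite Rminus_diag Rabs_R0; lra).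
have q0 : q < 0.
  exact: (return_transversal psi f X c X0 C3 fc eqn box fc0 crit _ _ _ _ _ level ret0 slope).
apply: (implicit_derivative Gam k (fun t => psi (P1 t) (P2 t))).
- apply: (differentiable_pt_lim_comp psi (fun t s => P1 t + s * E1 t) (fun t s => P2 t + s * E2 t)).
  + apply: strict_diff_diff; exact: C1_strict_diff.
  + exact: differentiable_ray.
  + exact: differentiable_ray.
- exact: C1_comp.
- lra.
- exact: return_continuous.
- by exists d; split=> // t ht; case: (ret t ht).
Qed.

End ReturnCurve.

(** * Level circles *)

(** The clause on the interior excludes a second such circle that touches this one from inside or
    outside; see [circle_ratio]. *)
Definition level_circle (psi : R -> R -> R) (c C1 C2 r : R) : Prop :=
  0 < r /\ exists h mu, [/\ c < h, mu < 0,
    forall x y, (x - C1) ^ 2 + (y - C2) ^ 2 = r ^ 2 ->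
      [/\ psi x y = h, dx psi x y = mu * (x - C1) & dy psi x y = mu * (y - C2)]
  & forall x y, (x - C1) ^ 2 + (y - C2) ^ 2 < r ^ 2 -> h < psi x y].

Lemma sumsq_pos a b : a <> 0 \/ b <> 0 -> 0 < a ^ 2 + b ^ 2.
Proof.
have ha := pow2_ge_0 a; have hb := pow2_ge_0 b.
by case=> h; [have := pow2_gt_0 a h | have := pow2_gt_0 b h]; lra.
Qed.

Section Circle.
Variables (psi : R -> R -> R) (f : R -> R) (X c : R).
Hypotheses (X0 : 0 < X) (C3 : Ck 3 psi) (fc : forall r, continuous f r)
  (eqn : forall x y, lap psi x y + f (psi x y) = 0) (box : const_off_box X c psi)
  (fc0 : f c = 0) (crit : forall x y, psi x y = c -> dx psi x y = 0 /\ dy psi x y = 0).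

Definition ret_time (A1 A2 E1 E2 : R) : R :=
  epsilon (inhabits 0) (first_return psi A1 A2 E1 E2).

Lemma ret_timeP A1 A2 E1 E2 : c < psi A1 A2 ->
  0 < dx psi A1 A2 * E1 + dy psi A1 A2 * E2 ->
  first_return psi A1 A2 E1 E2 (ret_time A1 A2 E1 E2).
Proof. move=> h1 h2; apply: epsilon_spec; exact: (return_exists psi X c X0 C3 box). Qed.

Definition active (x y : R) : Prop := c < psi x y /\ 0 < dx psi x y ^ 2 + dy psi x y ^ 2.

Section Point.
Variables (A1 A2 : R).
Hypothesis act : active A1 A2.
Let n1 := dx psi A1 A2.
Let n2 := dy psi A1 A2.
Let lam t := ret_time A1 A2 (n1 - t * n2) (n2 + t * n1).

Let slope t : n1 * (n1 - t * n2) + n2 * (n2 + t * n1) = n1 ^ 2 + n2 ^ 2.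
Proof. ring. Qed.

Lemma ray_return t : first_return psi A1 A2 (n1 - t * n2) (n2 + t * n1) (lam t).
Proof. case: act => h1 h2; apply: ret_timeP => //; by rewrite -/n1 -/n2 slope. Qed.

(** This is the mirror image [n - 2 E / (1 + t^2)] of [n] in the bisector of the chord, where [E] is
    [n] plus [t] times its normal. *)
Lemma ray_gradient t :
  let B1 := A1 + lam t * (n1 - t * n2) in let B2 := A2 + lam t * (n2 + t * n1) in
  dx psi B1 B2 = ((t ^ 2 - 1) * n1 + 2 * t * n2) / (1 + t ^ 2) /\
  dy psi B1 B2 = ((t ^ 2 - 1) * n2 - 2 * t * n1) / (1 + t ^ 2).
Proof.
case: act => h1 h2 B1 B2.
have := return_law psi f X c X0 C3 fc eqn box fc0 crit A1 A2 _ _ _ h1 (ray_return t).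
rewrite -/B1 -/B2 /= -/n1 -/n2 slope => /(_ h2).
set x := dx psi B1 B2; set y := dy psi B1 B2.
rewrite -/n1 -/n2 in h2.
have t2 : 0 < 1 + t ^ 2 by have := pow2_ge_0 t; lra.
move=> [e1 e2]; set N := n1 ^ 2 + n2 ^ 2 in h2 e1.
have ex : (1 + t ^ 2) * N * x = N * ((t ^ 2 - 1) * n1 + 2 * t * n2).
  transitivity ((x * (n1 - t * n2) + y * (n2 + t * n1)) * (n1 - t * n2) -
    (- x * (n2 + t * n1) + y * (n1 - t * n2)) * (n2 + t * n1)); first by rewrite /N; ring.
  rewrite e1 e2 /N; ring.
have ey : (1 + t ^ 2) * N * y = N * ((t ^ 2 - 1) * n2 - 2 * t * n1).
  transitivity ((x * (n1 - t * n2) + y * (n2 + t * n1)) * (n2 + t * n1) +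
    (- x * (n2 + t * n1) + y * (n1 - t * n2)) * (n1 - t * n2)); first by rewrite /N; ring.
  rewrite e1 e2 /N; ring.
have Nt : (1 + t ^ 2) * N <> 0 by apply: Rmult_integral_contrapositive; lra.
split; apply: (Rmult_eq_reg_l ((1 + t ^ 2) * N)) => //.
  by rewrite ex; field; lra.
by rewrite ey; field; lra.
Qed.

Lemma ray_time_derivative t : is_derive lam t (- 2 * t * lam t / (1 + t ^ 2)).
Proof.
case: act => h1 h2; rewrite -/n1 -/n2 in h2.
have := return_derivative psi f X c X0 C3 fc eqn box fc0 crit
  (fun _ => A1) (fun _ => A2) (fun t => n1 - t * n2) (fun t => n2 + t * n1)
  (fun _ => 0) (fun _ => 0) (fun _ => - n2) (fun _ => n1) lam t 1
  (fun _ => is_derive_const _ _) (fun _ => is_derive_const _ _).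
move=> /(_ ltac:(by move=> s; auto_derive => //; ring) ltac:(by move=> s; auto_derive => //; ring) h1).
rewrite -/n1 -/n2 slope => /(_ h2 Rlt_0_1 (fun s _ => ray_return s)) /=.
have [-> ->] := ray_gradient t.
have t2 : 0 < 1 + t ^ 2 by have := pow2_ge_0 t; lra.
rewrite /= in t2.
match goal with |- is_derive _ _ ?a -> is_derive _ _ ?b => have -> : a = b; last by [] end.
rewrite /=; field; split; first lra.
have -> : ((t * t - 1) * n1 + 2 * t * n2) * (n1 - t * n2) + ((t * t - 1) * n2 - 2 * t * n1) * (n2 + t * n1)
  = - ((1 + t * (t * 1)) * (n1 ^ 2 + n2 ^ 2)) by ring.
apply: Rlt_not_eq; have := Rmult_lt_0_compat _ _ t2 h2; lra.
Qed.

(** With [t] the tangent of the angle between chord and gradient, the chord has length [lam 0 |n|]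
    times the cosine of this angle: the polar equation of a circle through [A] with diameter
    [lam 0 |n|]. *)
Lemma ray_time_eq t : lam t = lam 0 / (1 + t ^ 2).
Proof.
have t2 s : 0 < 1 + s ^ 2 by have := pow2_ge_0 s; lra.
have d s : is_derive (fun s => lam s * (1 + s ^ 2)) s 0.
  have -> : 0 = (- 2 * s * lam s / (1 + s ^ 2)) * (1 + s ^ 2) + lam s * (2 * s).
    by have := t2 s => h; field; lra.
  apply: is_derive_mult; [exact: ray_time_derivative | by auto_derive => //; ring | by move=> *; apply: Rmult_comm].
have [r [_ e]] := mvt _ _ 0 t d.
have -> : lam t = lam t * (1 + t ^ 2) / (1 + t ^ 2) by have := t2 t => h; field; lra.
congr Rdiv; move: e; rewrite /=; lra.
Qed.

Let kap := lam 0.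

Lemma normal_time_pos : 0 < kap.
Proof. by case: (ray_return 0). Qed.

(** The tangent at [A] meets the disk only in [A], so every other point lies on one of the rays. The
    last equation is the power of the point with respect to the circle, as the product of its signed
    distances to the two intersections with the ray. *)
Lemma disk_param x y : (x - (A1 + kap / 2 * n1)) ^ 2 + (y - (A2 + kap / 2 * n2)) ^ 2
    <= (kap / 2) ^ 2 * (n1 ^ 2 + n2 ^ 2) -> (x = A1 /\ y = A2) \/
  exists s t, [/\ 0 < s, x = A1 + s * (n1 - t * n2), y = A2 + s * (n2 + t * n1) &
    (x - (A1 + kap / 2 * n1)) ^ 2 + (y - (A2 + kap / 2 * n2)) ^ 2 =
    (kap / 2) ^ 2 * (n1 ^ 2 + n2 ^ 2) + (n1 ^ 2 + n2 ^ 2) * s * (1 + t ^ 2) * (s - lam t)].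
Proof.
case: act => _ h2; rewrite -/n1 -/n2 in h2; set N := n1 ^ 2 + n2 ^ 2 in h2 *.
move=> h.
set p := ((x - A1) * n1 + (y - A2) * n2) / N.
set q := ((y - A2) * n1 - (x - A1) * n2) / N.
have ex : x = A1 + (p * n1 - q * n2) by rewrite /p /q /N; field; rewrite /N in h2; lra.
have ey : y = A2 + (p * n2 + q * n1) by rewrite /p /q /N; field; rewrite /N in h2; lra.
have e : (x - (A1 + kap / 2 * n1)) ^ 2 + (y - (A2 + kap / 2 * n2)) ^ 2 =
   (kap / 2) ^ 2 * N + N * (p ^ 2 + q ^ 2 - kap * p).
  by clearbody p q; rewrite ex ey /N; field.
have pq : p ^ 2 + q ^ 2 <= kap * p.
  apply: (Rmult_le_reg_l N) => //; rewrite e in h; lra.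
have kp := normal_time_pos; have p2 := pow2_ge_0 p; have q2 := pow2_ge_0 q.
have p0 : 0 <= p by apply: (Rmult_le_reg_l kap) => //; lra.
have [z|pp] : p = 0 \/ 0 < p by lra.
  left; have q0 : q = 0 by rewrite z in pq; nra.
  by rewrite z q0 in ex ey; split; lra.
right; exists p, (q / p); split=> //.
- rewrite {1}ex; field; lra.
- rewrite {1}ey; field; lra.
rewrite e ray_time_eq -/kap /=; field.
by have := pow2_ge_0 q; rewrite /=; nra.
Qed.

Lemma circle_at : level_circle psi c (A1 + kap / 2 * n1) (A2 + kap / 2 * n2)
  (kap / 2 * sqrt (n1 ^ 2 + n2 ^ 2)).
Proof.
case: act => h1 h2; rewrite -/n1 -/n2 in h2.
have kp := normal_time_pos.
have e : (kap / 2 * sqrt (n1 ^ 2 + n2 ^ 2)) ^ 2 = (kap / 2) ^ 2 * (n1 ^ 2 + n2 ^ 2).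
  rewrite Rpow_mult_distr -Rsqr_pow2 -Rsqr_pow2 Rsqr_sqrt //; lra.
split; first by apply: Rmult_lt_0_compat; [lra | exact: sqrt_lt_R0].
(* At [A] the radius vector is [- kap / 2] times the gradient, which determines the factor. *)
exists (psi A1 A2), (- 2 / kap).
have t2 s : 0 < 1 + s ^ 2 by have := pow2_ge_0 s; lra.
split=> //.
- have -> : - 2 / kap = - (2 / kap) by field; lra.
  have := Rdiv_lt_0_compat 2 kap ltac:(lra) kp; lra.
- move=> x y; rewrite e => h.
  have [[-> ->]|[s [t [s0 ex ey exy]]]] := disk_param x y ltac:(lra).
    by split=> //; rewrite -/n1 -/n2; field; lra.
  have st : s = lam t.
    rewrite h in exy.
    have : (n1 ^ 2 + n2 ^ 2) * s * (1 + t ^ 2) * (s - lam t) = 0 by lra.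
    case/Rmult_integral => // z; last lra.
    have : 0 < (n1 ^ 2 + n2 ^ 2) * s * (1 + t ^ 2).
      by apply: Rmult_lt_0_compat => //; exact: Rmult_lt_0_compat.
    lra.
  have [_ eb _] := ray_return t; have [g1 g2] := ray_gradient t.
  rewrite -st -ex -ey in eb g1 g2.
  split=> //; rewrite ?g1 ?g2 ?ex ?ey st ray_time_eq -/kap; have := t2 t; rewrite /= => ht2; field; lra.
- move=> x y; rewrite e => h.
  have [[ex ey]|[s [t [s0 ex ey exy]]]] := disk_param x y ltac:(lra).
    move: h; rewrite ex ey.
    have -> : (A1 - (A1 + kap / 2 * n1)) ^ 2 + (A2 - (A2 + kap / 2 * n2)) ^ 2 = (kap / 2) ^ 2 * (n1 ^ 2 + n2 ^ 2) by ring.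
    lra.
  have [_ _ hin] := ray_return t; rewrite ex ey; apply: hin; split=> //.
  apply: Rnot_le_lt => hle.
  have : 0 <= (n1 ^ 2 + n2 ^ 2) * s * (1 + t ^ 2) * (s - lam t).
    apply: Rmult_le_pos; last lra.
    apply: Rmult_le_pos; last by have := t2 t; lra.
    apply: Rmult_le_pos; lra.
  lra.
Qed.

End Point.

(* The zero terms make this the first return along the ray with parameter t = 0. *)
Definition gradient_return (x y : R) : R := ret_time x y (dx psi x y - 0 * dy psi x y) (dy psi x y + 0 * dx psi x y).
Definition center1 (x y : R) : R := x + gradient_return x y / 2 * dx psi x y.
Definition center2 (x y : R) : R := y + gradient_return x y / 2 * dy psi x y.

Lemma active_circle x y : active x y ->
  exists r, level_circle psi c (center1 x y) (center2 x y) r /\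
    (x - center1 x y) ^ 2 + (y - center2 x y) ^ 2 = r ^ 2.
Proof.
move=> h; have := circle_at x y h; set r := _ * sqrt _ => hr.
exists r; split=> //.
rewrite /r Rpow_mult_distr -[sqrt _ ^ 2]Rsqr_pow2 Rsqr_sqrt; last by case: h; lra.
rewrite /center1 /center2 /gradient_return; ring.
Qed.

(** Both radii point along the gradient at the common point, so [k] is the ratio of the two factors
    and positive. If [k < 1], the antipode [2 D - x] on the second circle is inside of the first
    one, where [psi] exceeds the common level. *)
Lemma circle_ratio C1 C2 r D1 D2 s x y : level_circle psi c C1 C2 r -> level_circle psi c D1 D2 s ->
  (x - C1) ^ 2 + (y - C2) ^ 2 = r ^ 2 -> (x - D1) ^ 2 + (y - D2) ^ 2 = s ^ 2 ->
  exists k, [/\ 1 <= k, D1 - x = k * (C1 - x) & D2 - y = k * (C2 - y)].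
Proof.
move=> [r0 [h [mu [hc hmu on ins]]]] [s0 [h' [mu' [hc' hmu' on' ins']]]] zr zs.
have [e1 e2 e3] := on x y zr; have [e1' e2' e3'] := on' x y zs.
exists (mu / mu').
have ka : D1 - x = mu / mu' * (C1 - x).
  by apply: (Rmult_eq_reg_l mu'); [field_simplify; lra | lra].
have kb : D2 - y = mu / mu' * (C2 - y).
  by apply: (Rmult_eq_reg_l mu'); [field_simplify; lra | lra].
split=> //; apply: Rnot_lt_le => hk.
set k := mu / mu' in ka kb hk.
have kp : 0 < k.
  rewrite /k; have -> : mu / mu' = (- mu) / (- mu') by field; lra.
  by apply: Rdiv_lt_0_compat; lra.
have z' : (2 * D1 - x - D1) ^ 2 + (2 * D2 - y - D2) ^ 2 = s ^ 2 by rewrite -zs; ring.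
have [v _ _] := on' _ _ z'.
have := ins (2 * D1 - x) (2 * D2 - y).
have -> : (2 * D1 - x - C1) ^ 2 + (2 * D2 - y - C2) ^ 2 = (2 * k - 1) ^ 2 * r ^ 2.
  have -> : 2 * D1 - x - C1 = 2 * (D1 - x) - (C1 - x) by ring.
  have -> : 2 * D2 - y - C2 = 2 * (D2 - y) - (C2 - y) by ring.
  rewrite ka kb -zr; ring.
have r2 := pow_lt r 2 r0.
have : (2 * k - 1) ^ 2 < 1 by nra.
move=> k2 /(_ ltac:(nra)); lra.
Qed.

Lemma circle_unique C1 C2 r D1 D2 s x y : level_circle psi c C1 C2 r -> level_circle psi c D1 D2 s ->
  (x - C1) ^ 2 + (y - C2) ^ 2 = r ^ 2 -> (x - D1) ^ 2 + (y - D2) ^ 2 = s ^ 2 ->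
  [/\ C1 = D1, C2 = D2 & r = s].
Proof.
move=> hr hs zr zs.
  have [k [k1 ka kb]] := circle_ratio _ _ _ _ _ _ _ _ hr hs zr zs.
  have [m [m1 ma mb]] := circle_ratio _ _ _ _ _ _ _ _ hs hr zs zr.
  have [r0 _] := hr; have [s0 _] := hs.
  have r2 := pow_lt r 2 r0.
  have km : (k * m - 1) * r ^ 2 = 0.
    rewrite -zr.
    have -> : (k * m - 1) * ((x - C1) ^ 2 + (y - C2) ^ 2) =
      (m * (k * (C1 - x)) - (C1 - x)) * (C1 - x) + (m * (k * (C2 - y)) - (C2 - y)) * (C2 - y) by ring.
    rewrite -ka -kb -ma -mb; ring.
  have {}km : k * m = 1 by case/Rmult_integral: km; lra.
  have ek : k = 1 by nra.
  rewrite ek in ka kb.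
  have e1 : C1 = D1 by lra. have e2 : C2 = D2 by lra.
  split=> //; rewrite e1 e2 zs in zr; nra.
Qed.

Lemma circle_active C1 C2 r x y : level_circle psi c C1 C2 r -> (x - C1) ^ 2 + (y - C2) ^ 2 = r ^ 2 ->
  active x y.
Proof.
move=> [r0 [h [mu [hc hmu on _]]]] z; have [e1 e2 e3] := on x y z.
split; first lra.
rewrite e2 e3; have -> : (mu * (x - C1)) ^ 2 + (mu * (y - C2)) ^ 2 = mu ^ 2 * r ^ 2 by rewrite -z; ring.
by apply: Rmult_lt_0_compat; [apply: pow2_gt_0; lra | apply: pow_lt].
Qed.

End Circle.

(** * Centers are locally constant *)

Section Center.
Variables (psi : R -> R -> R) (f : R -> R) (X c : R).
Hypotheses (X0 : 0 < X) (C3 : Ck 3 psi) (fc : forall r, continuous f r)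
  (eqn : forall x y, lap psi x y + f (psi x y) = 0) (box : const_off_box X c psi)
  (fc0 : f c = 0) (crit : forall x y, psi x y = c -> dx psi x y = 0 /\ dy psi x y = 0).

Let Cx' : Ck 1 (dx psi) := Ck_pred 1 _ (Ck_dx 2 _ C3).
Let Cy' : Ck 1 (dy psi) := Ck_pred 1 _ (Ck_dy 2 _ C3).
Let dxpy x y : dx (dy psi) x y = dy (dx psi) x y := C2_schwarz psi x y (Ck_pred 2 _ C3).

Lemma active_open x y : active psi c x y -> exists d, 0 < d /\ forall x' y',
  Rabs (x' - x) < d -> Rabs (y' - y) < d -> active psi c x' y'.
Proof.
move=> [h1 h2].
have cN : cont2 (fun x y => dx psi x y ^ 2 + dy psi x y ^ 2).
  apply: cont2_plus; apply: cont2_pow2; [exact: Ck_cont2 Cx' | exact: Ck_cont2 Cy'].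
have [d1 [d10 k1]] := cont2_eps psi (Ck_cont2 3 _ C3) x y (psi x y - c) ltac:(lra).
have [d2 [d20 k2]] := cont2_eps _ cN x y _ h2.
have m1 := Rmin_l d1 d2; have m2 := Rmin_r d1 d2.
exists (Rmin d1 d2); split; first exact: Rmin_glb_lt.
move=> x' y' hx hy; split.
  have := k1 x' y' ltac:(lra) ltac:(lra) => /Rabs_def2; lra.
have := k2 x' y' ltac:(lra) ltac:(lra) => /Rabs_def2; lra.
Qed.

Lemma gradient_returnP x y : active psi c x y ->
  first_return psi x y (dx psi x y) (dy psi x y) (gradient_return psi x y).
Proof.
move=> h; have := ray_return psi X c X0 C3 box x y h 0.
rewrite /gradient_return; set k := ret_time _ _ _ _ _.
by rewrite !Rmult_0_l Rminus_0_r Rplus_0_r.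
Qed.

(** Differentiating [grad psi = mu (z - C)] along the circle shows that the tangent is an
    eigenvector of the Hessian with eigenvalue [mu]. *)
Lemma hessian_tangent x y : active psi c x y ->
  exists mu, [/\ mu * gradient_return psi x y = - 2,
    - dx (dx psi) x y * dy psi x y + dy (dx psi) x y * dx psi x y = - mu * dy psi x y &
    - dy (dx psi) x y * dy psi x y + dy (dy psi) x y * dx psi x y = mu * dx psi x y].
Proof.
move=> act.
have [r [[r0 [h [mu [hc hmu on _]]]] hr]] := active_circle psi f X c X0 C3 fc eqn box fc0 crit x y act.
set C1 := center1 psi x y in on hr; set C2 := center2 psi x y in on hr.
set k := gradient_return psi x y.
have [kp _ _] := gradient_returnP x y act; rewrite -/k in kp.
set n1 := dx psi x y; set n2 := dy psi x y.
have N0 : 0 < n1 ^ 2 + n2 ^ 2 by case: act.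
have ea : x - C1 = - (k / 2) * n1 by rewrite /C1 /center1 -/k -/n1; ring.
have eb : y - C2 = - (k / 2) * n2 by rewrite /C2 /center2 -/k -/n2; ring.
set a := x - C1 in ea hr; set b := y - C2 in eb hr.
have [_ g1 g2] := on x y hr; rewrite -/a -/n1 in g1; rewrite -/b -/n2 in g2.
have mk : mu * k = - 2.
  have z : (mu * k + 2) * (n1 ^ 2 + n2 ^ 2) = 0.
    have z1 : (mu * k + 2) * n1 = 0 by rewrite ea in g1; lra.
    have z2 : (mu * k + 2) * n2 = 0 by rewrite eb in g2; lra.
    have -> : (mu * k + 2) * (n1 ^ 2 + n2 ^ 2) = ((mu * k + 2) * n1) * n1 + ((mu * k + 2) * n2) * n2 by ring.
    rewrite z1 z2; ring.
  by case/Rmult_integral: z; lra.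
set Z1 := fun t => C1 + (cos t * a - sin t * b); set Z2 := fun t => C2 + (cos t * b + sin t * a).
have onZ t : (Z1 t - C1) ^ 2 + (Z2 t - C2) ^ 2 = r ^ 2.
  rewrite -hr /Z1 /Z2.
  transitivity ((Rsqr (sin t) + Rsqr (cos t)) * (a ^ 2 + b ^ 2)); first by rewrite /Rsqr; ring.
  rewrite sin2_cos2; ring.
have Z10 : Z1 0 = x by rewrite /Z1 cos_0 sin_0 /a; ring.
have Z20 : Z2 0 = y by rewrite /Z2 cos_0 sin_0 /b; ring.
have dZ1 : is_derive Z1 0 (- b).
  by rewrite /Z1; auto_derive => //; rewrite cos_0 sin_0; ring.
have dZ2 : is_derive Z2 0 a.
  by rewrite /Z2; auto_derive => //; rewrite cos_0 sin_0; ring.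
have tang u (w : R -> R) (dw : R) : Ck 1 u -> (forall t, u (Z1 t) (Z2 t) = mu * w t) -> is_derive w 0 dw ->
   dx u x y * (- b) + dy u x y * a = mu * dw.
  move=> hu e hw.
  have := C1_comp u Z1 Z2 0 _ _ hu dZ1 dZ2; rewrite Z10 Z20 => /is_derive_unique <-.
  have : is_derive (fun t => u (Z1 t) (Z2 t)) 0 (mu * dw).
    apply: (is_derive_extR (fun t => mu * w t)); first by move=> t; rewrite e.
    exact: is_derive_scal.
  by move/is_derive_unique.
have t1 := tang (dx psi) (fun t => cos t * a - sin t * b) (- b) Cx'.
have t2 := tang (dy psi) (fun t => cos t * b + sin t * a) a Cy'.
have {}t1 : dx (dx psi) x y * (- b) + dy (dx psi) x y * a = mu * (- b).
  apply: t1.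
    by move=> t; have [_ -> _] := on _ _ (onZ t); rewrite /Z1; ring.
  by auto_derive => //; rewrite cos_0 sin_0; ring.
have {}t2 : dy (dx psi) x y * (- b) + dy (dy psi) x y * a = mu * a.
  rewrite -dxpy; apply: t2.
    by move=> t; have [_ _ ->] := on _ _ (onZ t); rewrite /Z2; ring.
  by auto_derive => //; rewrite cos_0 sin_0; ring.
exists mu; split=> //; apply: (Rmult_eq_reg_l (k / 2)); try lra.
  rewrite eb ea in t1; lra.
rewrite eb ea in t2; lra.
Qed.

(** The center is the point plus half the return time times the gradient. The component of its
    derivative along the gradient vanishes by the formula for the derivative of the return time, as
    the gradient at the opposite point is minus the given one. The tangential component contains the
    factor [2 + mu k] by [hessian_tangent], and this is 0. *)
Lemma center_derivative x y v w t : active psi c (x + t * v) (y + t * w) ->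
  is_derive (fun t => center1 psi (x + t * v) (y + t * w)) t 0 /\
  is_derive (fun t => center2 psi (x + t * v) (y + t * w)) t 0.
Proof.
move=> act.
set P1 := fun t => x + t * v; set P2 := fun t => y + t * w.
set k := fun t => gradient_return psi (P1 t) (P2 t).
set E1 := fun t => dx psi (P1 t) (P2 t); set E2 := fun t => dy psi (P1 t) (P2 t).
set hxx := fun t => dx (dx psi) (P1 t) (P2 t); set hxy := fun t => dy (dx psi) (P1 t) (P2 t).
set hyy := fun t => dy (dy psi) (P1 t) (P2 t).
have dP1 s : is_derive P1 s v by rewrite /P1; auto_derive => //; ring.
have dP2 s : is_derive P2 s w by rewrite /P2; auto_derive => //; ring.
have dE1 s : is_derive E1 s (hxx s * v + hxy s * w) := C1_line (dx psi) x y v w s Cx'.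
have dE2 s : is_derive E2 s (hxy s * v + hyy s * w).
  have := C1_line (dy psi) x y v w s Cy'; rewrite dxpy; exact.
have [d [d0 hd]] := active_open _ _ act.
have [dl [dl0 near]] : exists dl, 0 < dl /\ forall s, Rabs (s - t) < dl -> active psi c (P1 s) (P2 s).
  exists (d / (1 + Rabs v + Rabs w)).
  have v0 := Rabs_pos v; have w0 := Rabs_pos w.
  have q0 : 0 < 1 + Rabs v + Rabs w by lra.
  split; first exact: Rdiv_lt_0_compat.
  move=> s hs.
  have hs' : Rabs (s - t) * (1 + Rabs v + Rabs w) < d.
    have -> : d = d / (1 + Rabs v + Rabs w) * (1 + Rabs v + Rabs w) by field; lra.
    exact: Rmult_lt_compat_r.
  have s0 := Rabs_pos (s - t).
  have p1 : 0 <= Rabs (s - t) * Rabs v by apply: Rmult_le_pos.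
  have p2 : 0 <= Rabs (s - t) * Rabs w by apply: Rmult_le_pos.
  apply: hd; rewrite /P1 /P2.
    have -> : x + s * v - (x + t * v) = (s - t) * v by ring.
    rewrite Rabs_mult; lra.
  have -> : y + s * w - (y + t * w) = (s - t) * w by ring.
  rewrite Rabs_mult; lra.
have ret s : Rabs (s - t) < dl -> first_return psi (P1 s) (P2 s) (E1 s) (E2 s) (k s).
  by move=> /near h; exact: gradient_returnP.
case: (act) => hc hN; rewrite -/(P1 t) -/(P2 t) -/(E1 t) -/(E2 t) in hc hN.
have slope : 0 < E1 t * E1 t + E2 t * E2 t by lra.
have rt := ret t ltac:(rewrite Rminus_diag Rabs_R0; lra).
have := return_derivative psi f X c X0 C3 fc eqn box fc0 crit P1 P2 E1 E2 (fun _ => v) (fun _ => w)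
  _ _ k t dl dP1 dP2 dE1 dE2 hc slope dl0 ret.
have [l1 l2] := return_law psi f X c X0 C3 fc eqn box fc0 crit _ _ _ _ _ hc rt slope.
move: l1 l2; rewrite /=.
set B1 := P1 t + k t * E1 t; set B2 := P2 t + k t * E2 t.
rewrite -/(E1 t) -/(E2 t).
set u1 := dx psi B1 B2; set u2 := dy psi B1 B2 => l1 l2.
have eu1 : u1 = - E1 t.
  apply: (Rmult_eq_reg_r (E1 t * E1 t + E2 t * E2 t)); last lra.
  transitivity ((u1 * E1 t + u2 * E2 t) * E1 t - (- u1 * E2 t + u2 * E1 t) * E2 t); first ring.
  rewrite l1 l2; ring.
have eu2 : u2 = - E2 t.
  apply: (Rmult_eq_reg_r (E1 t * E1 t + E2 t * E2 t)); last lra.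
  transitivity ((u1 * E1 t + u2 * E2 t) * E2 t + (- u1 * E2 t + u2 * E1 t) * E1 t); first ring.
  rewrite l1 l2; ring.
rewrite eu1 eu2 => dk.
have [mu [mk t1 t2]] := hessian_tangent _ _ act.
rewrite -/(P1 t) -/(P2 t) -/(k t) -/(E1 t) -/(E2 t) -/(hxx t) -/(hxy t) -/(hyy t) in mk t1 t2.
set k' := ((E1 t * v + E2 t * w - _) / _) in dk.
have ek : k' * (E1 t * E1 t + E2 t * E2 t) = - (2 * (E1 t * v + E2 t * w) +
   k t * (E1 t * (hxx t * v + hxy t * w) + E2 t * (hxy t * v + hyy t * w))).
  by rewrite /k'; field; lra.
set N := E1 t * E1 t + E2 t * E2 t in slope ek.
have bracket : E2 t * (hxx t * v + hxy t * w) - E1 t * (hxy t * v + hyy t * w) = mu * (v * E2 t - w * E1 t).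
  transitivity (- v * (- hxx t * E2 t + hxy t * E1 t) - w * (- hxy t * E2 t + hyy t * E1 t)); first ring.
  rewrite t1 t2; ring.
have z1 : v + (k' / 2 * E1 t + k t / 2 * (hxx t * v + hxy t * w)) = 0.
  apply: (Rmult_eq_reg_r (2 * N)); last lra.
  transitivity (2 * N * v + E1 t * (k' * N) + k t * N * (hxx t * v + hxy t * w)); first by field.
  rewrite ek.
  transitivity (2 * E2 t * (v * E2 t - w * E1 t) + k t * E2 t *
    (E2 t * (hxx t * v + hxy t * w) - E1 t * (hxy t * v + hyy t * w))); first by rewrite /N; ring.
  rewrite bracket.
  transitivity ((2 + mu * k t) * (E2 t * (v * E2 t - w * E1 t))); first ring.
  rewrite mk; ring.
have z2 : w + (k' / 2 * E2 t + k t / 2 * (hxy t * v + hyy t * w)) = 0.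
  apply: (Rmult_eq_reg_r (2 * N)); last lra.
  transitivity (2 * N * w + E2 t * (k' * N) + k t * N * (hxy t * v + hyy t * w)); first by field.
  rewrite ek.
  transitivity (- 2 * E1 t * (v * E2 t - w * E1 t) - k t * E1 t *
    (E2 t * (hxx t * v + hxy t * w) - E1 t * (hxy t * v + hyy t * w))); first by rewrite /N; ring.
  rewrite bracket.
  transitivity (- (2 + mu * k t) * (E1 t * (v * E2 t - w * E1 t))); first ring.
  rewrite mk; ring.
have half : is_derive (fun s => k s / 2) t (k' / 2).
  apply: (is_derive_extR (fun s => / 2 * k s)); first by move=> s; rewrite /Rdiv Rmult_comm.
  by rewrite /Rdiv (Rmult_comm k'); apply: is_derive_scal.
split.
  rewrite -z1; apply: (is_derive_plus P1 (fun s => k s / 2 * E1 s)) => //.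
  by apply: is_derive_mult => //; move=> *; apply: Rmult_comm.
rewrite -z2; apply: (is_derive_plus P2 (fun s => k s / 2 * E2 s)) => //.
by apply: is_derive_mult => //; move=> *; apply: Rmult_comm.
Qed.

Lemma center_locally_constant x y : active psi c x y -> exists d, 0 < d /\ forall x' y',
  Rabs (x' - x) < d -> Rabs (y' - y) < d ->
  [/\ active psi c x' y', center1 psi x' y' = center1 psi x y & center2 psi x' y' = center2 psi x y].
Proof.
move=> act; have [d [d0 hd]] := active_open x y act.
exists d; split=> // x' y' hx hy.
have seg t : Rmin 0 1 <= t <= Rmax 0 1 -> active psi c (x + t * (x' - x)) (y + t * (y' - y)).
  rewrite Rmin_left ?Rmax_right; try lra; move=> ht.
  have sc v : Rabs v < d -> Rabs (t * v) < d.
    move=> hv; rewrite Rabs_mult (Rabs_pos_eq t); last lra.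
    have := Rabs_pos v; nra.
  apply: hd.
    have -> : x + t * (x' - x) - x = t * (x' - x) by ring.
    exact: sc.
  have -> : y + t * (y' - y) - y = t * (y' - y) by ring.
  exact: sc.
have e1 : x + 1 * (x' - x) = x' by ring. have e2 : y + 1 * (y' - y) = y' by ring.
have e3 : x + 0 * (x' - x) = x by ring. have e4 : y + 0 * (y' - y) = y by ring.
have const (g : R -> R) : (forall t, Rmin 0 1 <= t <= Rmax 0 1 -> is_derive g t 0) -> g 1 = g 0.
  move=> hg; have [s [_ es]] := MVT_gen g 0 1 (fun _ => 0)
     (fun t ht => hg t (conj (Rlt_le _ _ (proj1 ht)) (Rlt_le _ _ (proj2 ht))))
     (fun t ht => derivable_continuous_pt g t (exist _ 0 (proj1 (is_derive_Reals g t 0) (hg t ht)))).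
  lra.
split; first exact: hd.
  have := const (fun t => center1 psi (x + t * (x' - x)) (y + t * (y' - y)))
     (fun t ht => proj1 (center_derivative _ _ _ _ _ (seg t ht))).
  by rewrite e1 e2 e3 e4.
have := const (fun t => center2 psi (x + t * (x' - x)) (y + t * (y' - y)))
     (fun t ht => proj2 (center_derivative _ _ _ _ _ (seg t ht))).
by rewrite e1 e2 e3 e4.
Qed.

(** Moving a point of the circle radially keeps its center, so the circle through the moved point is
    concentric with the given one. *)
Lemma circle_open C1 C2 r : level_circle psi c C1 C2 r -> exists e, 0 < e /\
  forall s, Rabs (s - r) < e -> level_circle psi c C1 C2 s.
Proof.
move=> hr; have [r0 _] := hr.
have on s : (C1 + s - C1) ^ 2 + (C2 - C2) ^ 2 = s ^ 2 by ring.
have act := circle_active psi c _ _ _ _ _ hr (on r).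
have [s [hs zs]] := active_circle psi f X c X0 C3 fc eqn box fc0 crit _ _ act.
have [e1 e2 _] := circle_unique psi c _ _ _ _ _ _ _ _ hr hs (on r) zs.
have [d [d0 hd]] := center_locally_constant _ _ act.
have m1 := Rmin_l d r; have m2 := Rmin_r d r.
exists (Rmin d r); split; first exact: Rmin_glb_lt.
move=> t ht.
have [at_ c1 c2] := hd (C1 + t) C2 ltac:((have -> : C1 + t - (C1 + r) = t - r by ring); lra)
  ltac:(rewrite Rminus_diag Rabs_R0; lra).
have [q [hq zq]] := active_circle psi f X c X0 C3 fc eqn box fc0 crit _ _ at_.
rewrite c1 c2 -e1 -e2 in hq zq.
have [q0 _] := hq; rewrite on in zq.
have t0 : 0 < t by move/Rabs_def2: ht; lra.
have -> : t = q by nra.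
exact: hq.
Qed.

End Center.

(** * Decomposition into annuli *)

Lemma least_nat (P : nat -> Prop) : (exists n, P n) ->
  exists n, P n /\ forall m, (m < n)%N -> ~ P m.
Proof.
move=> [n hn]; apply: NNPP => hno.
suff all_not : forall k m, (m <= k)%N -> ~ P m by exact: (all_not n n (leqnn n)).
elim=> [|k IH] m hm hP; apply: hno; exists m; split=> // j hj.
  by lia.
by apply: IH; lia.
Qed.

Lemma maximal_right_interval (Q : R -> Prop) r b : Q r ->
  (forall t, Q t -> exists e, 0 < e /\ forall s, Rabs (s - t) < e -> Q s) ->
  (forall t, Q t -> t <= b) ->
  exists r2, r < r2 /\ r2 <= b /\ forall s, r <= s -> ((forall t, r <= t <= s -> Q t) <-> s < r2).
Proof.
move=> Qr op bd.
pose S s := r <= s /\ forall t, r <= t <= s -> Q t.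
have Sr : S r by split; [lra | move=> t ht; have -> : t = r by lra].
have Sb s : S s -> s <= b by move=> [h1 h2]; apply: bd; apply: h2; lra.
have [l [ub lub]] := completeness S (ex_intro _ b Sb) (ex_intro _ r Sr).
have rl : r <= l by apply: ub.
have below s : r <= s < l -> forall t, r <= t <= s -> Q t.
  move=> hs t ht; apply: NNPP => hn; have : l <= s; last lra.
  apply: lub => x [hx px]; apply: Rnot_lt_le => h; apply: hn; apply: px; lra.
have notS : ~ S l.
  move=> [_ hl]; have [e [e0 he]] := op l (hl l ltac:(lra)).
  have : S (l + e / 2); last by move/ub; lra.
  split; first lra.
  move=> t ht; have [h|h] := Rle_dec t l; first by apply: hl; lra.
  apply: he; apply: Rabs_def1; lra.
have lr : r < l by (have [e|//] : l = r \/ r < l by lra); case: notS; rewrite e.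
exists l; split=> //; split; first by apply: lub.
move=> s hs; split; last by move=> h; apply: below; lra.
move=> h; have : s <= l by apply: ub.
case=> // e; by case: notS; rewrite -e.
Qed.

Lemma Rmin_Rmax_cases r s t : Rmin r s <= t <= Rmax r s <-> r <= t <= s \/ s <= t <= r.
Proof. rewrite /Rmin /Rmax; destruct Rle_dec; split; try (case; lra); lra. Qed.

(** Rational points as differences of naturals over a common positive denominator; [(0, 0)] is the
    value at numbers that encode nothing. *)
Definition rational_point (n : nat) : R * R :=
  match @unpickle (nat * nat * nat * nat * nat)%type n with
  | Some (a, b, a', b', m) =>
      ((INR a - INR b) / (INR m + 1), (INR a' - INR b') / (INR m + 1))
  | None => (0, 0)
  end.

Lemma rational_point_dense x y d : 0 < d -> exists n,
  Rabs (fst (rational_point n) - x) < d /\ Rabs (snd (rational_point n) - y) < d.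
Proof.
move=> hd.
have [m [m1 m2]] := nat_floor (/ d) ltac:(apply: Rlt_le; exact: Rinv_0_lt_compat).
have mp : 0 < INR m + 1 by have := pos_INR m; lra.
have md : / (INR m + 1) < d.
  apply: (Rmult_lt_reg_r (INR m + 1)) => //; rewrite Rinv_l; last lra.
  apply: (Rle_lt_trans _ (d * / d)); [rewrite Rinv_r; lra | exact: Rmult_lt_compat_l].
have app z : exists a b : nat, Rabs ((INR a - INR b) / (INR m + 1) - z) < d.
  have [a [a1 a2]] := nat_floor (Rmax (z * (INR m + 1)) 0) (Rmax_r _ _).
  have [b [b1 b2]] := nat_floor (Rmax (- z * (INR m + 1)) 0) (Rmax_r _ _).
  exists a, b; apply: Rle_lt_trans md.
  have -> : (INR a - INR b) / (INR m + 1) - z = (INR a - INR b - z * (INR m + 1)) * / (INR m + 1) by field; lra.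
  have ip : 0 < / (INR m + 1) by apply: Rinv_0_lt_compat.
  rewrite Rabs_scal_r; last lra.
  rewrite -[X in _ <= X]Rmult_1_l; apply: Rmult_le_compat_r; first lra.
  have a0 := pos_INR a; have b0 := pos_INR b.
  move: a1 a2 b1 b2; rewrite -Ropp_mult_distr_l /Rmax; do 2 destruct Rle_dec; move=> a1 a2 b1 b2;
    apply: Rabs_le_intro; lra.
have [a [b hab]] := app x; have [a' [b' hab']] := app y.
by exists (pickle (a, b, a', b', m)); rewrite /rational_point pickleK.
Qed.

Lemma dist2_lipschitz x y x' y' a b : Rabs (dist2 x y a b - dist2 x' y' a b) <= Rabs (x - x') + Rabs (y - y').
Proof.
suff key : forall x y x' y', dist2 x y a b <= dist2 x' y' a b + (Rabs (x - x') + Rabs (y - y')).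
  have h1 := key x y x' y'; have h2 := key x' y' x y.
  rewrite (Rabs_minus_sym x' x) (Rabs_minus_sym y' y) in h2.
  apply: Rabs_le_intro; lra.
move=> {}x {}y {}x' {}y'; rewrite /dist2.
have s0 := sqrt_pos ((x' - a) ^ 2 + (y' - b) ^ 2).
have p1 := Rabs_pos (x - x'); have p2 := Rabs_pos (y - y').
set S := sqrt ((x' - a) ^ 2 + (y' - b) ^ 2) in s0 *.
have SS : S * S = (x' - a) ^ 2 + (y' - b) ^ 2.
  apply: sqrt_sqrt; have := pow2_ge_0 (x' - a); have := pow2_ge_0 (y' - b); lra.
rewrite -[X in _ <= X]sqrt_Rsqr; last lra.
apply: sqrt_le_1_alt; rewrite /Rsqr.
have ab z : Rabs z <= S -> Rabs z <= S by [].
have aS : Rabs (x' - a) <= S.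
  rewrite -[X in X <= _]sqrt_Rsqr; last exact: Rabs_pos.
  rewrite -Rsqr_abs; apply: sqrt_le_1_alt; rewrite Rsqr_pow2; have := pow2_ge_0 (y' - b); lra.
have bS : Rabs (y' - b) <= S.
  rewrite -[X in X <= _]sqrt_Rsqr; last exact: Rabs_pos.
  rewrite -Rsqr_abs; apply: sqrt_le_1_alt; rewrite Rsqr_pow2; have := pow2_ge_0 (x' - a); lra.
have c1 : (x - x') * (x' - a) <= Rabs (x - x') * S.
  apply: (Rle_trans _ (Rabs ((x - x') * (x' - a)))); first exact: Rle_abs.
  by rewrite Rabs_mult; apply: Rmult_le_compat_l.
have c2 : (y - y') * (y' - b) <= Rabs (y - y') * S.
  apply: (Rle_trans _ (Rabs ((y - y') * (y' - b)))); first exact: Rle_abs.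
  by rewrite Rabs_mult; apply: Rmult_le_compat_l.
have q1 : Rabs (x - x') * Rabs (x - x') = (x - x') ^ 2 by rewrite -/(Rsqr _) -Rsqr_abs Rsqr_pow2.
have q2 : Rabs (y - y') * Rabs (y - y') = (y - y') ^ 2 by rewrite -/(Rsqr _) -Rsqr_abs Rsqr_pow2.
have pp : 0 <= Rabs (x - x') * Rabs (y - y') by apply: Rmult_le_pos.
lra.
Qed.

(** * A family of disjoint circles with open sets of radii fills countably many annuli *)

Section Assembly.
Variables (Dom : R -> R -> Prop) (Ring : R -> R -> R -> Prop) (X : R).
Hypothesis ring_pos : forall a b r, Ring a b r -> 0 < r.
Hypothesis ring_ex : forall x y, Dom x y -> exists a b r, Ring a b r /\ dist2 x y a b = r.
Hypothesis ring_uniq : forall a b r a' b' r' x y, Ring a b r -> Ring a' b' r' ->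
  dist2 x y a b = r -> dist2 x y a' b' = r' -> a = a' /\ b = b'.
Hypothesis ring_op : forall a b r, Ring a b r ->
  exists e, 0 < e /\ forall s, Rabs (s - r) < e -> Ring a b s.
Hypothesis ring_dom : forall a b r x y, Ring a b r -> dist2 x y a b = r -> Dom x y.
Hypothesis dom_bd : forall x y, Dom x y -> Rabs x <= X /\ Rabs y <= X.

(** The distance to [(a, b)] lies in the connected component of [r] in the set of admissible
    radii. *)
Definition annulus (a b r x y : R) : Prop :=
  forall s, Rmin r (dist2 x y a b) <= s <= Rmax r (dist2 x y a b) -> Ring a b s.

Lemma annulus_ring a b r x y : annulus a b r x y -> Ring a b (dist2 x y a b).
Proof. by apply; split; [exact: Rmin_r | exact: Rmax_r]. Qed.

Lemma ring_bounded a b r : Ring a b r -> r <= X.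
Proof.
move=> h; have r0 := ring_pos _ _ _ h.
have e s : s ^ 2 = r ^ 2 -> dist2 (a + s) b a b = r.
  move=> hs; rewrite /dist2.
  have -> : (a + s - a) ^ 2 + (b - b) ^ 2 = r ^ 2 by rewrite -hs; ring.
  by rewrite -Rsqr_pow2 sqrt_Rsqr; lra.
have [h1 _] := dom_bd _ _ (ring_dom _ _ _ _ _ h (e r erefl)).
have [h2 _] := dom_bd _ _ (ring_dom _ _ _ _ _ h (e (- r) ltac:(ring))).
move/Rabs_le_elim: h1 => h1; move/Rabs_le_elim: h2 => h2; lra.
Qed.

Lemma annulus_shape a b r : Ring a b r -> exists r1 r2, 0 <= r1 < r2 /\
  forall x y, annulus a b r x y <-> r1 < dist2 x y a b < r2.
Proof.
move=> h.
have [r2 [h1 [h2 up]]] := maximal_right_interval (Ring a b) r X h (ring_op a b) (ring_bounded a b).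
have op' t : Ring a b (- t) -> exists e, 0 < e /\ forall s, Rabs (s - t) < e -> Ring a b (- s).
  move=> /ring_op [e [e0 he]]; exists e; split=> // s hs; apply: he.
  have -> : - s - - t = - (s - t) by ring.
  by rewrite Rabs_Ropp.
have bd' t : Ring a b (- t) -> t <= 0 by move=> /ring_pos; lra.
have h' : Ring a b (- - r) by rewrite Ropp_involutive.
(* The inner radius is obtained from the result for right ends by changing the sign of the radius;
   the bound 0 stems from [ring_pos]. *)
have [r1 [g1 [g2 lo]]] := maximal_right_interval (fun t => Ring a b (- t)) (- r) 0 h' op' bd'.
exists (- r1), r2; split; first lra.
move=> x y; set d := dist2 x y a b.
split.
  move=> ha.
  have ha' t : (r <= t <= d \/ d <= t <= r) -> Ring a b t by move=> ht; apply: ha; apply/Rmin_Rmax_cases.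
  have [hd|hd] := Rle_dec r d.
    have : d < r2 by apply/(up d hd) => t ht; apply: ha'; left.
    lra.
  have : - d < r1; last lra.
  apply/(lo (- d)); first lra.
  move=> t ht; apply: ha'; lra.
move=> hd s; rewrite -/d => /Rmin_Rmax_cases [hs|hs].
  by apply: (proj2 (up d ltac:(lra)) (proj2 hd)).
have := proj2 (lo (- d) ltac:(lra)) ltac:(lra) (- s) ltac:(lra).
by rewrite Ropp_involutive.
Qed.

Definition ring_of (x y : R) : R * R * R :=
  epsilon (inhabits (0, 0, 0)) (fun p => Ring p.1.1 p.1.2 p.2 /\ dist2 x y p.1.1 p.1.2 = p.2).

Lemma ring_ofP x y : Dom x y ->
  Ring (ring_of x y).1.1 (ring_of x y).1.2 (ring_of x y).2 /\
  dist2 x y (ring_of x y).1.1 (ring_of x y).1.2 = (ring_of x y).2.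
Proof.
move=> /ring_ex [a [b [r h]]].
by apply: (epsilon_spec (inhabits (0, 0, 0)) (fun p : R * R * R => Ring p.1.1 p.1.2 p.2 /\ dist2 x y p.1.1 p.1.2 = p.2)); exists (a, b, r).
Qed.

Definition annulus_of (x y : R) : R -> R -> Prop :=
  annulus (ring_of x y).1.1 (ring_of x y).1.2 (ring_of x y).2.

Lemma annulus_of_self x y : Dom x y -> annulus_of x y x y.
Proof.
move=> /ring_ofP [h1 h2] s; rewrite h2 Rmin_left ?Rmax_left; try lra.
by move=> hs; have -> : s = (ring_of x y).2 by lra.
Qed.

Lemma annulus_of_dom x y u v : annulus_of x y u v -> Dom u v.
Proof. by move=> /annulus_ring h; apply: ring_dom h _. Qed.

(** Symmetry and transitivity at once: uniqueness of circles gives both annuli the same center, and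
    a radius between two of three numbers is between one of these two and the third. *)
Lemma annulus_of_trans x y u v w z : Dom x y -> annulus_of x y u v ->
  (annulus_of u v w z <-> annulus_of x y w z).
Proof.
move=> hd ha; have hd' := annulus_of_dom _ _ _ _ ha.
have [h1 h2] := ring_ofP x y hd; have [g1 g2] := ring_ofP u v hd'.
have [e1 e2] := ring_uniq _ _ _ _ _ _ _ _ (annulus_ring _ _ _ _ _ ha) g1 erefl g2.
move: ha; rewrite /annulus_of /annulus -e1 -e2 -g2 -e1 -e2.
set a := (ring_of x y).1.1; set b := (ring_of x y).1.2; set r := (ring_of x y).2.
move=> ha; split=> h s /Rmin_Rmax_cases hs.
  have [k|k] := classic (Rmin r (dist2 u v a b) <= s <= Rmax r (dist2 u v a b)); first exact: ha.
  apply: h; apply/Rmin_Rmax_cases; move: k; rewrite Rmin_Rmax_cases; lra.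
have [k|k] := classic (Rmin r (dist2 u v a b) <= s <= Rmax r (dist2 u v a b)); first exact: ha.
apply: h; apply/Rmin_Rmax_cases; move: k; rewrite Rmin_Rmax_cases; lra.
Qed.

Lemma annulus_of_rational x y : Dom x y -> exists n,
  annulus_of x y (rational_point n).1 (rational_point n).2.
Proof.
move=> hd; have [h _] := ring_ofP x y hd.
have [r1 [r2 [_ sh]]] := annulus_shape _ _ _ h.
have /sh hxy := annulus_of_self x y hd.
set t := dist2 x y _ _ in hxy.
have [e [e0 [l1 [l2 _]]]] := common_min [:: (t - r1) / 2; (r2 - t) / 2]
  ltac:(repeat split; lra).
have [n [n1 n2]] := rational_point_dense x y (e / 2) ltac:(lra).
exists n; apply/sh.
have := dist2_lipschitz (rational_point n).1 (rational_point n).2 x y (ring_of x y).1.1 (ring_of x y).1.2.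
move/Rabs_le_elim; rewrite -/t; lra.
Qed.

(* The index of an annulus is the first rational point that it contains. *)
Definition first_point (n : nat) : Prop :=
  let p := rational_point n in
  Dom p.1 p.2 /\ forall m, (m < n)%N ->
    ~ annulus_of p.1 p.2 (rational_point m).1 (rational_point m).2.

(** Lying in the same annulus is an equivalence relation with open classes. The least rational point
    of a class selects its representative, so that distinct indices give disjoint annuli. *)
Lemma annuli_decomposition :
  exists (I : Type) (A : I -> R -> R -> Prop) (ca cb : I -> R),
    countable_type I /\
    (forall i, annulus_or_disk (A i) (ca i) (cb i)) /\
    (forall i j, i <> j -> forall x y, ~ (A i x y /\ A j x y)) /\
    (forall x y, Dom x y <-> exists i, A i x y) /\
    (forall i x y, A i x y -> Ring (ca i) (cb i) (dist2 x y (ca i) (cb i))).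
Proof.
pose pt (i : {n | first_point n}) := rational_point (proj1_sig i).
have ptD i : Dom (pt i).1 (pt i).2 by case: i => n [].
exists {n | first_point n}, (fun i => annulus_of (pt i).1 (pt i).2),
  (fun i => (ring_of (pt i).1 (pt i).2).1.1), (fun i => (ring_of (pt i).1 (pt i).2).1.2).
split; [|split; [|split; [|split]]].
- exists (@proj1_sig _ _) => -[n hn] [m hm] /= e.
  by move: hn hm; rewrite e => hn hm; congr exist; exact: proof_irrelevance.
- move=> i; have [h _] := ring_ofP _ _ (ptD i).
  have [r1 [r2 [h1 h2]]] := annulus_shape _ _ _ h.
  by exists r1, r2; left; split.
- have key (i j : {n | first_point n}) x y : (proj1_sig i < proj1_sig j)%N ->
    annulus_of (pt i).1 (pt i).2 x y -> annulus_of (pt j).1 (pt j).2 x y -> False.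
    move=> hij hi hj; case: (proj2_sig j) => _ /(_ _ hij); apply; rewrite -/(pt i) -/(pt j).
    apply/(annulus_of_trans _ _ _ _ _ _ (ptD j) hj).
    apply/(annulus_of_trans _ _ _ _ _ _ (ptD i) hi); exact: annulus_of_self.
  move=> i j hij x y [hi hj].
  have [h|h|h] := ltngtP (proj1_sig i) (proj1_sig j); [exact: key h hi hj | exact: key h hj hi |].
  apply: hij; case: i j h {hi hj} => [n hn] [m hm] /= e.
  by move: hn hm; rewrite e => hn hm; congr exist; exact: proof_irrelevance.
- move=> x y; split; last by move=> [i]; exact: annulus_of_dom.
  move=> hd; have [n [hn hmin]] := least_nat _ (annulus_of_rational x y hd).
  have tr w z := annulus_of_trans x y _ _ w z hd hn.
  have fn : first_point n.
    split; first exact: annulus_of_dom hn.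
    by move=> m hm /tr; exact: hmin.
  exists (exist _ n fn); rewrite /pt /=; apply/tr; exact: annulus_of_self.
- move=> i x y; exact: annulus_ring.
Qed.

End Assembly.

(** * Change of sign, and the value at infinity *)

Lemma cont2_opp u : cont2 u -> cont2 (fun x y => - u x y).
Proof. move=> hu x y; apply: continuous_opp; exact: hu. Qed.

Lemma dx_opp u x y : dx (fun x y => - u x y) x y = - dx u x y.
Proof. exact: Derive_opp. Qed.

Lemma dy_opp u x y : dy (fun x y => - u x y) x y = - dy u x y.
Proof. exact: Derive_opp. Qed.

Lemma dx_ext u v : (forall x y, u x y = v x y) -> forall x y, dx u x y = dx v x y.
Proof. by move=> h x y; apply: Derive_ext => t. Qed.

Lemma dy_ext u v : (forall x y, u x y = v x y) -> forall x y, dy u x y = dy v x y.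
Proof. by move=> h x y; apply: Derive_ext => t. Qed.

Lemma Ck_ext k u v : (forall x y, u x y = v x y) -> Ck k u -> Ck k v.
Proof.
elim: k u v => [|k IH] u v h; first exact: cont2_ext.
move=> [h1 [h2 [h3 h4]]]; split; first exact: cont2_ext h1.
split; last by split; [apply: IH h3; exact: dx_ext | apply: IH h4; exact: dy_ext].
move=> x y; have [g1 g2] := h2 x y; split.
  by apply: ex_derive_ext g1 => t.
by apply: ex_derive_ext g2 => t.
Qed.

Lemma Ck_opp k u : Ck k u -> Ck k (fun x y => - u x y).
Proof.
elim: k u => [|k IH] u; first exact: cont2_opp.
move=> [h1 [h2 [h3 h4]]]; split; first exact: cont2_opp.
split; last split.
- move=> x y; have [g1 g2] := h2 x y.
  by split; [apply: (ex_derive_opp (fun t => u t y)) | apply: (ex_derive_opp (fun t => u x t))].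
- apply: (Ck_ext k (fun x y => - dx u x y)); last exact: IH.
  by move=> x y; rewrite dx_opp.
- apply: (Ck_ext k (fun x y => - dy u x y)); last exact: IH.
  by move=> x y; rewrite dy_opp.
Qed.

Lemma lap_opp u x y : lap (fun x y => - u x y) x y = - lap u x y.
Proof.
rewrite /lap (dx_ext _ (fun x y => - dx u x y)); last exact: dx_opp.
rewrite (dy_ext (dy (fun x y => - u x y)) (fun x y => - dy u x y)); last exact: dy_opp.
rewrite dx_opp dy_opp; ring.
Qed.

(** Outside of the box, a vertical and a horizontal segment join every point to the corner
    [(X + 1, X + 1)] without entering the box. *)
Lemma const_at_infinity psi M : Ck 1 psi ->
  (forall x y, M < dist2 x y 0 0 -> dx psi x y = 0 /\ dy psi x y = 0) ->
  exists X c, 0 < X /\ const_off_box X c psi.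
Proof.
move=> C1 hM; set X := Rmax M 1.
have X1 : 1 <= X by apply: Rmax_r. have XM : M <= X by apply: Rmax_l.
have far x y : X < Rabs x \/ X < Rabs y -> M < dist2 x y 0 0.
  move=> h; apply: (Rle_lt_trans _ X) => //.
  have p1 := pow2_ge_0 x; have p2 := pow2_ge_0 y.
  rewrite /dist2 !Rminus_0_r; case: h => h; apply: (Rlt_le_trans _ _ _ h);
    rewrite -sqrt_Rsqr_abs; apply: sqrt_le_1_alt; rewrite Rsqr_pow2; lra.
have gx x y : X < Rabs x \/ X < Rabs y -> dx psi x y = 0 by move=> /far /hM [].
have gy x y : X < Rabs x \/ X < Rabs y -> dy psi x y = 0 by move=> /far /hM [].
have vert x y y' : X < Rabs x -> psi x y = psi x y'.
  move=> h; have [t [_ e]] := mvt _ _ y y' (fun t => Ck_is_derive_y 0 psi x t C1).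
  rewrite gy in e; [lra | by left].
have horz x x' y : X < Rabs y -> psi x y = psi x' y.
  move=> h; have [t [_ e]] := mvt _ _ x x' (fun t => Ck_is_derive_x 0 psi t y C1).
  rewrite gx in e; [lra | by right].
have big : X < Rabs (X + 1) by rewrite Rabs_pos_eq; lra.
exists X, (psi (X + 1) (X + 1)); split; first lra.
move=> x y [h|h].
  by rewrite (vert x y (X + 1) h) (horz x (X + 1)).
by rewrite (horz x (X + 1) y h) (vert (X + 1) y (X + 1)).
Qed.

Lemma nonlinearity_at_infinity psi f X c : const_off_box X c psi -> 0 < X ->
  (forall x y, lap psi x y + f (psi x y) = 0) -> f c = 0.
Proof.
move=> box X0 eqn.
have big : X < Rabs (X + 1) by rewrite Rabs_pos_eq; lra.
have := eqn (X + 1) (X + 1); rewrite (box (X + 1)); last by left.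
have bx := dx_off_box _ _ _ (dx_off_box _ _ _ box).
have by_ := dy_off_box _ _ _ (dy_off_box _ _ _ box).
rewrite /lap bx ?by_; try (by left); lra.
Qed.

Theorem theoremA2 (psi : R -> R -> R) (f : R -> R) :
  Ck 3 psi ->
  (forall r : R, continuous f r) ->
  (forall x y : R, lap psi x y + f (psi x y) = 0) ->
  (* grad psi is compactly supported (i.e. vanishes outside a bounded set) *)
  (exists M : R, forall x y : R, M < dist2 x y 0 0 ->
       dx psi x y = 0 /\ dy psi x y = 0) ->
  exists (I : Type) (A : I -> R -> R -> Prop) (ca cb : I -> R),
    countable_type I /\
    (forall i : I, annulus_or_disk (A i) (ca i) (cb i)) /\
    (forall i j : I, i <> j -> forall x y : R, ~ (A i x y /\ A j x y)) /\
    (forall x y : R,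
        (dx psi x y <> 0 \/ dy psi x y <> 0) <-> exists i : I, A i x y) /\
    (forall (i : I) (x y x' y' : R), A i x y -> A i x' y' ->
        dist2 x y (ca i) (cb i) = dist2 x' y' (ca i) (cb i) ->
        psi x y = psi x' y').
Proof.
move=> C3 fc eqn [M hM].
have [X [c [X0 box]]] := const_at_infinity psi M (Ck_pred 1 _ (Ck_pred 2 _ C3)) hM.
have fc0 := nonlinearity_at_infinity psi f X c box X0 eqn.
have crit x y : psi x y = c -> dx psi x y = 0 /\ dy psi x y = 0.
  (* The unique continuation argument concerns nonconstant [psi]; for constant [psi] the gradient
     vanishes anyway. *)
  have [h|h] := classic (exists x y, psi x y <> c).
    exact: (regular_value_off_infinity psi f X c X0 C3 fc eqn box x y fc0 h).
  have h' u v : psi u v = c by apply: NNPP => h'; apply: h; exists u, v.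
  move=> _; split; apply: is_derive_unique.
    by apply: (is_derive_ext (fun _ => c)); [move=> t; rewrite h' | exact: is_derive_const].
  by apply: (is_derive_ext (fun _ => c)); [move=> t; rewrite h' | exact: is_derive_const].
pose phi x y := - psi x y; pose g t := - f (- t).
have C3' : Ck 3 phi := Ck_opp 3 psi C3.
have gc r : continuous g r.
  apply: (continuous_opp (fun t => f (- t))).
  apply: (continuous_comp Ropp f); last exact: fc.
  by apply: (continuous_opp (fun t : R => t)); exact: continuous_id.
have eqn' x y : lap phi x y + g (phi x y) = 0.
  rewrite lap_opp /g /phi Ropp_involutive; have := eqn x y; lra.
have box' : const_off_box X (- c) phi by move=> x y h; rewrite /phi box.
have fc0' : g (- c) = 0 by rewrite /g Ropp_involutive fc0 Ropp_0.
have crit' x y : phi x y = - c -> dx phi x y = 0 /\ dy phi x y = 0.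
  move=> h; have [e1 e2] := crit x y ltac:(rewrite /phi in h; lra).
  by rewrite dx_opp dy_opp e1 e2 Ropp_0.
(* Regular points never lie on the level [c]; those below it are above the level [- c] of [phi],
   which solves the equation with [g]. *)
pose Ring a b r := level_circle psi c a b r \/ level_circle phi (- c) a b r.
pose Dom x y := dx psi x y <> 0 \/ dy psi x y <> 0.
have circ x y a b r : 0 < r -> dist2 x y a b = r -> (x - a) ^ 2 + (y - b) ^ 2 = r ^ 2.
  move=> hr <-; rewrite /dist2 -[sqrt _ ^ 2]Rsqr_pow2 Rsqr_sqrt //.
  have := pow2_ge_0 (x - a); have := pow2_ge_0 (y - b); lra.
have circ' x y a b r : 0 < r -> (x - a) ^ 2 + (y - b) ^ 2 = r ^ 2 -> dist2 x y a b = r.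
  by move=> hr e; rewrite /dist2 e -Rsqr_pow2 sqrt_Rsqr; lra.
have pos a b r : Ring a b r -> 0 < r by case=> -[].
have act x y : Dom x y -> active psi c x y \/ active phi (- c) x y.
  move=> h; have N := sumsq_pos _ _ h.
  have [e|[l|l]] : psi x y = c \/ c < psi x y \/ psi x y < c by lra.
  - by have [e1 e2] := crit x y e; case: h; rewrite ?e1 ?e2.
  - by left.
  - right; split; first by rewrite /phi; lra.
    by rewrite dx_opp dy_opp; lra.
have ex x y : Dom x y -> exists a b r, Ring a b r /\ dist2 x y a b = r.
  case/act => h.
    have [r [h1 h2]] := active_circle psi f X c X0 C3 fc eqn box fc0 crit x y h.
    by do 3 eexists; split; [left; exact: h1 | apply: circ' => //; case: h1].
  have [r [h1 h2]] := active_circle phi g X (- c) X0 C3' gc eqn' box' fc0' crit' x y h.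
  by do 3 eexists; split; [right; exact: h1 | apply: circ' => //; case: h1].
(* Circles of the two kinds cannot meet, as [psi] is above [c] on the first and below on the
   second. *)
have levels x y a b r a' b' r' : level_circle psi c a b r -> level_circle phi (- c) a' b' r' ->
   (x - a) ^ 2 + (y - b) ^ 2 = r ^ 2 -> (x - a') ^ 2 + (y - b') ^ 2 = r' ^ 2 -> False.
  move=> h h' z z'; have [k _] := circle_active psi c _ _ _ _ _ h z.
  have [k' _] := circle_active phi (- c) _ _ _ _ _ h' z'; rewrite /phi in k'; lra.
have uniq a b r a' b' r' x y : Ring a b r -> Ring a' b' r' ->
  dist2 x y a b = r -> dist2 x y a' b' = r' -> a = a' /\ b = b'.
  move=> h h' /(circ _ _ _ _ _ (pos _ _ _ h)) z /(circ _ _ _ _ _ (pos _ _ _ h')) z'.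
  case: h h' => h [] h'.
  - by have [] := circle_unique psi c _ _ _ _ _ _ _ _ h h' z z'.
  - by case: (levels _ _ _ _ _ _ _ _ h h' z z').
  - by case: (levels _ _ _ _ _ _ _ _ h' h z' z).
  - by have [] := circle_unique phi (- c) _ _ _ _ _ _ _ _ h h' z z'.
have op a b r : Ring a b r -> exists e, 0 < e /\ forall s, Rabs (s - r) < e -> Ring a b s.
  case=> h.
    have [e [e0 he]] := circle_open psi f X c X0 C3 fc eqn box fc0 crit _ _ _ h.
    by exists e; split=> // s hs; left; exact: he.
  have [e [e0 he]] := circle_open phi g X (- c) X0 C3' gc eqn' box' fc0' crit' _ _ _ h.
  by exists e; split=> // s hs; right; exact: he.
have dom a b r x y : Ring a b r -> dist2 x y a b = r -> Dom x y.
  move=> h /(circ _ _ _ _ _ (pos _ _ _ h)) z; apply: NNPP => hn.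
  have e1 : dx psi x y = 0 by apply: NNPP => k; apply: hn; left.
  have e2 : dy psi x y = 0 by apply: NNPP => k; apply: hn; right.
  case: h => h.
    by have [_] := circle_active psi c _ _ _ _ _ h z; rewrite e1 e2; lra.
  by have [_] := circle_active phi (- c) _ _ _ _ _ h z; rewrite dx_opp dy_opp e1 e2; lra.
have bd x y : Dom x y -> Rabs x <= X /\ Rabs y <= X.
  move=> h; split; apply: Rnot_lt_le => hx; (case: h; [apply; apply: dx_off_box box _ _ _ | apply; apply: dy_off_box box _ _ _]);
    by [left | right].
have [I [A [ca [cb [h1 [h2 [h3 [h4 h5]]]]]]]] := annuli_decomposition Dom Ring X pos ex uniq op dom bd.
exists I, A, ca, cb; do 4 (split => //).
move=> i x y x' y' /h5 hr _ e.
have p := pos _ _ _ hr.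
have z := circ _ _ _ _ _ p erefl; have z' := circ x' y' _ _ _ p (esym e).
case: hr => -[_ [h [mu [_ _ on _]]]].
  by have [-> _ _] := on _ _ z; have [-> _ _] := on _ _ z'.
have [k _ _] := on _ _ z; have [k' _ _] := on _ _ z'; rewrite /phi in k k'; lra.
Qed.
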